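(* Let the Hamiltonian $(H_0,H_1)$ be ideal and let $\rho_d$ be a generic stationary target state ($[H_0,\rho_d]=0$). Then for the system $$\dot\rho(t)=-i[H_0+f(\rho)H_1,\rho(t)],\qquad f(\rho)=\mathrm{Tr}([-iH_1,\rho(t)]\rho_d)$$ on $\mathcal{M}$, almost all initial states converge to $\rho_d$: the set of initial states $\rho(0)\in\mathcal{M}$ whose solution does not converge to $\rho_d$ as $t\to+\infty$ has measure zero in $\mathcal{M}$.
   Context: A density operator is a positive semidefinite Hermitian $n\times n$ matrix of trace $1$; it is generic if it has $n$ distinct eigenvalues. $\mathcal{M}$ is the compact manifold (of dimension $n^2-n$) of density operators with the same spectrum as $\rho_d$. $H_0,H_1$ are Hermitian; one works in a basis in which $H_0=\mathrm{diag}(a_1,\ldots,a_n)$, $a_1\ge\cdots\ge a_n$. With $\omega_{k\ell}=a_\ell-a_k$ and $b_{k\ell}$ the $(k,\ell)$ entry of $H_1$, the Hamiltonian is ideal if (i) for $k\ne\ell$, $p\ne q$, $\omega_{k\ell}\ne\omega_{pq}$ unless $(k,\ell)=(p,q)$; and (ii) $b_{k\ell}\ne0$ except (possibly) for $k=\ell$. $[A,B]=AB-BA$. Measure zero refers to the smooth (Lebesgue) measure class on $\mathcal M$. *)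

(* Defs.v *)
From HB Require Import structures.
From mathcomp Require Import all_boot all_order all_algebra.
From mathcomp Require Import sesquilinear spectral complex.
From mathcomp Require Import all_classical all_reals all_analysis.

Set Implicit Arguments.
Unset Strict Implicit.
Unset Printing Implicit Defensive.

Import Order.TTheory GRing.Theory Num.Theory.
Import numFieldNormedType.Exports.

Local Open Scope classical_set_scope.
Local Open Scope ring_scope.
Local Open Scope complex_scope.
Local Open Scope sesquilinear_scope.

(* R[i] carries no R-normed-module structure; the topology and the real
   differential structure of the space of complex matrices are those of the
   pairs (real part, imaginary part). *)
Definition realify (R : realType) n (A : 'M[R[i]]_n) : 'M[R]_n * 'M[R]_n :=
  (map_mx (@complex.Re R) A, map_mx (@complex.Im R) A).

Section quantum.
Variables (R : realType) (n : nat).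
Local Notation C := R[i].
Implicit Types A B rho rhod : 'M[C]_n.

Definition commutator A B : 'M[C]_n := A *m B - B *m A.

Definition posdefsemi A : Prop :=
  forall v : 'cV[C]_n, 0 <= (v ^t* *m A *m v) 0 0.

Definition density A : Prop :=
  [/\ A \is hermsymmx, posdefsemi A & \tr A = 1].

Definition generic A : Prop :=
  exists s : seq C,
    [/\ uniq s, size s = n & forall x, x \in s -> eigenvalue A x].

(* Equality of the characteristic polynomials is equality of the spectra,
   counted with multiplicities. *)
Definition isospectral rhod : set 'M[C]_n :=
  [set rho | density rho /\ char_poly rho = char_poly rhod].

(* The rows of U are the adjoints of the vectors of an orthonormal eigenbasis
   of H0, so that U *m A *m U ^t* is the matrix of A in that basis. *)
Definition ideal (H0 H1 : 'M[C]_n) : Prop :=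
  exists (U : 'M[C]_n) (a : 'rV[R]_n),
    let b := U *m H1 *m U ^t* in
    let omega k l := a 0 l - a 0 k in
    [/\ U \is unitarymx,
        U *m H0 *m U ^t* = diag_mx (map_mx (fun x : R => x%:C) a),
        (forall k l : 'I_n, (k <= l)%N -> a 0 l <= a 0 k),
        (forall k l p q : 'I_n, k != l -> p != q ->
           omega k l = omega p q -> (k, l) = (p, q)) &
        (forall k l : 'I_n, k != l -> b k l != 0)].

Definition feedback (H1 : 'M[C]_n) rhod rho : C :=
  \tr (commutator (- 'i *: H1) rho *m rhod).

Definition closed_loop (H0 H1 : 'M[C]_n) rhod rho : 'M[C]_n :=
  - 'i *: commutator (H0 + feedback H1 rhod rho *: H1) rho.

(* Solution of the initial value problem on [0, +oo[; its values at negative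
   times are irrelevant. *)
Definition solution (H0 H1 : 'M[C]_n) rhod (rho0 : 'M[C]_n) (rho : R -> 'M[C]_n) : Prop :=
  [/\ rho 0 = rho0,
      forall t : R, 0 <= t -> isospectral rhod (rho t),
      realify (rho t) @[t --> 0^'+] --> realify (rho 0) &
      forall t : R, 0 < t ->
        is_derive t 1 (fun s : R => realify (rho s))
          (realify (closed_loop H0 H1 rhod (rho t)))].

(* Existence of a solution is part of the property, so that it is not
   vacuously true; solutions being unique, "every solution" is "the
   solution". *)
Definition attracted (H0 H1 : 'M[C]_n) rhod (rho0 : 'M[C]_n) : Prop :=
  (exists rho : R -> 'M[C]_n, solution H0 H1 rhod rho0 rho) /\
  (forall rho : R -> 'M[C]_n, solution H0 H1 rhod rho0 rho ->
     realify (rho t) @[t --> +oo] --> realify rhod).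

End quantum.

Section measure_zero.
Variables (R : realType) (d : nat).

(* The index set of the covering may be finite or empty: for d = 0 every box
   is the whole one-point space and has volume 1. *)
Definition lebesgue_null (A : set 'rV[R]_d) : Prop :=
  forall e : R, 0 < e ->
  exists (I : set nat) (a b : nat -> 'rV[R]_d),
    [/\ forall k j, a k 0 j <= b k 0 j,
        A `<=` \bigcup_(k in I) [set x | forall j, a k 0 j <= x 0 j <= b k 0 j] &
        (\esum_(k in I) (\prod_(j < d) (b k 0 j - a k 0 j))%:E <= e%:E)%E].

Fixpoint iter_partial (W : normedModType R) (s : seq 'I_d)
    (g : 'rV[R]_d -> W) : 'rV[R]_d -> W :=
  if s is j :: s' then fun x => 'D_(delta_mx 0 j) (iter_partial s' g) x else g.

(* C^infinity on the open set V: the partial derivatives of all orders exist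
   and are differentiable, hence continuous. *)
Definition smooth_on (W : normedModType R) (V : set 'rV[R]_d)
    (g : 'rV[R]_d -> W) : Prop :=
  forall (s : seq 'I_d) x, V x -> differentiable (iter_partial s g) x.

(* phi : V -> M is the inverse of a chart of the d-dimensional embedded
   submanifold M: an injective smooth immersion which is a homeomorphism onto
   a relatively open subset of M. *)
Definition parametrization n (M : set 'M[R[i]]_n) (V : set 'rV[R]_d)
    (phi : 'rV[R]_d -> 'M[R[i]]_n) : Prop :=
  let g := fun x => realify (phi x) in
  [/\ open V,
      smooth_on V g,
      (forall x, V x -> injective ('d g x)),
      {in V &, injective phi} &
      (forall W : set 'rV[R]_d, open W -> W `<=` V ->
         exists2 O : set ('M[R]_n * 'M[R]_n), open O &
           phi @` W = M `&` (@realify R n @^-1` O))].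

Definition measure_zero n (M S : set 'M[R[i]]_n) : Prop :=
  forall (V : set 'rV[R]_d) (phi : 'rV[R]_d -> 'M[R[i]]_n),
    parametrization M V phi -> lebesgue_null (V `&` phi @^-1` S).

End measure_zero.

(* Main.v *)
(** In an eigenbasis of [H0] the free evolution rotates the off-diagonal entries of [rho]
    with pairwise distinct frequencies, and the feedback [f] is a linear form in these
    entries all of whose coefficients [c_kl] are nonzero.  Along solutions
    [V = Tr (rho rhod)] satisfies [V' = f^2].  Because the frequencies are distinct, [f^2]
    differs from [sum |c_kl|^2 |rho_kl|^2] by the derivative, along the free rotation, of a
    quadratic form [K], so [A V - K] is a strict Lyapunov function for large [A]: the
    off-diagonal part tends to [0] and every solution converges to a diagonal matrix, whose
    diagonal is a permutation [s] of that of [rhod].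

    Near such a limit with [s <> 1], let [Q] be the second variation of [V].  The same
    correction makes [A Q - K] grow along the difference of any two solutions which stay
    near the limit; since that difference stays bounded, the form is never positive on it.
    An inversion of [s] provides a direction in which the form is positive, so the states
    trapped near the limit form a Lipschitz graph over the remaining [n^2 - n - 1]
    off-diagonal coordinates.  Going back to time [0] with Gronwall's inequality and to a
    chart with the immersion property, the exceptional set is a countable union of pieces
    that map to a space of dimension [n^2 - n - 1] with Lipschitz inverse, hence a null
    set. *)

(* Existence is part of [attracted], so solutions are built first. On trace-one matrices the closed
   loop is a homogeneous quadratic equation; its power series converges for a time common to all
   states of the orbit, so local solutions can be chained forever.

   The obstacle is that [f] vanishes far beyond the diagonal matrices, so that [V] alone yields
   neither convergence nor instability. The correction [K] depends only on the free rotation, hence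
   serves both for solutions and for differences of solutions. The control terms that it leaves over
   are either of size [|off| |f|], absorbed once [A] is large, or of second order, absorbed once the
   neighbourhood of the saddle is small.

   At a saddle no spectrum is computed and no invariant manifold is constructed: one direction where
   [A Q - K] is positive removes one dimension, which is enough for measure zero. The off-diagonal
   coordinates suffice because, near a diagonal matrix with distinct entries, the diagonal of the
   difference of two isospectral matrices is a small fraction of the whole difference. *)
Require Import Defs.
From HB Require Import structures.
From mathcomp Require Import all_boot all_order all_algebra.
From mathcomp Require Import sesquilinear spectral complex.
From mathcomp Require Import all_classical all_reals all_analysis.
From mathcomp Require Import perm ring lra.

Set Implicit Arguments.
Unset Strict Implicit.
Unset Printing Implicit Defensive.

Import Order.TTheory GRing.Theory Num.Theory.
Import numFieldNormedType.Exports.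

Local Open Scope classical_set_scope.
Local Open Scope ring_scope.
Local Open Scope complex_scope.
Local Open Scope sesquilinear_scope.

(** * Complex matrices and their limits and derivatives *)

Section complex_numbers.
Variable R : realType.
Local Notation C := R[i].
Local Notation Re := (@complex.Re R).
Local Notation Im := (@complex.Im R).
Implicit Types x y z : C.

Lemma cReD x y : Re (x + y) = Re x + Re y. Proof. by case: x y => [? ?] [? ?]. Qed.
Lemma cImD x y : Im (x + y) = Im x + Im y. Proof. by case: x y => [? ?] [? ?]. Qed.
Lemma cReN x : Re (- x) = - Re x. Proof. by case: x. Qed.
Lemma cImN x : Im (- x) = - Im x. Proof. by case: x. Qed.
Lemma cReB x y : Re (x - y) = Re x - Re y. Proof. by rewrite cReD cReN. Qed.
Lemma cImB x y : Im (x - y) = Im x - Im y. Proof. by rewrite cImD cImN. Qed.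
Lemma cReM x y : Re (x * y) = Re x * Re y - Im x * Im y.
Proof. by case: x y => [? ?] [? ?]. Qed.
Lemma cImM x y : Im (x * y) = Re x * Im y + Im x * Re y.
Proof. by case: x y => [? ?] [? ?]. Qed.
Lemma cReJ x : Re (Num.conj x) = Re x. Proof. by case: x. Qed.
Lemma cImJ x : Im (Num.conj x) = - Im x. Proof. by case: x. Qed.
Lemma cRe_i : Re 'i = 0. Proof. by []. Qed.
Lemma cIm_i : Im 'i = 1. Proof. by []. Qed.
Lemma cRe_real (a : R) : Re a%:C = a. Proof. by []. Qed.
Lemma cIm_real (a : R) : Im a%:C = 0. Proof. by []. Qed.

Definition ReImE := (cReD, cImD, cReN, cImN, cReM, cImM, cReJ, cImJ, cRe_i, cIm_i, cRe_real, cIm_real).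

Lemma ReIm_eq x y : Re x = Re y -> Im x = Im y -> x = y.
Proof. by case: x y => [? ?] [? ?] /= -> ->. Qed.

Lemma conjCR (a : R) : Num.conj a%:C = a%:C :> C. Proof. exact: conjc_real. Qed.

Lemma conj_realE x : Num.conj x = x -> x = (Re x)%:C.
Proof.
move=> h; apply: ReIm_eq => //; rewrite cIm_real.
by have := congr1 Im h; rewrite cImJ; lra.
Qed.

Lemma cRe_sum I (r : seq I) (P : pred I) (F : I -> C) :
  Re (\sum_(i <- r | P i) F i) = \sum_(i <- r | P i) Re (F i).
Proof. by apply: (big_morph Re cReD). Qed.

Lemma cIm_sum I (r : seq I) (P : pred I) (F : I -> C) :
  Im (\sum_(i <- r | P i) F i) = \sum_(i <- r | P i) Im (F i).
Proof. by apply: (big_morph Im cImD). Qed.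

(** The l1 norm of the real and imaginary parts: it has values in [R], is submultiplicative, and
    [sq_le_nm] and [nm_le_sq] compare its square with the squared modulus. *)
Definition nm z : R := `|Re z| + `|Im z|.

Lemma nm_ge0 z : 0 <= nm z. Proof. by rewrite addr_ge0. Qed.
Lemma nm0 : nm 0 = 0. Proof. by rewrite /nm normr0 addr0. Qed.
Lemma nmN z : nm (- z) = nm z. Proof. by rewrite /nm !ReImE !normrN. Qed.
Lemma nmJ z : nm (Num.conj z) = nm z. Proof. by rewrite /nm !ReImE normrN. Qed.
Lemma nm_real (a : R) : nm a%:C = `|a|. Proof. by rewrite /nm !ReImE normr0 addr0. Qed.
Lemma nm_i : nm 'i = 1. Proof. by rewrite /nm cRe_i cIm_i normr0 normr1 add0r. Qed.
Lemma nmD x y : nm (x + y) <= nm x + nm y.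
Proof.
rewrite /nm !ReImE.
by have := ler_normD (Re x) (Re y); have := ler_normD (Im x) (Im y); lra.
Qed.

Lemma nmM x y : nm (x * y) <= nm x * nm y.
Proof.
rewrite /nm !ReImE.
have := ler_normD (Re x * Re y) (- (Im x * Im y)).
have := ler_normD (Re x * Im y) (Im x * Re y).
by rewrite normrN !normrM; lra.
Qed.

Lemma nm_eq0 z : nm z <= 0 -> z = 0.
Proof.
move=> h; have hr := normr_ge0 (Re z); have hi := normr_ge0 (Im z).
by apply: ReIm_eq => /=; apply/eqP; rewrite -normr_le0 -/(nm z); move: h; rewrite /nm; lra.
Qed.

Lemma nm_sum I (r : seq I) (P : pred I) (F : I -> C) :
  nm (\sum_(i <- r | P i) F i) <= \sum_(i <- r | P i) nm (F i).
Proof.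
elim/big_ind2 : _ => //; first by rewrite nm0.
by move=> x1 x2 y1 y2 h1 h2; apply: (le_trans (nmD _ _)); apply: lerD.
Qed.

Lemma Re_le_nm z : `|Re z| <= nm z. Proof. by rewrite lerDl. Qed.
Lemma Im_le_nm z : `|Im z| <= nm z. Proof. by rewrite lerDr. Qed.

Definition sq z : R := Re z ^+ 2 + Im z ^+ 2.

Lemma sqE z : (sq z)%:C = z * Num.conj z.
Proof. by apply: ReIm_eq; rewrite !ReImE /sq; ring. Qed.

Lemma sq_ge0 z : 0 <= sq z. Proof. by rewrite addr_ge0 // sqr_ge0. Qed.

Lemma sq_le_nm z : sq z <= nm z ^+ 2.
Proof.
rewrite /sq /nm -(real_normK (num_real (Re z))) -(real_normK (num_real (Im z))).
by have := normr_ge0 (Re z); have := normr_ge0 (Im z); nra.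
Qed.

Lemma nm_le_sq z : nm z ^+ 2 <= 2 * sq z.
Proof.
rewrite /sq /nm -(real_normK (num_real (Re z))) -(real_normK (num_real (Im z))).
have := sqr_ge0 (`|Re z| - `|Im z|); nra.
Qed.

End complex_numbers.

Section complex_limits.
Variable R : realType.
Local Notation C := R[i].
Local Notation Re := (@complex.Re R).
Local Notation Im := (@complex.Im R).

(** Limits and derivatives are taken componentwise so that they match [realify]; [realify_cvgP] and
    [realify_deriveP] translate the definition of a solution into this language. *)
Definition ccvg T (F : set_system T) (u : T -> C) (l : C) :=
  (Re (u t) @[t --> F] --> Re l) /\ (Im (u t) @[t --> F] --> Im l).

Definition cder (u : R -> C) (t : R) (l : C) :=
  is_derive t 1 (fun s => Re (u s)) (Re l) /\ is_derive t 1 (fun s => Im (u s)) (Im l).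

Section cvg.
Variables (T : Type) (F : set_system T) (FF : ProperFilter F).
Implicit Types u v : T -> C.

Lemma ccvg_cst a : ccvg F (fun=> a) a.
Proof. by split; apply: cvg_cst. Qed.

Lemma ccvgD u v a b : ccvg F u a -> ccvg F v b -> ccvg F (fun t => u t + v t) (a + b).
Proof.
by move=> [u1 u2] [v1 v2]; split; rewrite !ReImE; under eq_fun do rewrite !ReImE;
  apply: cvgD.
Qed.

Lemma ccvgN u a : ccvg F u a -> ccvg F (fun t => - u t) (- a).
Proof.
by move=> [u1 u2]; split; rewrite !ReImE; under eq_fun do rewrite !ReImE; apply: cvgN.
Qed.

Lemma ccvgB u v a b : ccvg F u a -> ccvg F v b -> ccvg F (fun t => u t - v t) (a - b).
Proof. by move=> ua vb; apply: ccvgD => //; apply: ccvgN. Qed.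

Lemma ccvgM u v a b : ccvg F u a -> ccvg F v b -> ccvg F (fun t => u t * v t) (a * b).
Proof.
by move=> [u1 u2] [v1 v2]; split; rewrite !ReImE; under eq_fun do rewrite !ReImE;
  [apply: cvgB|apply: cvgD]; apply: cvgM.
Qed.

Lemma ccvgJ u a : ccvg F u a -> ccvg F (fun t => Num.conj (u t)) (Num.conj a).
Proof.
move=> [u1 u2]; split; rewrite !ReImE; under eq_fun do rewrite !ReImE;
  [exact: u1|exact: cvgN].
Qed.

Lemma ccvg_sum I (r : seq I) (P : pred I) (u : I -> T -> C) (a : I -> C) :
  (forall i, P i -> ccvg F (u i) (a i)) ->
  ccvg F (fun t => \sum_(i <- r | P i) u i t) (\sum_(i <- r | P i) a i).
Proof.
move=> h; elim: r => [|i r IHr].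
  under eq_fun do rewrite big_nil; rewrite big_nil; exact: ccvg_cst.
under eq_fun do rewrite big_cons; rewrite big_cons.
by have [Pi|_] := boolP (P i); [apply: ccvgD => //; apply: h|].
Qed.

Lemma ccvg_prod I (r : seq I) (P : pred I) (u : I -> T -> C) (a : I -> C) :
  (forall i, P i -> ccvg F (u i) (a i)) ->
  ccvg F (fun t => \prod_(i <- r | P i) u i t) (\prod_(i <- r | P i) a i).
Proof.
move=> h; elim: r => [|i r IHr].
  under eq_fun do rewrite big_nil; rewrite big_nil; exact: ccvg_cst.
under eq_fun do rewrite big_cons; rewrite big_cons.
by have [Pi|_] := boolP (P i); [apply: ccvgM => //; apply: h|].
Qed.

Lemma ccvg_unique u a b : ccvg F u a -> ccvg F u b -> a = b.
Proof.
by move=> [u1 u2] [v1 v2]; apply: ReIm_eq;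
  [apply: (cvg_unique (@Rhausdorff R) u1 v1)|apply: (cvg_unique (@Rhausdorff R) u2 v2)].
Qed.

Lemma ccvg_nm u a : ccvg F u a -> nm (u t - a) @[t --> F] --> 0.
Proof.
move=> [u1 u2]; rewrite /nm -[X in _ --> X]addr0; apply: cvgD; rewrite -(normr0 R);
  apply: cvg_norm.
  under eq_fun do rewrite cReB; rewrite -(subrr (Re a)).
  by apply: cvgB => //; apply: cvg_cst.
under eq_fun do rewrite cImB; rewrite -(subrr (Im a)).
by apply: cvgB => //; apply: cvg_cst.
Qed.

End cvg.

Implicit Types u v : R -> C.

Lemma cder_cst a t : cder (fun=> a) t 0.
Proof. by split; apply: is_derive_cst. Qed.

Lemma cderD u v t a b : cder u t a -> cder v t b -> cder (fun t => u t + v t) t (a + b).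
Proof.
by move=> [u1 u2] [v1 v2]; split; rewrite !ReImE; under eq_fun do rewrite !ReImE;
  apply: is_deriveD.
Qed.

Lemma cderN u t a : cder u t a -> cder (fun t => - u t) t (- a).
Proof.
by move=> [u1 u2]; split; rewrite !ReImE; under eq_fun do rewrite !ReImE; apply: is_deriveN.
Qed.

Lemma cderB u v t a b : cder u t a -> cder v t b -> cder (fun t => u t - v t) t (a - b).
Proof. by move=> ua vb; apply: cderD => //; apply: cderN. Qed.

Lemma cderM u v t a b : cder u t a -> cder v t b ->
  cder (fun t => u t * v t) t (a * v t + u t * b).
Proof.
move=> [u1 u2] [v1 v2]; split; under eq_fun do rewrite !ReImE.
  have h := is_deriveB (is_deriveM u1 v1) (is_deriveM u2 v2).
  by apply: (is_derive_eq h); rewrite /GRing.scale /= !ReImE; ring.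
have h := is_deriveD (is_deriveM u1 v2) (is_deriveM u2 v1).
by apply: (is_derive_eq h); rewrite /GRing.scale /= !ReImE; ring.
Qed.

Lemma cderJ u t a : cder u t a -> cder (fun t => Num.conj (u t)) t (Num.conj a).
Proof.
move=> [u1 u2]; split; rewrite !ReImE; under eq_fun do rewrite !ReImE;
  [exact: u1|exact: is_deriveN].
Qed.

Lemma cder_sum I (r : seq I) (P : pred I) (u : I -> R -> C) t (a : I -> C) :
  (forall i, P i -> cder (u i) t (a i)) ->
  cder (fun t => \sum_(i <- r | P i) u i t) t (\sum_(i <- r | P i) a i).
Proof.
move=> h; elim: r => [|i r IHr].
  under eq_fun do rewrite big_nil; rewrite big_nil; exact: cder_cst.
under eq_fun do rewrite big_cons; rewrite big_cons.
by have [Pi|_] := boolP (P i); [apply: cderD => //; apply: h|].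
Qed.

Lemma cder_eq u t a b : cder u t a -> a = b -> cder u t b.
Proof. by move=> h <-. Qed.

Lemma cder_ccvg u t a : cder u t a -> ccvg (nbhs t) u (u t).
Proof.
move=> [[h1 _] [h2 _]]; split.
  by have /derivable1_diffP/differentiable_continuous := h1.
by have /derivable1_diffP/differentiable_continuous := h2.
Qed.

End complex_limits.

Section matrices.
Variable R : realType.
Local Notation C := R[i].
Local Notation Re := (@complex.Re R).
Local Notation Im := (@complex.Im R).

Definition mnorm m n (A : 'M[C]_(m, n)) : R := \sum_i \sum_j nm (A i j).

Section norm.
Variables (m n : nat).
Implicit Types A B : 'M[C]_(m, n).

Lemma mnorm_ge0 A : 0 <= mnorm A.
Proof. by apply: sumr_ge0 => i _; apply: sumr_ge0 => j _; apply: nm_ge0. Qed.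

Lemma mnorm0 : mnorm (0 : 'M[C]_(m, n)) = 0.
Proof. by rewrite /mnorm big1 // => i _; rewrite big1 // => j _; rewrite mxE nm0. Qed.

Lemma mnormN A : mnorm (- A) = mnorm A.
Proof. by apply: eq_bigr => i _; apply: eq_bigr => j _; rewrite mxE nmN. Qed.

Lemma mnormD A B : mnorm (A + B) <= mnorm A + mnorm B.
Proof.
rewrite /mnorm -big_split; apply: ler_sum => i _; rewrite -big_split.
by apply: ler_sum => j _; rewrite mxE nmD.
Qed.

Lemma mnormB A B : mnorm (A - B) <= mnorm A + mnorm B.
Proof. by rewrite -(mnormN B) mnormD. Qed.

Lemma mnormZ a A : mnorm (a *: A) <= nm a * mnorm A.
Proof.
rewrite mulr_sumr; apply: ler_sum => i _; rewrite mulr_sumr.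
by apply: ler_sum => j _; rewrite mxE nmM.
Qed.

Lemma nm_le_mnorm A i j : nm (A i j) <= mnorm A.
Proof.
rewrite /mnorm (bigD1 i) //= (bigD1 j) //= -addrA lerDl addr_ge0 //.
  by apply: sumr_ge0 => k _; apply: nm_ge0.
by apply: sumr_ge0 => k _; apply: sumr_ge0 => l _; apply: nm_ge0.
Qed.

Lemma mnorm_le A (c : R) : (forall i j, nm (A i j) <= c) -> mnorm A <= m%:R * n%:R * c.
Proof.
move=> h; have -> : m%:R * n%:R * c = \sum_(i < m) \sum_(j < n) c.
  by rewrite !sumr_const !card_ord -mulrA !mulr_natl.
by apply: ler_sum => i _; apply: ler_sum => j _.
Qed.

Lemma mnorm_sum I (r : seq I) (P : pred I) (F : I -> 'M[C]_(m, n)) :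
  mnorm (\sum_(i <- r | P i) F i) <= \sum_(i <- r | P i) mnorm (F i).
Proof.
elim/big_ind2 : _ => //; first by rewrite mnorm0.
by move=> x1 x2 y1 y2 h1 h2; apply: (le_trans (mnormD _ _)); apply: lerD.
Qed.

End norm.

Lemma mnormM m n p (A : 'M[C]_(m, n)) (B : 'M[C]_(n, p)) :
  mnorm (A *m B) <= mnorm A * mnorm B.
Proof.
rewrite /mnorm mulr_suml; apply: ler_sum => i _.
apply: (@le_trans _ _ (\sum_k \sum_j nm (A i j) * nm (B j k))).
  apply: ler_sum => k _; rewrite mxE; apply: (le_trans (nm_sum _ _ _)).
  by apply: ler_sum => j _; apply: nmM.
rewrite exchange_big mulr_suml; apply: ler_sum => j _.
rewrite -mulr_sumr; apply: ler_wpM2l; first exact: nm_ge0.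
rewrite (bigD1 j) //= lerDl; apply: sumr_ge0 => k _.
by apply: sumr_ge0 => l _; apply: nm_ge0.
Qed.

Lemma nm_trace n (A : 'M[C]_n) : nm (\tr A) <= mnorm A.
Proof.
apply: (le_trans (nm_sum _ _ _)); apply: ler_sum => i _.
by rewrite (bigD1 i) //= lerDl; apply: sumr_ge0 => j _; apply: nm_ge0.
Qed.

Lemma mnorm_commutator n (A B : 'M[C]_n) :
  mnorm (commutator A B) <= 2 * mnorm A * mnorm B.
Proof.
apply: (le_trans (mnormB _ _)).
have := mnormM A B; have := mnormM B A; lra.
Qed.

Definition mcvg T m n (F : set_system T) (A : T -> 'M[C]_(m, n)) (L : 'M[C]_(m, n)) :=
  forall i j, ccvg F (fun t => A t i j) (L i j).

Definition mder m n (A : R -> 'M[C]_(m, n)) (t : R) (L : 'M[C]_(m, n)) :=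
  forall i j, cder (fun t => A t i j) t (L i j).

Section calculus.
Variables (T : Type) (F : set_system T) (FF : ProperFilter F).

Lemma mcvg_cst m n (A : 'M[C]_(m, n)) : mcvg F (fun=> A) A.
Proof. by move=> i j; apply: ccvg_cst. Qed.

Lemma mcvgB m n (A B : T -> 'M[C]_(m, n)) a b :
  mcvg F A a -> mcvg F B b -> mcvg F (fun t => A t - B t) (a - b).
Proof.
by move=> hA hB i j; under eq_fun do rewrite !mxE; rewrite !mxE; apply: ccvgB.
Qed.

Lemma mcvgD m n (A B : T -> 'M[C]_(m, n)) a b :
  mcvg F A a -> mcvg F B b -> mcvg F (fun t => A t + B t) (a + b).
Proof.
by move=> hA hB i j; under eq_fun do rewrite !mxE; rewrite !mxE; apply: ccvgD.
Qed.

Lemma mcvgZ m n (u : T -> C) (A : T -> 'M[C]_(m, n)) c a :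
  ccvg F u c -> mcvg F A a -> mcvg F (fun t => u t *: A t) (c *: a).
Proof.
by move=> hu hA i j; under eq_fun do rewrite !mxE; rewrite !mxE; apply: ccvgM.
Qed.

Lemma mcvg_trace n (A : T -> 'M[C]_n) a : mcvg F A a -> ccvg F (fun t => \tr (A t)) (\tr a).
Proof. by move=> hA; apply: ccvg_sum => i _; apply: hA. Qed.

Lemma mcvgM m n p (A : T -> 'M[C]_(m, n)) (B : T -> 'M[C]_(n, p)) a b :
  mcvg F A a -> mcvg F B b -> mcvg F (fun t => A t *m B t) (a *m b).
Proof.
move=> hA hB i j; under eq_fun do rewrite !mxE; rewrite !mxE.
by apply: ccvg_sum => k _; apply: ccvgM.
Qed.

Lemma mcvg_det n (A : T -> 'M[C]_n) a : mcvg F A a -> ccvg F (fun t => \det (A t)) (\det a).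
Proof.
move=> hA; rewrite /determinant; apply: ccvg_sum => s _; apply: ccvgM.
  exact: ccvg_cst.
by apply: ccvg_prod => i _; apply: hA.
Qed.

Lemma cvg_sumr I (r : seq I) (u : I -> T -> R) (l : I -> R) :
  (forall i, u i t @[t --> F] --> l i) ->
  \sum_(i <- r) u i t @[t --> F] --> \sum_(i <- r) l i.
Proof.
move=> h; elim: r => [|i r IHr].
  under eq_fun do rewrite big_nil; rewrite big_nil; exact: cvg_cst.
by under eq_fun do rewrite big_cons; rewrite big_cons; apply: cvgD.
Qed.

Lemma mcvg_norm m n (A : T -> 'M[C]_(m, n)) a :
  mcvg F A a -> mnorm (A t - a) @[t --> F] --> 0.
Proof.
move=> hA; rewrite /mnorm.
rewrite [X in _ --> X](_ : 0 = \sum_(i < m) \sum_(j < n) 0); last first.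
  by rewrite big1 // => i _; rewrite big1.
apply: cvg_sumr => i; apply: cvg_sumr => j.
by under eq_fun do rewrite !mxE; apply: ccvg_nm.
Qed.

End calculus.

Lemma mder_cst m n (A : 'M[C]_(m, n)) t : mder (fun=> A) t 0.
Proof. by move=> i j; rewrite mxE; apply: cder_cst. Qed.

Lemma mderB m n (A B : R -> 'M[C]_(m, n)) t a b :
  mder A t a -> mder B t b -> mder (fun t => A t - B t) t (a - b).
Proof.
by move=> hA hB i j; under eq_fun do rewrite !mxE; rewrite !mxE; apply: cderB.
Qed.

Lemma mderM m n p (A : R -> 'M[C]_(m, n)) (B : R -> 'M[C]_(n, p)) t a b :
  mder A t a -> mder B t b -> mder (fun t => A t *m B t) t (a *m B t + A t *m b).
Proof.
move=> hA hB i j; under eq_fun do rewrite !mxE; rewrite !mxE -big_split.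
by apply: cder_sum => k _; apply: cderM.
Qed.

Lemma mder_adj m n (A : R -> 'M[C]_(m, n)) t a :
  mder A t a -> mder (fun t => (A t) ^t*) t (a ^t*).
Proof.
by move=> hA i j; under eq_fun do rewrite !mxE; rewrite !mxE; apply: cderJ.
Qed.

Lemma cder_trace n (A : R -> 'M[C]_n) t a : mder A t a -> cder (fun t => \tr (A t)) t (\tr a).
Proof. by move=> hA; apply: cder_sum => i _; apply: hA. Qed.

Lemma mder_mcvg m n (A : R -> 'M[C]_(m, n)) t a : mder A t a -> mcvg (nbhs t) A (A t).
Proof. by move=> hA i j; apply: cder_ccvg (hA i j). Qed.

Lemma realify_cvgP n (F : set_system R) (FF : ProperFilter F) (A : R -> 'M[C]_n) L :
  realify (A t) @[t --> F] --> realify L <-> mcvg F A L.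
Proof.
split.
  move=> h i j.
  have h1 : (realify (A t)).1 @[t --> F] --> (realify L).1 by apply: cvg_comp h _; apply: cvg_fst.
  have h2 : (realify (A t)).2 @[t --> F] --> (realify L).2 by apply: cvg_comp h _; apply: cvg_snd.
  have hc (M : 'M[R]_n) : (fun N : 'M[R]_n => N i j : R) x @[x --> M] --> M i j.
    exact: coord_continuous.
  have e1 : (fun t => Re (A t i j)) = (fun t => (realify (A t)).1 i j).
    by apply/funext => t; rewrite mxE.
  have e2 : (fun t => Im (A t i j)) = (fun t => (realify (A t)).2 i j).
    by apply/funext => t; rewrite mxE.
  have l1 : Re (L i j) = (realify L).1 i j by rewrite mxE.
  have l2 : Im (L i j) = (realify L).2 i j by rewrite mxE.
  split; first by rewrite e1 l1; apply: (cvg_comp _ _ h1 (hc _)).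
  by rewrite e2 l2; apply: (cvg_comp _ _ h2 (hc _)).
move=> h; apply/cvg_ballP => e e0.
have hr i j : \forall t \near F, ball (Re (L i j)) e (Re (A t i j)).
  by have [/cvg_ballP + _] := h i j; apply.
have hi i j : \forall t \near F, ball (Im (L i j)) e (Im (A t i j)).
  by have [_ /cvg_ballP +] := h i j; apply.
have fall (P : 'I_n -> 'I_n -> R -> Prop) : (forall i j, \forall t \near F, P i j t) ->
    \forall t \near F, forall i j, P i j t.
  by move=> hP; apply: filter_forall => i; apply: filter_forall => j.
near=> t; split; split => //.
  move=> i j; rewrite /realify !mxE.
  by move: i j; near: t; apply: fall => i j; apply: hr.
move=> i j; rewrite /realify !mxE.
by move: i j; near: t; apply: fall => i j; apply: hi.
Unshelve. all: by end_near. Qed.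

Lemma is_derive1E (W : normedModType R) (f : R -> W) (t : R) (l : W) :
  is_derive t 1 f l <-> h^-1 *: (f (h + t) - f t) @[h --> 0^'] --> l.
Proof.
have E : (fun h : R => h^-1 *: ((f \o shift t) (h *: 1) - f t)) =
         (fun h => h^-1 *: (f (h + t) - f t)).
  by apply/funext => h /=; rewrite /GRing.scale /= mulr1.
split.
  by move=> [h1 <-]; rewrite /derive E; move: h1; rewrite /derivable E.
move=> h; split; first by rewrite /derivable E; apply/cvg_ex; exists l.
by rewrite /derive E; apply: cvg_lim.
Qed.

Lemma realify_deriveP n (A : R -> 'M[C]_n) (t : R) (L : 'M[C]_n) :
  is_derive t 1 (fun s => realify (A s)) (realify L) <-> mder A t L.
Proof.
have E : (fun h : R => h^-1 *: (realify (A (h + t)) - realify (A t))) =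
         (fun h => realify ((h^-1)%:C *: (A (h + t) - A t))).
  apply/funext => h; rewrite /realify; congr pair; apply/matrixP => i j; rewrite !mxE !ReImE.
    by rewrite !mul0r subr0.
  by rewrite !mul0r addr0.
have S (h : R) (u v : C) : Re ((h^-1)%:C * (u - v)) = h^-1 *: (Re u - Re v).
  by rewrite !ReImE mul0r subr0.
have S' (h : R) (u v : C) : Im ((h^-1)%:C * (u - v)) = h^-1 *: (Im u - Im v).
  by rewrite !ReImE mul0r addr0.
split.
  move/is_derive1E; rewrite E => /realify_cvgP h i j; have [h1 h2] := h i j.
  split; apply/is_derive1E.
    by under eq_fun do rewrite -S; move: h1; under eq_fun do rewrite !mxE.
  by under eq_fun do rewrite -S'; move: h2; under eq_fun do rewrite !mxE.
move=> h; apply/is_derive1E; rewrite E; apply/realify_cvgP => i j.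
have [/is_derive1E h1 /is_derive1E h2] := h i j.
split.
  by under eq_fun do rewrite !mxE S.
by under eq_fun do rewrite !mxE S'.
Qed.

End matrices.

(** * Existence of solutions *)

Section power_series.
Variable R : realType.

Lemma derive_ge0_le (f df : R -> R) (a b : R) : a <= b ->
  (forall x : R, a <= x <= b -> is_derive x 1 f (df x)) ->
  (forall x, a <= x <= b -> 0 <= df x) -> f a <= f b.
Proof.
move=> ab hd h0.
have [x||c + E] := @MVT_segment R f df a b ab.
- by rewrite in_itv /= => /andP[/ltW ax /ltW xb]; apply: hd; rewrite ax xb.
- apply: continuous_in_subspaceT => x; rewrite inE /= in_itv /= => xab.
  have [h _] := hd _ xab.
  by apply: differentiable_continuous; apply/derivable1_diffP.
- rewrite in_itv /= => cab; rewrite -subr_ge0 E mulr_ge0 ?subr_ge0 //.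
  exact: h0.
Qed.

(* The factor [m.+1] produced by a differentiation is absorbed by a larger ratio. *)
Lemma linear_geometric_bound (q q' : R) : 0 <= q < q' ->
  exists2 c : R, 0 <= c & forall m, m.+1%:R * q ^+ m <= c * q' ^+ m.
Proof.
move=> /andP[q0 qq]; have q'0 : 0 < q' by apply: le_lt_trans qq.
pose p := q / q'.
have p0 : 0 <= p by rewrite divr_ge0 // ltW.
have p1 : p < 1 by rewrite ltr_pdivrMr ?mul1r.
exists (1 - p)^-1; first by rewrite invr_ge0 subr_ge0 ltW.
move=> m; have -> : q = p * q' by rewrite /p divfK // gt_eqF.
rewrite exprMn mulrA ler_wpM2r ?exprn_ge0 ?(ltW q'0) //.
rewrite -[X in _ <= X]mul1r ler_pdivlMr ?subr_gt0 //.
apply: (@le_trans _ _ (1 - p ^+ m.+1)); last by rewrite lerBlDr lerDl exprn_ge0.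
have -> : 1 - p ^+ m.+1 = (1 - p) * \sum_(i < m.+1) p ^+ i.
  by rewrite -opprB subrX1 -mulNr opprB.
rewrite mulrC ler_wpM2l ?subr_ge0 ?(ltW p1) //.
rewrite mulr_natl -[X in _ *+ X](card_ord m.+1) -sumr_const; apply: ler_sum => i _.
by apply: ler_wiXn2l => //; [exact: ltW|rewrite -ltnS].
Qed.

(** Convergence is tracked only through geometric bounds; a differentiation costs an arbitrarily
    small increase of the ratio [r]. *)
Definition expo (r : R) (a : nat -> R) :=
  exists2 M : R, 0 <= M & forall m, `|a m| <= M * r ^+ m.

Definition pser (a : nat -> R) (t : R) : R := limn (pseries a t).

Lemma pser_cvg (r : R) a (t : R) : 0 <= r -> expo r a -> `|t| * r < 1 -> cvgn (pseries a t).
Proof.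
move=> r0 [M M0 h] tr; apply: normed_cvg.
apply: (@series_le_cvg _ _ (geometric M (`|t| * r))) => [m|m|m|].
- exact: normr_ge0.
- by rewrite /geometric /= mulr_ge0 // exprn_ge0 // mulr_ge0.
- rewrite /geometric /= normrM normrX exprMn mulrCA mulrC ler_wpM2l ?exprn_ge0 //.
- by apply: is_cvg_geometric_series; rewrite normrM normr_id (ger0_norm r0).
Qed.

Lemma expo_diffs (r r' : R) a : 0 <= r < r' -> expo r a -> expo r' (pseries_diffs a).
Proof.
move=> /andP[r0 rr] [M M0 h].
have [|c c0 hc] := @linear_geometric_bound r r'; first by rewrite r0.
exists (M * r * c); first by rewrite !mulr_ge0.
move=> m; rewrite /pseries_diffs normrM ger0_norm //.
apply: (@le_trans _ _ (m.+1%:R * (M * r ^+ m.+1))); first by rewrite ler_wpM2l.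
have -> : m.+1%:R * (M * r ^+ m.+1) = M * r * (m.+1%:R * r ^+ m) by rewrite exprS; ring.
by rewrite -[leRHS]mulrA ler_wpM2l ?mulr_ge0.
Qed.

Lemma pser_deriv (r : R) a (t : R) : 0 <= r -> expo r a -> `|t| * r < 1 ->
  is_derive t 1 (pser a) (pser (pseries_diffs a) t).
Proof.
move=> r0 ha tr.
set s := `|t| in tr *; have s0 : 0 <= s by apply: normr_ge0.
(* This [e] leaves room for (|t| + e)(r + e) < 1. Termwise differentiation needs a point beyond
   [|t|] where the series and its first two derived series converge, and each of the two
   differentiations raises the ratio by [e / 2]. *)
pose e := Num.min 1 ((1 - s * r) / (2 * (s + r + 1))).
have e1 : e <= 1 by rewrite ge_min lexx.
have e2 : e <= (1 - s * r) / (2 * (s + r + 1)) by rewrite ge_min lexx orbT.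
have e0 : 0 < e by rewrite lt_min ltr01 divr_gt0 //; lra.
have e3 : e * (2 * (s + r + 1)) <= 1 - s * r by rewrite -ler_pdivlMr //; lra.
have K0 : 0 < s + e by lra.
have bound r' : 0 <= r' <= r + e -> `|s + e| * r' < 1.
  by rewrite gtr0_norm //; nra.
apply: (@pseries_snd_diffs _ a (s + e)).
- by apply: (@pser_cvg r) => //; apply: bound; lra.
- apply: (@pser_cvg (r + e / 2)); [lra| |apply: bound; lra].
  by apply: (@expo_diffs r) => //; lra.
- apply: (@pser_cvg (r + e)); [lra| |apply: bound; lra].
  apply: (@expo_diffs (r + e / 2)); [lra|].
  by apply: (@expo_diffs r) => //; lra.
- by rewrite -/s gtr0_norm //; lra.
Qed.

Definition rconv (a b : nat -> R) m := \sum_(i < m.+1) a i * b (m - i)%N.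

Lemma triangular_sum (F : nat -> nat -> R) N :
  \sum_(i < N) \sum_(j < (N - i)%N) F i j = \sum_(k < N) \sum_(i < k.+1) F i (k - i)%N.
Proof.
elim: N => [|N IH]; first by rewrite !big_ord0.
rewrite big_ord_recr [in RHS]big_ord_recr /= -IH subSnn big_ord1 big_ord_recr /=.
rewrite subnn addrA; congr (_ + _); rewrite -big_split /=.
apply: eq_bigr => i _; rewrite subSn; last exact: ltnW (ltn_ord i).
by rewrite [LHS]big_ord_recr.
Qed.

(** Cauchy product: the product of two partial sums exceeds the partial sum of the convolution by
    the corner i + j >= N of a square, which has at most N^2 terms, each bounded by M M' q^N with q
    = |t| r < 1. *)
Lemma pser_conv (r : R) a b (t : R) : 0 <= r -> expo r a -> expo r b -> `|t| * r < 1 ->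
  pseries (rconv a b) t n @[n --> \oo] --> pser a t * pser b t.
Proof.
move=> r0 ha hb tr.
have ca := pser_cvg r0 ha tr; have cb := pser_cvg r0 hb tr.
have [M M0 hM] := ha; have [M' M'0 hM'] := hb.
set q := `|t| * r in tr; have q0 : 0 <= q by rewrite mulr_ge0.
(* Each of the two uses of [linear_geometric_bound] absorbs one factor N, along q < q1 < q2 < 1. *)
have [|c c0 hc] := @linear_geometric_bound q ((q + 1) / 2); first by lra.
have [|d d0 hd] := @linear_geometric_bound ((q + 1) / 2) ((q + 3) / 4); first by lra.
set q1 := (q + 1) / 2 in hc hd; set q2 := (q + 3) / 4 in hd.
have pe m (a' : nat -> R) : pseries a' t m = \sum_(i < m) a' i * t ^+ i.
  by rewrite /pseries seriesEord.
have E N : pseries a t N * pseries b t N - pseries (rconv a b) t N =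
    \sum_(i < N) \sum_(N - i <= j < N) (a i * t ^+ i) * (b j * t ^+ j).
  rewrite !pe mulr_suml.
  have -> : \sum_(i < N) rconv a b i * t ^+ i =
      \sum_(i < N) \sum_(j < (N - i)%N) (a i * t ^+ i) * (b j * t ^+ j).
    rewrite (triangular_sum (fun i j => (a i * t ^+ i) * (b j * t ^+ j))).
    apply: eq_bigr => k _; rewrite mulr_suml; apply: eq_bigr => i _.
    have -> : t ^+ k = t ^+ i * t ^+ (k - i) by rewrite -exprD subnKC // -ltnS.
    by rewrite mulrACA.
  rewrite -sumrB; apply: eq_bigr => i _.
  rewrite mulr_sumr -(big_mkord xpredT (fun j => (a i * t ^+ i) * (b j * t ^+ j))).
  rewrite (big_cat_nat (n := (N - i)%N)) //= ?leq_subr // big_mkord addrAC subrr add0r //.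
have bound N : `|pseries a t N * pseries b t N - pseries (rconv a b) t N| <=
    M * M' * (N%:R * (N%:R * q ^+ N)).
  rewrite E; apply: (le_trans (ler_norm_sum _ _ _)).
  have -> : M * M' * (N%:R * (N%:R * q ^+ N)) = \sum_(i < N) \sum_(j < N) M * M' * q ^+ N.
    by rewrite !sumr_const !card_ord mulrCA [X in _ * X]mulrCA !mulr_natl.
  apply: ler_sum => i _; apply: (le_trans (ler_norm_sum _ _ _)).
  rewrite -(big_mkord xpredT (fun=> M * M' * q ^+ N)).
  rewrite [leRHS](big_cat_nat (n := (N - i)%N)) //= ?leq_subr //.
  rewrite -[leLHS]add0r lerD ?sumr_ge0 // => [k _|]; first by rewrite !mulr_ge0 ?exprn_ge0.
  rewrite big_nat_cond [leRHS]big_nat_cond; apply: ler_sum => j /andP[/andP[j1 j2] _].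
  rewrite !normrM !normrX.
  apply: (@le_trans _ _ (M * q ^+ i * (M' * q ^+ j))).
    have term (L x : R) m : `|x| <= L * r ^+ m -> `|x| * `|t| ^+ m <= L * q ^+ m.
      by move=> hx; rewrite /q exprMn mulrCA mulrC ler_wpM2l ?exprn_ge0.
    by apply: ler_pM; rewrite ?mulr_ge0 ?exprn_ge0 //; apply: term.
  have -> : M * q ^+ i * (M' * q ^+ j) = M * M' * q ^+ (i + j) by rewrite exprD; ring.
  rewrite ler_wpM2l ?mulr_ge0 //; apply: ler_wiXn2l => //; first exact: ltW.
  by rewrite -leq_subLR.
have -> : pser a t * pser b t = pser a t * pser b t - 0 by rewrite subr0.
have -> : pseries (rconv a b) t = (fun N => pseries a t N * pseries b t N -
    (pseries a t N * pseries b t N - pseries (rconv a b) t N)).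
  by apply/funext => N; rewrite opprB addrC subrK.
apply: cvgB; first by apply: cvgM.
apply/cvgr0Pnorm_le => e e0.
have /cvgr0Pnorm_le/(_ e e0) : geometric (M * M' * (c * d)) q2 n @[n --> \oo] --> 0.
  by apply: cvg_geometric; rewrite /q2 ger0_norm; lra.
apply: filterS => N; apply: le_trans; apply: (le_trans (bound N)).
rewrite /geometric /= ger0_norm ?mulr_ge0 ?exprn_ge0 // /q2; last lra.
rewrite -!mulrA ler_wpM2l // ler_wpM2l //.
apply: (@le_trans _ _ (N%:R * (c * q1 ^+ N))).
  rewrite ler_wpM2l //; apply: le_trans (hc N); rewrite ler_wpM2r ?exprn_ge0 //.
  by rewrite ler_nat.
rewrite mulrCA ler_wpM2l //; apply: le_trans (hd N); rewrite ler_wpM2r ?exprn_ge0 //.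
  by rewrite /q1; lra.
by rewrite ler_nat.
Qed.

End power_series.

(** * Power series with complex and matrix coefficients *)

Section matrix_power_series.
Variable R : realType.
Local Notation C := R[i].
Local Notation Re := (@complex.Re R).
Local Notation Im := (@complex.Im R).

Definition cser (a : nat -> C) (t : R) (N : nat) : C := \sum_(i < N) (t ^+ i)%:C * a i.

Definition cpser (a : nat -> C) (t : R) : C :=
  pser (Re \o a) t +i* pser (Im \o a) t.

Definition cexpo (r : R) (a : nat -> C) :=
  exists2 M : R, 0 <= M & forall m, nm (a m) <= M * r ^+ m.

Lemma cexpo_Re r a : cexpo r a -> expo r (Re \o a).
Proof. by move=> [M M0 h]; exists M => // m; apply: le_trans (h m); apply: Re_le_nm. Qed.

Lemma cexpo_Im r a : cexpo r a -> expo r (Im \o a).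
Proof. by move=> [M M0 h]; exists M => // m; apply: le_trans (h m); apply: Im_le_nm. Qed.

Lemma Re_cser a t N : Re (cser a t N) = pseries (Re \o a) t N.
Proof.
rewrite /pseries seriesEord cRe_sum; apply: eq_bigr => i _.
by rewrite /= !ReImE mul0r subr0 mulrC.
Qed.

Lemma Im_cser a t N : Im (cser a t N) = pseries (Im \o a) t N.
Proof.
rewrite /pseries seriesEord cIm_sum; apply: eq_bigr => i _.
by rewrite /= !ReImE mul0r addr0 mulrC.
Qed.

Lemma cser_cvg (r t : R) a : 0 <= r -> cexpo r a -> `|t| * r < 1 ->
  ccvg \oo (cser a t) (cpser a t).
Proof.
move=> r0 ha tr; split.
  under eq_fun do rewrite Re_cser.
  exact: (pser_cvg r0 (cexpo_Re ha) tr).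
under eq_fun do rewrite Im_cser.
exact: (pser_cvg r0 (cexpo_Im ha) tr).
Qed.

Lemma cpser_deriv (r t : R) a : 0 <= r -> cexpo r a -> `|t| * r < 1 ->
  cder (cpser a) t (cpser (fun m => m.+1%:R * a m.+1) t).
Proof.
move=> r0 ha tr.
have nRe k z : Re (k%:R * z) = k%:R * Re z.
  by rewrite !mulr_natl; elim: k => [|k IH]; rewrite ?mulr0n // !mulrS cReD IH.
have nIm k z : Im (k%:R * z) = k%:R * Im z.
  by rewrite !mulr_natl; elim: k => [|k IH]; rewrite ?mulr0n // !mulrS cImD IH.
have eRe : Re \o (fun m => m.+1%:R * a m.+1) = pseries_diffs (Re \o a).
  by apply/funext => m /=; rewrite nRe.
have eIm : Im \o (fun m => m.+1%:R * a m.+1) = pseries_diffs (Im \o a).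
  by apply/funext => m /=; rewrite nIm.
split; rewrite /cpser /= ?eRe ?eIm.
  exact: (pser_deriv r0 (cexpo_Re ha) tr).
exact: (pser_deriv r0 (cexpo_Im ha) tr).
Qed.

Definition cconv (a b : nat -> C) m := \sum_(i < m.+1) a i * b (m - i)%N.

Lemma cser_conv (r t : R) a b : 0 <= r -> cexpo r a -> cexpo r b -> `|t| * r < 1 ->
  ccvg \oo (cser (cconv a b) t) (cpser a t * cpser b t).
Proof.
move=> r0 ha hb tr.
have h := pser_conv r0 _ _ tr.
have [ar ai br bi] : [/\ expo r (Re \o a), expo r (Im \o a), expo r (Re \o b) & expo r (Im \o b)].
  by split; [apply: cexpo_Re|apply: cexpo_Im|apply: cexpo_Re|apply: cexpo_Im].
split.
  have -> : (fun N => Re (cser (cconv a b) t N)) = (fun N =>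
      pseries (rconv (Re \o a) (Re \o b)) t N - pseries (rconv (Im \o a) (Im \o b)) t N).
    apply/funext => N; rewrite Re_cser /pseries !seriesEord -sumrB; apply: eq_bigr => i _.
    rewrite /= -mulrBl; congr (_ * _); rewrite cRe_sum -sumrB; apply: eq_bigr => j _.
    by rewrite cReM.
  by rewrite cReM; apply: cvgB; apply: h.
have -> : (fun N => Im (cser (cconv a b) t N)) = (fun N =>
    pseries (rconv (Re \o a) (Im \o b)) t N + pseries (rconv (Im \o a) (Re \o b)) t N).
  apply/funext => N; rewrite Im_cser /pseries !seriesEord -big_split; apply: eq_bigr => i _.
  rewrite /= -mulrDl; congr (_ * _); rewrite cIm_sum -big_split; apply: eq_bigr => j _.
  by rewrite cImM.
by rewrite cImM; apply: cvgD; apply: h.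
Qed.

Lemma cpser0 a : cpser a 0 = a 0%N.
Proof.
have e (u : nat -> R) : pser u 0 = u 0%N.
  apply: cvg_lim => //; apply: cvg_near_cst; near=> N.
  have N0 : (0 < N)%N by near: N; apply: nbhs_infty_gt.
  rewrite /pseries seriesEord /= -(prednK N0) big_ord_recl expr0 mulr1 big1 ?addr0 // => i _.
  by rewrite expr0n mulr0.
by apply: ReIm_eq; rewrite /= e.
Unshelve. all: by end_near. Qed.

Section matrix_series.
Variables (m n : nat).
Implicit Types X : nat -> 'M[C]_(m, n).

Definition mser X (t : R) (N : nat) : 'M[C]_(m, n) := \sum_(i < N) (t ^+ i)%:C *: X i.

Definition mpser X (t : R) : 'M[C]_(m, n) := \matrix_(i, j) cpser (fun k => X k i j) t.

Definition mexpo (r : R) X := exists2 M : R, 0 <= M & forall k, mnorm (X k) <= M * r ^+ k.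

Lemma mexpo_entry r X i j : mexpo r X -> cexpo r (fun k => X k i j).
Proof. by move=> [M M0 h]; exists M => // k; apply: le_trans (h k); apply: nm_le_mnorm. Qed.

Lemma mser_entry X t N i j : mser X t N i j = cser (fun k => X k i j) t N.
Proof. by rewrite /mser summxE; apply: eq_bigr => k _; rewrite !mxE. Qed.

Lemma mser_cvg (r t : R) X : 0 <= r -> mexpo r X -> `|t| * r < 1 ->
  mcvg \oo (mser X t) (mpser X t).
Proof.
move=> r0 hX tr i j; rewrite mxE; under eq_fun do rewrite mser_entry.
by apply: (cser_cvg r0) => //; apply: mexpo_entry.
Qed.

Lemma mpser0 X : mpser X 0 = X 0%N.
Proof. by apply/matrixP => i j; rewrite mxE cpser0. Qed.

End matrix_series.

Definition mconv m n p (X : nat -> 'M[C]_(m, n)) (Y : nat -> 'M[C]_(n, p)) k :=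
  \sum_(i < k.+1) X i *m Y (k - i)%N.

Lemma mser_conv m n p (r t : R) (X : nat -> 'M[C]_(m, n)) (Y : nat -> 'M[C]_(n, p)) :
  0 <= r -> mexpo r X -> mexpo r Y -> `|t| * r < 1 ->
  mcvg \oo (mser (mconv X Y) t) (mpser X t *m mpser Y t).
Proof.
move=> r0 hX hY tr i j; under eq_fun do rewrite mser_entry.
have -> : (fun N => cser (fun k => mconv X Y k i j) t N) =
    (fun N => \sum_l cser (cconv (fun k => X k i l) (fun k => Y k l j)) t N).
  apply/funext => N; rewrite /cser exchange_big; apply: eq_bigr => k _.
  rewrite -mulr_sumr; congr (_ * _); rewrite /mconv summxE /cconv exchange_big.
  by apply: eq_bigr => l _; rewrite mxE.
rewrite mxE; apply: ccvg_sum => l _; rewrite !mxE.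
by apply: (cser_conv r0) => //; apply: mexpo_entry.
Qed.

(** Each coefficient of a power series solution depends on all the earlier ones. The table [h k] is
    correct up to index [k], and the sequence is read off its diagonal. *)
Lemma course_of_values T (x0 : T) (G : nat -> (nat -> T) -> T) :
  (forall k f g, (forall i, (i <= k)%N -> f i = g i) -> G k f = G k g) ->
  exists2 f : nat -> T, f 0%N = x0 & forall k, f k.+1 = G k f.
Proof.
move=> hG.
pose h := fix h k : nat -> T :=
  if k is k'.+1 then fun i => if (i <= k')%N then h k' i else G k' (h k') else fun=> x0.
exists (fun k => h k k) => // k /=; rewrite ltnn; apply: hG => i.
elim: k => [|k IH]; first by rewrite leqn0 => /eqP ->.
rewrite leq_eqVlt => /orP[/eqP -> //|ik] /=.
by rewrite -ltnS ik IH.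
Qed.

End matrix_power_series.

(** * Adjoints, commutators, and the boundedness of density operators *)

Section density_operators.
Variable R : realType.
Local Notation C := R[i].
Local Notation Re := (@complex.Re R).
Local Notation Im := (@complex.Im R).

Lemma adjM m n p (A : 'M[C]_(m, n)) (B : 'M[C]_(n, p)) :
  (A *m B) ^t* = B ^t* *m A ^t*.
Proof. by rewrite trmx_mul map_mxM. Qed.

Lemma adjD m n (A B : 'M[C]_(m, n)) : (A + B) ^t* = A ^t* + B ^t*.
Proof. by rewrite linearD map_mxD. Qed.

Lemma adjB m n (A B : 'M[C]_(m, n)) : (A - B) ^t* = A ^t* - B ^t*.
Proof. by rewrite linearB map_mxB. Qed.

Lemma adjZ m n c (A : 'M[C]_(m, n)) : (c *: A) ^t* = Num.conj c *: A ^t*.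
Proof. by rewrite linearZ map_mxZ. Qed.

Lemma adj_sum m n I (r : seq I) (F : I -> 'M[C]_(m, n)) :
  (\sum_(i <- r) F i) ^t* = \sum_(i <- r) (F i) ^t*.
Proof. by rewrite linear_sum map_mx_sum. Qed.

Lemma tr_adj n (A : 'M[C]_n) : \tr (A ^t*) = Num.conj (\tr A).
Proof. by rewrite -map_trmx mxtrace_tr /mxtrace rmorph_sum; apply: eq_bigr => i _; rewrite !mxE. Qed.

Variable n : nat.
Implicit Types (A B U x rhod : 'M[C]_n).

Lemma hermP A : reflect (A ^t* = A) (A \is hermsymmx).
Proof.
apply: (iffP (is_hermitianmxP _ _ _)); rewrite expr0 scale1r; first by move=> <-.
by move=> ->.
Qed.

Lemma herm_entry A i j : A \is hermsymmx -> Num.conj (A i j) = A j i.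
Proof. by move=> /hermP h; rewrite -[in RHS]h !mxE. Qed.

Lemma commutatorDl A B x : commutator (A + B) x = commutator A x + commutator B x.
Proof. by rewrite /commutator mulmxDl mulmxDr opprD addrACA. Qed.

Lemma commutatorDr A B x : commutator x (A + B) = commutator x A + commutator x B.
Proof. by rewrite /commutator mulmxDl mulmxDr opprD addrACA. Qed.

Lemma commutatorZl c A x : commutator (c *: A) x = c *: commutator A x.
Proof. by rewrite /commutator -scalemxAl -scalemxAr scalerBr. Qed.

Lemma commutatorZr c A x : commutator x (c *: A) = c *: commutator x A.
Proof. by rewrite /commutator -scalemxAl -scalemxAr scalerBr. Qed.

Lemma commutatorNr A x : commutator x (- A) = - commutator x A.
Proof. by rewrite -scaleN1r commutatorZr scaleN1r. Qed.

Lemma commutatorBr A B x : commutator x (A - B) = commutator x A - commutator x B.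
Proof. by rewrite commutatorDr commutatorNr. Qed.

Lemma adj_commutator A B : (commutator A B) ^t* = commutator (B ^t*) (A ^t*).
Proof. by rewrite /commutator adjB !adjM. Qed.

Lemma feedbackD H rhod x y : feedback H rhod (x + y) = feedback H rhod x + feedback H rhod y.
Proof. by rewrite /feedback commutatorDr mulmxDl mxtraceD. Qed.

Lemma feedbackZ H rhod c x : feedback H rhod (c *: x) = c * feedback H rhod x.
Proof. by rewrite /feedback commutatorZr -scalemxAl mxtraceZ. Qed.

Lemma feedbackB H rhod x y : feedback H rhod (x - y) = feedback H rhod x - feedback H rhod y.
Proof. by rewrite feedbackD -scaleN1r feedbackZ mulN1r. Qed.

Lemma feedback_real H rhod x : H \is hermsymmx -> rhod \is hermsymmx -> x \is hermsymmx ->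
  Num.conj (feedback H rhod x) = feedback H rhod x.
Proof.
move=> /hermP hH /hermP hr /hermP hx.
rewrite /feedback -tr_adj adjM adj_commutator adjZ hH hr hx mxtrace_mulC.
congr (\tr (_ *m _)); rewrite rmorphN /= conjCi opprK commutatorZr.
by rewrite commutatorZl scaleNr -scalerN /commutator opprB.
Qed.

Lemma nm_feedback H rhod x :
  nm (feedback H rhod x) <= 2 * mnorm H * mnorm rhod * mnorm x.
Proof.
apply: (le_trans (nm_trace _)); apply: (le_trans (mnormM _ _)).
rewrite -mulrA [mnorm rhod * _]mulrC mulrA ler_wpM2r ?mnorm_ge0 //.
rewrite commutatorZl; apply: (le_trans (mnormZ _ _)).
by rewrite nmN nm_i mul1r mnorm_commutator.
Qed.

Lemma unitary_adjK U : U \is unitarymx -> U ^t* *m U = 1%:M.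
Proof. by move=> /unitarymxP h; apply: mulmx1C. Qed.

Lemma density_conj U x : U \is unitarymx -> density x -> density (U *m x *m U ^t*).
Proof.
move=> hU [/hermP hx px tx]; split.
- by apply/hermP; rewrite !adjM trmxCK hx mulmxA.
- move=> v; have := px (U ^t* *m v).
  by rewrite adjM trmxCK !mulmxA.
- by rewrite mxtrace_mulC mulmxA unitary_adjK // mul1mx.
Qed.

Lemma char_poly_conj U x : U \is unitarymx -> char_poly (U *m x *m U ^t*) = char_poly x.
Proof.
move=> hU; rewrite /char_poly /char_poly_mx.
pose V := map_mx polyC U; pose W := map_mx polyC (U ^t*).
have VW : V *m W = 1%:M by rewrite -map_mxM (unitarymxP hU) map_mx1.
have -> : 'X%:M - map_mx polyC (U *m x *m U ^t*) = V *m ('X%:M - map_mx polyC x) *m W.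
  rewrite mulmxBr mulmxBl !map_mxM /= -/V -/W; congr (_ - _).
  by rewrite mul_mx_scalar -scalemxAl VW scalemx1.
by rewrite !det_mulmx mulrAC -det_mulmx VW det1 mul1r.
Qed.

Lemma isospectral_conj U x rhod : U \is unitarymx -> isospectral rhod x ->
  isospectral rhod (U *m x *m U ^t*).
Proof.
by move=> hU [dx cx]; split; [apply: density_conj|rewrite char_poly_conj].
Qed.

(** Positivity on the vectors e_k + z e_l, with z = 1, -1, i, -i, bounds both parts of an
    off-diagonal entry by 1, since the diagonal entries lie in [0, 1]. The bound is uniform on the
    orbit, and so will be the existence time. *)
Lemma density_bounded x : density x -> mnorm x <= n%:R * n%:R * 2.
Proof.
move=> [hx px tx]; apply: mnorm_le => i j.
have dd k l : delta_mx 0 k *m x *m delta_mx l 0 = const_mx (x k l) :> 'M[C]_1.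
  by apply/matrixP => a b; rewrite !ord1 -rowE -colE !mxE.
have ed k : ((delta_mx k 0 : 'cV[C]_n) ^t*) = delta_mx 0 k.
  by apply/matrixP => a b; rewrite !mxE andbC conjC_nat.
have test k l z : 0 <= x k k + z * x k l + Num.conj z * x l k + Num.conj z * z * x l l.
  have := px (delta_mx k 0 + z *: delta_mx l 0).
  rewrite adjD adjZ !ed mulmxDl mulmxDl !mulmxDr -!scalemxAl -!scalemxAr -?scalemxAl !dd.
  by rewrite !mxE addrA mulrA.
have diag k : 0 <= Re (x k k).
  by have := test k k 0; rewrite rmorph0 !mul0r !addr0 lecE => /andP[].
have sumd : \sum_k Re (x k k) = 1 by rewrite -cRe_sum -/(\tr x) tx.
have diag1 k : Re (x k k) <= 1.
  by rewrite -sumd (bigD1 k) //= lerDl sumr_ge0.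
have e k l : x l k = Num.conj (x k l) by rewrite herm_entry.
have [ik|ij] := eqVneq i j.
  rewrite -{j}ik; have : Im (x i i) = 0 by have := congr1 Im (e i i); rewrite cImJ; lra.
  by rewrite /nm => ->; rewrite normr0 addr0 ger0_norm //; have := diag1 i; lra.
have := test i j 1; have := test i j (-1); have := test i j 'i; have := test i j (- 'i).
rewrite !lecE => /andP[_ h1] /andP[_ h2] /andP[_ h3] /andP[_ h4].
move: h1 h2 h3 h4; rewrite (e i j) !ReImE /=.
have := diag1 i; have := diag1 j; move: (Re (x i i)) (Re (x j j)) => a b.
rewrite /nm; case: (x i j) => c d /=.
move=> *; have [] : `|c| <= 1 /\ `|d| <= 1 by rewrite !ler_norml; split; apply/andP; split; lra.
lra.
Qed.

Lemma isospectral_bounded rhod x : isospectral rhod x -> mnorm x <= n%:R * n%:R * 2.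
Proof. by case=> + _; apply: density_bounded. Qed.

End density_operators.

(** * Power series solution of the closed loop *)

Section local_existence.
Variables (R : realType) (n : nat).
Local Notation C := R[i].
Variables (H0 H1 rhod : 'M[C]_n).

(* On trace-one matrices this is [-i (H0 + f(x) H1)]; the factor [\tr x] makes it linear
   in [x], so that the closed loop is a homogeneous quadratic equation. *)
Definition generator (x : 'M[C]_n) : 'M[C]_n :=
  - 'i *: (\tr x *: H0 + feedback H1 rhod x *: H1).

Lemma generator_closed_loop x : \tr x = 1 ->
  commutator (generator x) x = closed_loop H0 H1 rhod x.
Proof. by move=> tx; rewrite /generator tx scale1r commutatorZl. Qed.

Lemma generatorD x y : generator (x + y) = generator x + generator y.
Proof.
by rewrite /generator mxtraceD feedbackD !scalerDl addrACA scalerDr.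
Qed.

Lemma generatorZ c x : generator (c *: x) = c *: generator x.
Proof.
rewrite /generator mxtraceZ feedbackZ -!scalerA -scalerDr scalerA mulrC.
by rewrite -scalerA.
Qed.

Lemma generator_sum I (r : seq I) (F : I -> 'M[C]_n) :
  generator (\sum_(i <- r) F i) = \sum_(i <- r) generator (F i).
Proof.
apply: (big_morph generator generatorD).
by rewrite -(scale0r (0 : 'M[C]_n)) generatorZ !scale0r.
Qed.

Lemma generator_bounded : exists2 k : R, 0 < k & forall x, mnorm (generator x) <= k * mnorm x.
Proof.
have h0 := mnorm_ge0 H0; have h1 := mnorm_ge0 H1; have hr := mnorm_ge0 rhod.
exists (mnorm H0 + 2 * mnorm H1 * mnorm rhod * mnorm H1 + 1).
  by rewrite ltr_pwDr // addr_ge0 // !mulr_ge0.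
move=> x; apply: (le_trans (mnormZ _ _)); rewrite nmN nm_i mul1r.
apply: (le_trans (mnormD _ _)).
have a1 := le_trans (mnormZ (\tr x) H0) (ler_wpM2r h0 (nm_trace x)).
have a2 := le_trans (mnormZ (feedback H1 rhod x) H1) (ler_wpM2r h1 (nm_feedback H1 rhod x)).
by have hx := mnorm_ge0 x; lra.
Qed.

Lemma mcvg_generator T (F : set_system T) (FF : ProperFilter F) (x : T -> 'M[C]_n) l :
  mcvg F x l -> mcvg F (fun t => generator (x t)) (generator l).
Proof.
move=> h; apply: mcvgZ; first exact: ccvg_cst.
apply: mcvgD; apply: mcvgZ; [exact: mcvg_trace|exact: mcvg_cst| |exact: mcvg_cst].
apply: mcvg_trace; apply: mcvgM; last exact: mcvg_cst.
by apply: mcvgB; apply: mcvgM => //; apply: mcvg_cst.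
Qed.

Hypotheses (hH0 : H0 \is hermsymmx) (hH1 : H1 \is hermsymmx) (hrd : rhod \is hermsymmx).

Lemma adj_generator x : x \is hermsymmx -> (generator x) ^t* = - generator x.
Proof.
move=> hx; rewrite /generator adjZ adjD !adjZ (feedback_real hH1 hrd hx) -tr_adj.
rewrite (hermP _ hx) (hermP _ hH0) (hermP _ hH1).
by rewrite rmorphN /= conjCi opprK scaleNr opprK.
Qed.

(* Coefficients of the power series solution of [x' = [G(x), x]], [u' = G(x) u]. *)
Lemma series_solution (x0 : 'M[C]_n) (M : R) : x0 \is hermsymmx -> 0 < M -> mnorm x0 <= M ->
  forall k : R, 0 < k -> (forall x, mnorm (generator x) <= k * mnorm x) ->
  exists X U : nat -> 'M[C]_n,
  [/\ X 0%N = x0, U 0%N = 1%:M, forall m, X m \is hermsymmx,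
      mexpo (2 * k * M) X /\ mexpo (2 * k * M) U &
      forall m, m.+1%:R *: X m.+1 =
          mconv (generator \o X) X m - mconv X (generator \o X) m /\
        m.+1%:R *: U m.+1 = mconv (generator \o X) U m].
Proof.
move=> hx0 M0 xM k k0 hk.
have [c [c1 nc cJ]] : exists c : nat -> C, [/\ forall m, m.+1%:R * c m = 1,
    forall m, nm (c m) = m.+1%:R^-1 & forall m, Num.conj (c m) = c m].
  exists (fun m => (m.+1%:R^-1)%:C); split=> m.
  - by rewrite -(rmorph_nat (real_complex R)) -rmorphM mulfV ?rmorph1 // pnatr_eq0.
  - by rewrite nm_real ger0_norm // invr_ge0.
  - exact: conjc_real.
pose B (X Y : nat -> 'M[C]_n) m :=
  c m *: \sum_(i < m.+1) commutator (generator (X i)) (Y (m - i)%N).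
have BE m f g : (forall i, (i <= m)%N -> f i = g i) -> B f f m = B g g m.
  move=> fg; apply: (congr1 (fun A => c m *: A)); apply: eq_bigr => i _.
  have e1 : f i = g i by apply: fg; rewrite -ltnS; apply: ltn_ord.
  have e2 : f (m - i)%N = g (m - i)%N by apply: fg; apply: leq_subr.
  by rewrite e1 e2.
have [X X0 XS] := @course_of_values _ x0 (fun m f => B f f m) BE.
pose G (X U : nat -> 'M[C]_n) m :=
  c m *: \sum_(i < m.+1) generator (X i) *m U (m - i)%N.
have GE m f g : (forall i, (i <= m)%N -> f i = g i) -> G X f m = G X g m.
  move=> fg; apply: (congr1 (fun A => c m *: A)); apply: eq_bigr => i _.
  have e2 : f (m - i)%N = g (m - i)%N by apply: fg; apply: leq_subr.
  by rewrite e2.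
have [U U0 US] := @course_of_values _ (1%:M : 'M[C]_n) (fun m f => G X f m) GE.
have r0 : 0 <= 2 * k * M by rewrite !mulr_ge0 // ltW.
(* The factor 1 / (m + 1) compensates the m + 1 terms of the convolution, so the induction closes
   with the ratio 2 k M; the 2 comes from the commutator. *)
have avg m (F : 'I_m.+1 -> 'M[C]_n) (d : R) : (forall i, mnorm (F i) <= d) ->
    mnorm (c m *: \sum_i F i) <= d.
  move=> hF; apply: (le_trans (mnormZ _ _)); rewrite nc mulrC ler_pdivrMr //.
  apply: (le_trans (mnorm_sum _ _ _)); rewrite mulr_natr.
  by rewrite -[X in _ *+ X](card_ord m.+1) -sumr_const; apply: ler_sum.
have pw m (i : 'I_m.+1) : (2 * k * M) ^+ m = (2 * k * M) ^+ i * (2 * k * M) ^+ (m - i).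
  by rewrite -exprD subnKC // -ltnS.
have bX m : mnorm (X m) <= M * (2 * k * M) ^+ m.
  elim/ltn_ind: m => -[_|m IH]; first by rewrite X0 expr0 mulr1.
  rewrite XS; apply: avg => i.
  apply: (le_trans (mnorm_commutator _ _)).
  have h1 := le_trans (hk (X i)) (ler_wpM2l (ltW k0) (IH i (ltn_ord i))).
  have im : (m - i < m.+1)%N by rewrite ltnS leq_subr.
  have h2 := IH _ im.
  rewrite exprS (pw _ i) -mulrA.
  apply: (@le_trans _ _ (2 * ((k * (M * (2 * k * M) ^+ i)) * (M * (2 * k * M) ^+ (m - i))))).
    by rewrite ler_wpM2l // ler_pM ?mnorm_ge0.
  by rewrite le_eqVlt; apply/orP; left; apply/eqP; ring.
have bU m : mnorm (U m) <= mnorm (1%:M : 'M[C]_n) * (2 * k * M) ^+ m.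
  elim/ltn_ind: m => -[_|m IH]; first by rewrite U0 expr0 mulr1.
  rewrite US; apply: avg => i.
  apply: (le_trans (mnormM _ _)).
  have h1 := le_trans (hk (X i)) (ler_wpM2l (ltW k0) (bX i)).
  have im : (m - i < m.+1)%N by rewrite ltnS leq_subr.
  have h2 := IH _ im.
  rewrite exprS (pw _ i).
  apply: (@le_trans _ _ ((k * (M * (2 * k * M) ^+ i)) *
      (mnorm (1%:M : 'M[C]_n) * (2 * k * M) ^+ (m - i)))).
    by rewrite ler_pM ?mnorm_ge0.
  rewrite -subr_ge0.
  set a := _ ^+ i; set b := _ ^+ (m - i).
  have -> : mnorm (1%:M : 'M[C]_n) * (2 * k * M * (a * b)) -
    k * (M * a) * (mnorm (1%:M : 'M[C]_n) * b) = mnorm (1%:M : 'M[C]_n) * (k * M * (a * b)).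
    by ring.
  by rewrite !mulr_ge0 ?mnorm_ge0 ?exprn_ge0 // ltW.
exists X, U; split => //.
- elim/ltn_ind => -[_|m IH]; first by rewrite X0.
  apply/hermP; rewrite XS /B adjZ cJ adj_sum; apply: (congr1 (fun A => c m *: A)).
  apply: eq_bigr => i _.
  have hi : X i \is hermsymmx by apply: IH; apply: ltn_ord.
  have /hermP hmi : X (m - i)%N \is hermsymmx by apply: IH; rewrite ltnS leq_subr.
  by rewrite adj_commutator (adj_generator hi) hmi commutatorNr /commutator opprB.
- by split; [exists M => //; exact: ltW|exists (mnorm (1%:M : 'M[C]_n)) => //; exact: mnorm_ge0].
- move=> m; rewrite XS US /B /G !scalerA !c1 !scale1r; split; last by [].
  have -> : mconv X (generator \o X) m =
      \sum_(i < m.+1) X (m - i)%N *m generator (X i).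
    rewrite /mconv [LHS](reindex_inj rev_ord_inj); apply: eq_bigr => i _.
    have e : nat_of_ord (rev_ord i) = (m - i)%N by rewrite /= subSS.
    have im : (i <= m)%N by rewrite -ltnS.
    by rewrite e subKn.
  by rewrite /mconv -sumrB.
Qed.

End local_existence.

Section local_flow.
Variables (R : realType) (n : nat).
Local Notation C := R[i].
Local Notation Re := (@complex.Re R).
Local Notation Im := (@complex.Im R).

Lemma cpser_lim a (t : R) (l : C) : ccvg \oo (cser a t) l -> cpser a t = l.
Proof.
move=> [h1 h2]; apply: ReIm_eq; apply: cvg_lim => //.
  by move: h1; under eq_fun do rewrite Re_cser.
by move: h2; under eq_fun do rewrite Im_cser.
Qed.

Lemma mpser_lim m p (X : nat -> 'M[C]_(m, p)) (t : R) L :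
  mcvg \oo (mser X t) L -> mpser X t = L.
Proof.
move=> h; apply/matrixP => i j; rewrite mxE; apply: cpser_lim.
by have := h i j; under eq_fun do rewrite mser_entry.
Qed.

Lemma mpser_deriv m p (X : nat -> 'M[C]_(m, p)) (r t : R) : 0 <= r -> mexpo r X ->
  `|t| * r < 1 -> mder (mpser X) t (mpser (fun k => k.+1%:R *: X k.+1) t).
Proof.
move=> r0 hX tr i j.
have -> : (fun s => mpser X s i j) = cpser (fun k => X k i j).
  by apply/funext => s; rewrite mxE.
have -> : mpser (fun k => k.+1%:R *: X k.+1) t i j = cpser (fun k => k.+1%:R * X k.+1 i j) t.
  by rewrite mxE; congr (cpser _ t); apply/funext => k; rewrite mxE.
by apply: (cpser_deriv r0) => //; apply: mexpo_entry.
Qed.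

Lemma cder0_cst (u : R -> C) (d : R) : (forall s : R, `|s| < d -> cder u s 0) ->
  forall t : R, `|t| < d -> u t = u 0.
Proof.
move=> h t td.
have cst (f : R -> R) : (forall s : R, `|s| < d -> is_derive s 1 f 0) -> f t = f 0.
  move=> hf.
  have hN (s : R) : `|s| < d -> is_derive s 1 (- f) 0.
    by move=> sd; have := is_deriveN (hf s sd); rewrite oppr0.
  have le (g : R -> R) (a b : R) : (forall s : R, `|s| < d -> is_derive s 1 g 0) ->
      a <= b -> `|a| < d -> `|b| < d -> g a <= g b.
    move=> hg ab ad bd; apply: (@derive_ge0_le _ g (fun=> 0)) => // x xab; apply: hg.
    by move: ad bd xab; rewrite !ltr_norml; lra.
  have d0 : `|0 : R| < d by rewrite normr0; apply: le_lt_trans td.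
  apply/eqP; rewrite eq_le; have [t0|/ltW t0] := leP t 0.
    by rewrite le //= -lerN2; apply: (le (- f)).
  by rewrite andbC le //= -lerN2; apply: (le (- f)).
by apply: ReIm_eq; [apply: (cst (fun s => Re (u s)))|apply: (cst (fun s => Im (u s)))] => s /h[].
Qed.

Variables (H0 H1 rhod : 'M[C]_n).
Hypotheses (hH0 : H0 \is hermsymmx) (hH1 : H1 \is hermsymmx) (hrd : rhod \is hermsymmx).

Local Notation G := (generator H0 H1 rhod).

Lemma local_solution : exists2 d : R, 0 < d & forall x0, isospectral rhod x0 ->
  exists2 x : R -> 'M[C]_n, x 0 = x0 & forall t : R, `|t| < d ->
    isospectral rhod (x t) /\ mder x t (closed_loop H0 H1 rhod (x t)).
Proof.
have [k k0 hk] := generator_bounded H0 H1 rhod.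
pose M : R := n%:R * n%:R * 2 + 1.
have M0 : 0 < M by rewrite ltr_wpDl // !mulr_ge0.
set r := 2 * k * M.
have r0 : 0 < r by rewrite !mulr_gt0.
exists r^-1; first by rewrite invr_gt0.
move=> x0 ix0.
have xM : mnorm x0 <= M by apply: le_trans (isospectral_bounded ix0) _; rewrite lerDl.
have hx0 : x0 \is hermsymmx by case: ix0 => -[].
have [X [U [X0 U0 hX [bX bU] XU]]] := series_solution hH0 hH1 hrd hx0 M0 xM k0 hk.
rewrite -/r in bX bU.
have bG : mexpo r (G \o X).
  have [B B0 hB] := bX; exists (k * B) => [|i]; first by rewrite mulr_ge0 // ltW.
  by apply: (le_trans (hk _)); rewrite -mulrA ler_wpM2l // ltW.
pose x := mpser X; pose u := mpser U.
have small (t : R) : `|t| < r^-1 -> `|t| * r < 1.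
  by move=> tr; rewrite -ltr_pdivlMr // mul1r.
have r0' := ltW r0.
have xcvg (t : R) (tr : `|t| < r^-1) := mser_cvg r0' bX (small t tr).
have Gx (t : R) : `|t| < r^-1 -> mpser (G \o X) t = G (x t).
  move=> tr; apply: mpser_lim.
  have -> : mser (G \o X) t = (fun N => G (mser X t N)).
    by apply/funext => N; rewrite /mser generator_sum; apply: eq_bigr => i _; rewrite generatorZ.
  by apply: mcvg_generator; apply: xcvg.
have Gcvg (t : R) (tr : `|t| < r^-1) := mser_cvg r0' bG (small t tr).
have dx (t : R) : `|t| < r^-1 -> mder x t (commutator (G (x t)) (x t)).
  move=> tr; have := mpser_deriv r0' bX (small t tr).
  have -> : (fun k => k.+1%:R *: X k.+1) = (fun m => mconv (G \o X) X m - mconv X (G \o X) m).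
    by apply/funext => m; have [] := XU m.
  rewrite [X in mder _ _ X](_ : _ = commutator (G (x t)) (x t)) //.
  apply: mpser_lim.
  have -> : mser (fun m => mconv (G \o X) X m - mconv X (G \o X) m) t =
     (fun N => mser (mconv (G \o X) X) t N - mser (mconv X (G \o X)) t N).
    by apply/funext => N; rewrite /mser -sumrB; apply: eq_bigr => i _; rewrite scalerBr.
  by rewrite /commutator -Gx //; apply: mcvgB; apply: (mser_conv r0') => //; apply: small.
have du (t : R) : `|t| < r^-1 -> mder u t (G (x t) *m u t).
  move=> tr; have := mpser_deriv r0' bU (small t tr).
  have -> : (fun k => k.+1%:R *: U k.+1) = mconv (G \o X) U.
    by apply/funext => m; have [] := XU m.
  rewrite [X in mder _ _ X](_ : _ = G (x t) *m u t) //.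
  by apply: mpser_lim; rewrite -Gx //; apply: (mser_conv r0') => //; apply: small.
have hx (t : R) : `|t| < r^-1 -> x t \is hermsymmx.
  move=> tr; apply/hermP; apply/matrixP => i j; rewrite !mxE.
  have xij := xcvg t tr i j.
  have /ccvgJ xji := xcvg t tr j i.
  have E : (fun N => Num.conj (mser X t N j i)) = (fun N => mser X t N i j).
    apply/funext => N; rewrite !mser_entry /cser rmorph_sum; apply: eq_bigr => m _.
    by rewrite rmorphM; congr (_ * _); [exact: conjc_real|exact: herm_entry].
  rewrite E in xji; have := ccvg_unique _ xji xij; rewrite !mxE; apply.
have unit_u (t : R) : `|t| < r^-1 -> u t \is unitarymx.
  move=> tr; have : (u t) ^t* *m u t = 1%:M.
    have u0 : u 0 = 1%:M by rewrite /u mpser0 U0.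
    have : (u 0) ^t* *m u 0 = 1%:M by rewrite u0 trmx1 map_mx1 mulmx1.
    move=> <-; apply/matrixP => i j.
    apply: (@cder0_cst (fun s => ((u s) ^t* *m u s) i j) r^-1) => // s sr.
    have h := mderM (mder_adj (du s sr)) (du s sr).
    have := h i j; rewrite adjM (adj_generator hH0 hH1 hrd (hx s sr)).
    by rewrite mulmxN mulNmx mulmxA addNr mxE.
  by move=> /mulmx1C h; apply/unitarymxP.
have xu (t : R) : `|t| < r^-1 -> x t = u t *m x0 *m (u t) ^t*.
  move=> tr; have : (u t) ^t* *m x t *m u t = x0.
    have u0 : u 0 = 1%:M by rewrite /u mpser0 U0.
    have : (u 0) ^t* *m x 0 *m u 0 = x0.
      by rewrite u0 trmx1 map_mx1 mulmx1 mul1mx /x mpser0 X0.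
    move=> <-; apply/matrixP => i j.
    apply: (@cder0_cst (fun s => ((u s) ^t* *m x s *m u s) i j) r^-1) => // s sr.
    have h := mderM (mderM (mder_adj (du s sr)) (dx s sr)) (du s sr).
    apply: cder_eq (h i j) _.
    rewrite adjM (adj_generator hH0 hH1 hrd (hx s sr)) /commutator.
    set v := (u s) ^t*; set g := G (x s).
    by rewrite mulmxN mulNmx mulmxBr !mulmxA addKr mulNmx addNr mxE.
  move=> <-; rewrite !mulmxA (unitarymxP (unit_u t tr)) mul1mx -mulmxA.
  by rewrite (unitarymxP (unit_u t tr)) mulmx1.
exists x; first by rewrite /x mpser0 X0.
move=> t tr; have it : isospectral rhod (x t).
  by rewrite xu //; apply: isospectral_conj => //; apply: unit_u.
split => //; rewrite -generator_closed_loop; first exact: dx.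
by case: it => -[].
Qed.

End local_flow.

(** * Chaining local solutions *)

Section global_existence.
Variables (R : realType) (n : nat).
Local Notation C := R[i].

(** Serves at the grid points where two local solutions meet: the two-sided derivative is assembled
    from the piece on the left and the piece on the right. *)
Lemma is_derive_glue (f g h : R -> R) (a t b l : R) : a < t < b ->
  is_derive t 1 g l -> is_derive t 1 h l ->
  (forall s, a < s <= t -> f s = g s) -> (forall s, t <= s < b -> f s = h s) ->
  is_derive t 1 f l.
Proof.
move=> /andP[at_ tb] /is_derive1E hg /is_derive1E hh fg fh; apply/is_derive1E.
apply: (@cvg_at_right_left_dnbhs _ R^o).
  apply: cvg_trans (cvg_dnbhs_at_right hh); apply: near_eq_cvg.
  near=> e; have e0 : 0 < e by near: e; apply: nbhs_right_gt.
  have eb : e < b - t by near: e; apply: nbhs_right_lt; rewrite subr_gt0.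
  by rewrite !fh //; apply/andP; split; lra.
apply: cvg_trans (cvg_dnbhs_at_left hg); apply: near_eq_cvg.
near=> e; have e0 : e < 0 by near: e; apply: nbhs_left_lt.
have eb : a - t < e by near: e; apply: nbhs_left_gt; rewrite subr_lt0.
by rewrite !fg //; apply/andP; split; lra.
Unshelve. all: by end_near. Qed.

Lemma cder_glue (f g h : R -> C) (a t b : R) l : a < t < b ->
  cder g t l -> cder h t l ->
  (forall s, a < s <= t -> f s = g s) -> (forall s, t <= s < b -> f s = h s) ->
  cder f t l.
Proof.
move=> atb [g1 g2] [h1 h2] fg fh; split.
  by apply: (is_derive_glue atb g1 h1) => s sab; rewrite ?(fg s sab) ?(fh s sab).
by apply: (is_derive_glue atb g2 h2) => s sab; rewrite ?(fg s sab) ?(fh s sab).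
Qed.

Lemma is_derive_shift (f : R -> R) (c t l : R) :
  is_derive (t - c) 1 f l -> is_derive t 1 (fun s => f (s - c)) l.
Proof.
move=> /is_derive1E h; apply/is_derive1E.
by under eq_fun do rewrite -addrA.
Qed.

Lemma cder_shift (f : R -> C) (c t : R) l :
  cder f (t - c) l -> cder (fun s => f (s - c)) t l.
Proof. by move=> [h1 h2]; split; apply: (is_derive_shift (f := fun s => _ (f s))). Qed.

(** The local solutions all live for the same time [d], so they are restarted at the multiples of a
    step [e]. Taking [e] strictly below [d] keeps each piece differentiable at its right end. *)
Lemma solution_exists (H0 H1 rhod x0 : 'M[C]_n) :
  H0 \is hermsymmx -> H1 \is hermsymmx -> rhod \is hermsymmx -> isospectral rhod x0 ->
  exists x, solution H0 H1 rhod x0 x.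
Proof.
move=> hH0 hH1 hrd ix0.
have [d d0 hloc] := local_solution hH0 hH1 hrd.
have /choice[loc locP] : forall y0, exists y : R -> 'M[C]_n, isospectral rhod y0 ->
    y 0 = y0 /\ forall t : R, `|t| < d ->
      isospectral rhod (y t) /\ mder y t (closed_loop H0 H1 rhod (y t)).
  move=> y0; have [iy0|niy0] := pselect (isospectral rhod y0); last by exists (fun=> 0).
  by have [y ? ?] := hloc y0 iy0; exists y.
have [e e0 ed] : exists2 e : R, 0 < e & e < d by exists (d / 2); lra.
pose xs k := iter k (fun y => loc y e) x0.
have ixs k : isospectral rhod (xs k).
  elim: k => [//|k IH]; rewrite /xs iterS -/(xs k).
  by have [_ /(_ e)] := locP _ IH; rewrite gtr0_norm // => /(_ ed)[].
pose x (t : R) := loc (xs (Num.truncn (t / e))) (t - (Num.truncn (t / e))%:R * e).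
(* Both ends are included: at a grid point the piece that ends and the piece that starts have the
   same value. *)
have xE k t : k%:R * e <= t <= k.+1%:R * e -> x t = loc (xs k) (t - k%:R * e).
  move=> /andP[t1]; rewrite le_eqVlt => /orP[/eqP ->|t2].
    have -> : x (k.+1%:R * e) = loc (xs k.+1) 0.
      by rewrite /x mulfK ?gt_eqF // natrK subrr.
    rewrite (locP _ (ixs _)).1 -natr1 mulrDl mul1r addrAC subrr add0r.
    by rewrite /xs iterS.
  suff tk : Num.truncn (t / e) = k by rewrite /x tk.
  have t0 : 0 <= t by apply: le_trans t1; rewrite mulr_ge0 // ltW.
  apply/eqP; rewrite truncn_eq ?divr_ge0 ?(ltW e0) //.
  by rewrite ler_pdivlMr // ltr_pdivrMr // t1.
have stepP (t : R) : 0 <= t -> exists k, k%:R * e <= t < k.+1%:R * e.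
  move=> t0; exists (Num.truncn (t / e)).
  by rewrite -ler_pdivlMr // -ltr_pdivrMr // truncn_itv // divr_ge0 // ltW.
have small k (t : R) : k%:R * e <= t <= k.+1%:R * e -> `|t - k%:R * e| < d.
  by rewrite -natr1 mulrDl mul1r => /andP[h1 h2]; rewrite ger0_norm; lra.
have ix (t : R) : 0 <= t -> isospectral rhod (x t).
  move=> /stepP[k /andP[k1 /ltW k2]]; have kt : k%:R * e <= t <= k.+1%:R * e by rewrite k1.
  by rewrite (xE k) //; apply: ((locP _ (ixs k)).2 _ (small _ _ kt)).1.
have x0E : x 0 = x0.
  have h0 : 0%:R * e <= 0 <= 1%:R * e by rewrite mul0r lexx mul1r ltW.
  by rewrite (xE 0%N) // mul0r subr0 (locP _ (ixs 0%N)).1.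
have dpiece k (t : R) : k%:R * e <= t <= k.+1%:R * e ->
    mder (fun s => loc (xs k) (s - k%:R * e)) t (closed_loop H0 H1 rhod (x t)).
  move=> kt i j; apply: (cder_shift (f := fun s => loc (xs k) s i j)); rewrite (xE k) //.
  exact: ((locP _ (ixs k)).2 _ (small _ _ kt)).2.
exists x; split => //.
- apply/realify_cvgP.
  have h0 : 0%:R * e <= 0 <= 1%:R * e by rewrite mul0r lexx mul1r ltW.
  have /mder_mcvg h := dpiece 0%N 0 h0.
  move=> i j; have [h1 h2] := h i j.
  have E : \forall s \near 0^'+, loc (xs 0%N) (s - 0%:R * e) = x s.
    near=> s; rewrite (xE 0%N) // mul0r mul1r; apply/andP; split.
      by near: s; apply: nbhs_right_ge.
    by near: s; apply: nbhs_right_le.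
  move: h1 h2; rewrite -(xE 0%N) // => h1 h2; split.
    apply: cvg_trans (cvg_at_right_filter h1); apply: near_eq_cvg.
    by apply: filterS E => s ->.
  apply: cvg_trans (cvg_at_right_filter h2); apply: near_eq_cvg.
  by apply: filterS E => s ->.
- move=> t t0; apply/realify_deriveP => i j.
  have [k /andP[k1 k2]] := stepP t (ltW t0).
  have hk := dpiece k t; rewrite k1 (ltW k2) in hk.
  have {hk} hr := hk isT i j.
  (* The piece on the left of [t]; it differs from the piece on the right only when [t] is a grid
     point. *)
  have [k' /andP[k'1 k'2]] : exists k', k'%:R * e < t <= k'.+1%:R * e.
    move: k1; rewrite le_eqVlt => /orP[/eqP kt|kt]; last by exists k; rewrite kt ltW.
    case: k kt k2 {hr} => [kt|k kt _]; first by move: t0; rewrite -kt mul0r ltxx.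
    by exists k; rewrite kt lexx -kt ltr_pM2r // ltr_nat leqnn.
  have hk' := dpiece k' t; rewrite (ltW k'1) k'2 in hk'.
  have {hk'} hl := hk' isT i j.
  have tt : k'%:R * e < t < k.+1%:R * e by rewrite k'1.
  apply: (cder_glue tt hl hr) => s /andP[s1 s2].
    by rewrite (xE k') // ltW //= (le_trans s2).
  by rewrite (xE k) // (le_trans k1) //= ltW.
Unshelve. all: by end_near. Qed.

End global_existence.

(** * Convergence to diagonal matrices *)

Section hermitian_forms.
Variables (R : realType) (n : nat).
Local Notation C := R[i].
Local Notation I := ('I_n * 'I_n)%type.
Implicit Types (M : I -> I -> C) (w z : 'M[C]_n).

(** A form in the entries of [w], its matrix being indexed by pairs of indices. No symmetry of [M]
    is imposed; the estimates use the real part. *)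
Definition hform M w : C :=
  \sum_(i : I) \sum_(j : I) M i j * (w i.1 i.2 * Num.conj (w j.1 j.2)).

(** The derivative of [hform M] at [w] in the direction [z]. *)
Definition hpol M w z : C :=
  \sum_(i : I) \sum_(j : I)
    M i j * (z i.1 i.2 * Num.conj (w j.1 j.2) + w i.1 i.2 * Num.conj (z j.1 j.2)).

Lemma cder_hform M (w : R -> 'M[C]_n) t z : mder w t z ->
  cder (fun t => hform M (w t)) t (hpol M (w t) z).
Proof.
move=> h; apply: cder_sum => i _; apply: cder_sum => j _.
have := cderM (cder_cst (M i j) t) (cderM (h i.1 i.2) (cderJ (h j.1 j.2))).
by rewrite mul0r add0r.
Qed.

Lemma hpolD M w z z' : hpol M w (z + z') = hpol M w z + hpol M w z'.
Proof.
rewrite /hpol -big_split; apply: eq_bigr => i _; rewrite -big_split; apply: eq_bigr => j _ /=.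
by rewrite !mxE rmorphD /=; ring.
Qed.

Lemma hformD M w z : hform M (w + z) = hform M w + hpol M w z + hform M z.
Proof.
rewrite /hpol /hform -!big_split; apply: eq_bigr => i _; rewrite -!big_split.
by apply: eq_bigr => j _ /=; rewrite !mxE rmorphD /=; ring.
Qed.

Lemma hform_comb c M M' w : hform (fun i j => c * M i j - M' i j) w = c * hform M w - hform M' w.
Proof.
rewrite /hform mulr_sumr -sumrB; apply: eq_bigr => i _; rewrite mulr_sumr -sumrB.
by apply: eq_bigr => j _; ring.
Qed.

Lemma hpol_comb c M M' w z :
  hpol (fun i j => c * M i j - M' i j) w z = c * hpol M w z - hpol M' w z.
Proof.
rewrite /hpol mulr_sumr -sumrB; apply: eq_bigr => i _; rewrite mulr_sumr -sumrB.
by apply: eq_bigr => j _; ring.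
Qed.

Lemma conjCZ (c : R) (u : C) : Num.conj (c%:C * u) = c%:C * Num.conj u.
Proof. by rewrite rmorphM /= conjCR. Qed.

Lemma hpolZ M w (c : R) z : hpol M w (c%:C *: z) = c%:C * hpol M w z.
Proof.
rewrite /hpol mulr_sumr; apply: eq_bigr => i _; rewrite mulr_sumr; apply: eq_bigr => j _.
by rewrite !mxE !conjCZ; ring.
Qed.

Lemma hformZ M (c : R) w : hform M (c%:C *: w) = (c ^+ 2)%:C * hform M w.
Proof.
rewrite /hform mulr_sumr; apply: eq_bigr => i _; rewrite mulr_sumr; apply: eq_bigr => j _.
by rewrite !mxE !conjCZ expr2 rmorphM /=; ring.
Qed.

Lemma hpolZl M (c : R) w z : hpol M (c%:C *: w) z = c%:C * hpol M w z.
Proof.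
rewrite /hpol mulr_sumr; apply: eq_bigr => i _; rewrite mulr_sumr; apply: eq_bigr => j _.
by rewrite !mxE !conjCZ; ring.
Qed.

Definition hnorm M : R := \sum_(i : I) \sum_(j : I) nm (M i j).

Lemma hnorm_ge0 M : 0 <= hnorm M.
Proof. by apply: sumr_ge0 => i _; apply: sumr_ge0 => j _; apply: nm_ge0. Qed.

Lemma nm_hform M w : nm (hform M w) <= hnorm M * mnorm w ^+ 2.
Proof.
apply: (le_trans (nm_sum _ _ _)); rewrite mulr_suml; apply: ler_sum => i _.
apply: (le_trans (nm_sum _ _ _)); rewrite mulr_suml; apply: ler_sum => j _.
apply: (le_trans (nmM _ _)); apply: ler_wpM2l; first exact: nm_ge0.
apply: (le_trans (nmM _ _)); rewrite nmJ expr2.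
by apply: ler_pM; rewrite ?nm_ge0 ?nm_le_mnorm.
Qed.

Lemma nm_hpol M w z : nm (hpol M w z) <= 2 * hnorm M * mnorm w * mnorm z.
Proof.
have -> : 2 * hnorm M * mnorm w * mnorm z = hnorm M * (2 * mnorm w * mnorm z) by ring.
apply: (le_trans (nm_sum _ _ _)); rewrite mulr_suml; apply: ler_sum => i _.
apply: (le_trans (nm_sum _ _ _)); rewrite mulr_suml; apply: ler_sum => j _.
apply: (le_trans (nmM _ _)); apply: ler_wpM2l; first exact: nm_ge0.
apply: (le_trans (nmD _ _)).
have h1 : nm (z i.1 i.2 * Num.conj (w j.1 j.2)) <= mnorm z * mnorm w.
  by apply: (le_trans (nmM _ _)); rewrite nmJ ler_pM ?nm_ge0 ?nm_le_mnorm.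
have h2 : nm (w i.1 i.2 * Num.conj (z j.1 j.2)) <= mnorm w * mnorm z.
  by apply: (le_trans (nmM _ _)); rewrite nmJ ler_pM ?nm_ge0 ?nm_le_mnorm.
by lra.
Qed.

Definition off w : 'M[C]_n := \matrix_(k, l) if k == l then 0 else w k l.

Lemma mnorm_off w : mnorm (off w) <= mnorm w.
Proof.
apply: ler_sum => k _; apply: ler_sum => l _; rewrite mxE.
by case: ifP => _ //; rewrite nm0 nm_ge0.
Qed.

Lemma nm_off w k l : k != l -> nm (w k l) <= mnorm (off w).
Proof. by move=> /negbTE kl; have := nm_le_mnorm (off w) k l; rewrite mxE kl. Qed.

Lemma mnorm_off_diag w (c : R) : (forall k, nm (w k k) <= c) -> mnorm w <= mnorm (off w) + n%:R * c.
Proof.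
move=> h; rewrite -[n in n%:R]card_ord mulr_natl -sumr_const /mnorm -big_split.
apply: ler_sum => k _ /=; rewrite (bigD1 k) //= [in leRHS](bigD1 k) //=.
rewrite mxE eqxx nm0 add0r addrC; apply: lerD; last exact: h.
by apply: ler_sum => l lk; rewrite mxE eq_sym (negbTE lk).
Qed.

(** Such forms do not see the diagonal, so they and their error terms are bounded through the
    off-diagonal part, the only part that the dissipation controls. *)
Definition off_supported M :=
  (forall i j, i.1 = i.2 -> M i j = 0) /\ (forall i j, j.1 = j.2 -> M i j = 0).

Lemma hform_off M w : off_supported M -> hform M (off w) = hform M w.
Proof.
move=> [h1 h2]; apply: eq_bigr => i _; apply: eq_bigr => j _; rewrite !mxE.
case: eqP => [/h1 ->|_]; first by rewrite !mul0r.
by case: eqP => [/h2 ->|_ //]; rewrite !mul0r.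
Qed.

Lemma hpol_off M w z : off_supported M -> hpol M (off w) (off z) = hpol M w z.
Proof.
move=> [h1 h2]; apply: eq_bigr => i _; apply: eq_bigr => j _; rewrite !mxE.
case: eqP => [/h1 ->|_]; first by rewrite !mul0r.
by case: eqP => [/h2 ->|_ //]; rewrite !mul0r.
Qed.

Lemma sqr_sum_le (J : finType) (u : J -> R) : (\sum_i u i) ^+ 2 <= #|J|%:R * \sum_i u i ^+ 2.
Proof.
have S2 : (\sum_i u i) ^+ 2 = \sum_i \sum_j u i * u j.
  by rewrite expr2 mulr_suml; apply: eq_bigr => i _; rewrite mulr_sumr.
have SA : \sum_(i : J) \sum_(j : J) u i ^+ 2 = #|J|%:R * \sum_i u i ^+ 2.
  by rewrite mulr_sumr; apply: eq_bigr => i _; rewrite sumr_const mulr_natl.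
have SB : \sum_(i : J) \sum_(j : J) u j ^+ 2 = #|J|%:R * \sum_i u i ^+ 2.
  by rewrite exchange_big.
have : 2 * \sum_i \sum_j u i * u j <=
    \sum_(i : J) \sum_(j : J) u i ^+ 2 + \sum_(i : J) \sum_(j : J) u j ^+ 2.
  rewrite mulr_sumr -big_split; apply: ler_sum => i _; rewrite mulr_sumr -big_split.
  by apply: ler_sum => j _ /=; have := sqr_ge0 (u i - u j); nra.
by rewrite -S2 SA SB; lra.
Qed.

Lemma mnorm_sqr_le w : mnorm w ^+ 2 <= (2 * (n * n)%:R) * \sum_(i : I) sq (w i.1 i.2).
Proof.
rewrite /mnorm (pair_bigA _ (fun i j => nm (w i j))) /=.
apply: (le_trans (sqr_sum_le _)); rewrite card_prod card_ord [2 * _]mulrC -mulrA.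
rewrite ler_wpM2l ?ler0n // mulr_sumr; apply: ler_sum => i _; exact: nm_le_sq.
Qed.

Lemma sum_sq_le w : \sum_(i : I) sq (w i.1 i.2) <= mnorm w ^+ 2.
Proof.
have : mnorm w = \sum_(i : I) nm (w i.1 i.2).
  by rewrite /mnorm (pair_bigA _ (fun i j => nm (w i j))).
rewrite expr2 => {1}->; rewrite mulr_suml; apply: ler_sum => i _.
apply: (le_trans (sq_le_nm _)); rewrite expr2; apply: ler_wpM2l; first exact: nm_ge0.
exact: nm_le_mnorm.
Qed.

Lemma pos_lower_bound (J : finType) (P : pred J) (u : J -> R) :
  (forall i, P i -> 0 < u i) -> exists2 c : R, 0 < c & forall i, P i -> c <= u i.
Proof.
move=> hu; exists (\big[Num.min/1]_(i | P i) u i).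
  by elim/big_ind : _ => // x y x0 y0; rewrite lt_min x0.
by move=> i Pi; rewrite (bigD1 i) //= ge_min lexx.
Qed.

End hermitian_forms.

Notation cdiag v := (diag_mx (map_mx (real_complex _) v)).

(** * The closed loop in an eigenbasis of the free Hamiltonian *)

Section eigenbasis.
Variables (R : realType) (n : nat).
Local Notation C := R[i].
Local Notation Re := (@complex.Re R).
Local Notation I := ('I_n * 'I_n)%type.
Variables (a r : 'rV[R]_n) (b : 'M[C]_n).

Definition omega (i : I) : R := a 0 i.2 - a 0 i.1.

Definition rot (x : 'M[C]_n) : 'M[C]_n := \matrix_(k, l) ('i * (omega (k, l))%:C * x k l).

(* The feedback is the linear form [x |-> \sum_i cf i * x i.1 i.2]. *)
Definition cf (i : I) : C := - 'i * b i.2 i.1 * (r 0 i.2 - r 0 i.1)%:C.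

Definition drive (x : 'M[C]_n) : 'M[C]_n := - 'i *: commutator b x.

Local Notation f := (feedback b (cdiag r)).

Lemma cdiagE (v : 'rV[R]_n) k l : (cdiag v : 'M[C]_n) k l = if k == l then (v 0 k)%:C else 0.
Proof. by rewrite !mxE; case: eqP => [->|_]; rewrite ?mulr1n ?mulr0n. Qed.

Lemma mulmx_cdiag (x : 'M[C]_n) v k l : (x *m cdiag v) k l = x k l * (v 0 l)%:C.
Proof.
rewrite mxE (bigD1 l) //= cdiagE eqxx big1 ?addr0 // => j jl.
by rewrite cdiagE (negbTE jl) mulr0.
Qed.

Lemma mulmx_cdiagl (x : 'M[C]_n) v k l : (cdiag v *m x) k l = (v 0 k)%:C * x k l.
Proof.
rewrite mxE (bigD1 k) //= cdiagE eqxx big1 ?addr0 // => j jl.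
by rewrite cdiagE eq_sym (negbTE jl) mul0r.
Qed.

Lemma feedbackE x : f x = \sum_(i : I) cf i * x i.1 i.2.
Proof.
rewrite -(pair_bigA _ (fun k l => cf (k, l) * x k l)) /= /feedback commutatorZl -scalemxAl mxtraceZ.
have -> : \tr (commutator b x *m cdiag r) =
    \sum_k \sum_l b k l * x l k * (r 0 k)%:C - \sum_k \sum_l x k l * b l k * (r 0 k)%:C.
  rewrite -sumrB; apply: eq_bigr => k _; rewrite mulmx_cdiag !mxE mulrBl !mulr_suml.
  by [].
rewrite [X in X - _]exchange_big -sumrB mulr_sumr; apply: eq_bigr => k _.
rewrite -sumrB mulr_sumr; apply: eq_bigr => l _.
by rewrite /cf /= rmorphB /=; ring.
Qed.

Lemma commutator_entry (A B : 'M[C]_n) k l :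
  commutator A B k l = (A *m B) k l - (B *m A) k l.
Proof. by rewrite /commutator mxE [X in _ + X]mxE. Qed.

Lemma rotE x : rot x = - 'i *: commutator (cdiag a) x.
Proof.
apply/matrixP => k l; rewrite [LHS]mxE [RHS]mxE commutator_entry mulmx_cdiag mulmx_cdiagl.
by rewrite /omega /= rmorphB /=; ring.
Qed.

Lemma closed_loopE x : closed_loop (cdiag a) b (cdiag r) x = rot x + f x *: drive x.
Proof.
rewrite /closed_loop commutatorDl commutatorZl scalerDr rotE; congr (_ + _).
by rewrite /drive !scalerA mulrC.
Qed.

Lemma rotB x y : rot (x - y) = rot x - rot y.
Proof. by apply/matrixP => k l; rewrite !mxE; ring. Qed.

Lemma cf_diag i : i.1 = i.2 -> cf i = 0.
Proof. by move=> e; rewrite /cf e subrr mulr0. Qed.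

Lemma feedback_off x : f (off x) = f x.
Proof.
rewrite !feedbackE; apply: eq_bigr => i _; rewrite mxE.
by case: eqP => // /cf_diag ->; rewrite !mul0r.
Qed.

Lemma nm_feedback_off x : nm (f x) <= 2 * mnorm b * mnorm (cdiag r : 'M[C]_n) * mnorm (off x).
Proof. by rewrite -feedback_off; apply: nm_feedback. Qed.

Lemma mnorm_drive x : mnorm (drive x) <= 2 * mnorm b * mnorm x.
Proof.
apply: (le_trans (mnormZ _ _)); rewrite nmN nm_i mul1r; exact: mnorm_commutator.
Qed.

Lemma driveB x y : drive (x - y) = drive x - drive y.
Proof. by rewrite /drive commutatorBr scalerBr. Qed.

(* Solves the homological equation [dRm/dt = |f|^2 - \sum_i |cf i|^2 |w_i|^2] along the
   free rotation.  Resonant pairs are harmless: either [i = j], where the inverse is [0],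
   or one of the coefficients vanishes. *)
Definition Rm (i j : I) : C :=
  cf i * Num.conj (cf j) * ('i * (omega i - omega j)%:C)^-1.

Lemma Rm_off : off_supported Rm.
Proof.
split=> i j /cf_diag h; rewrite /Rm h; first by rewrite !mul0r.
by rewrite rmorph0 mulr0 mul0r.
Qed.

(** Under [hfreq] this is the time average of [|f|^2] along the free rotation, distinct frequencies
    being uncorrelated. Unlike [|f|^2], it dominates the whole off-diagonal part, see
    [dsum_lower_bound]. *)
Definition dsum (w : 'M[C]_n) : R := \sum_(i : I) sq (cf i) * sq (w i.1 i.2).

Hypothesis hfreq : forall i j : I, i.1 != i.2 -> j.1 != j.2 -> omega i = omega j -> i = j.

(** Along the rotation the product of w_i and the conjugate of w_j is multiplied by i (omega_i -
    omega_j), which cancels the denominator in [Rm]. What survives are the terms of [|f w|^2] with i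
    different from j. *)
Lemma hpol_Rm_rot w : hpol Rm w (rot w) = f w * Num.conj (f w) - (dsum w)%:C.
Proof.
pose t i := cf i * w i.1 i.2.
have -> : (dsum w)%:C = \sum_(i : I) \sum_(j : I)
    if j == i then t i * Num.conj (t j) else 0.
  rewrite /dsum rmorph_sum; apply: eq_bigr => i _; rewrite -big_mkcond big_pred1_eq.
  rewrite rmorphM /= !sqE /t; move: (cf i) (w i.1 i.2) => c v.
  by rewrite rmorphM /=; ring.
rewrite !feedbackE rmorph_sum mulr_suml -sumrB; apply: eq_bigr => i _.
rewrite mulr_sumr -sumrB; apply: eq_bigr => j _.
rewrite -/(t i) -/(t j) [rot w _ _]mxE [rot w _ _]mxE -!surjective_pairing.
have J x y : Num.conj ('i * x%:C * y) = - 'i * x%:C * Num.conj y :> C.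
  by rewrite !rmorphM /= conjCi conjCR.
have [->|ji] := eqVneq j i; first by rewrite /Rm subrr mulr0 invr0 !(mulr0, mul0r) subrr.
rewrite subr0 J; have [|wij] := eqVneq (omega i) (omega j); last first.
  have D0 : 'i * (omega i - omega j)%:C != 0 :> C.
    rewrite mulf_neq0 ?neq0Ci //; apply/eqP => /(congr1 Re) /= /eqP.
    by rewrite subr_eq0 (negbTE wij).
  rewrite /Rm /t; move: (cf i) (cf j) => ci cj; rewrite rmorphM /=.
  have -> : 'i * (omega i)%:C * w i.1 i.2 * Num.conj (w j.1 j.2) +
      w i.1 i.2 * (- 'i * (omega j)%:C * Num.conj (w j.1 j.2)) =
      'i * (omega i - omega j)%:C * (w i.1 i.2 * Num.conj (w j.1 j.2)).
    by move: (omega i) (omega j) => x y; rewrite rmorphB /=; ring.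
  by rewrite mulrA divfK //; ring.
move=> wij; have [i0|i0] := eqVneq i.1 i.2.
  by rewrite /Rm /t (cf_diag i0) !mul0r.
have [j0|j0] := eqVneq j.1 j.2.
  by rewrite /Rm /t (cf_diag j0) !(mul0r, conjC0, rmorph0, mulr0).
by rewrite (hfreq i0 j0 wij) eqxx in ji.
Qed.

Hypothesis hb : b \is hermsymmx.

Section saddle.
Variable s : 'rV[R]_n.

(* Second variation of [\tr (x *m cdiag r)] at the critical point [cdiag s] of its
   restriction to the orbit. *)
Definition qc (i : I) : R := (r 0 i.1 - r 0 i.2) / (s 0 i.2 - s 0 i.1).

Definition Qm (i j : I) : C := if i == j then (qc i)%:C else 0.

Lemma Qm_off : off_supported Qm.
Proof.
have q0 i : i.1 = i.2 -> (qc i)%:C = 0 :> C by move=> e; rewrite /qc e subrr mul0r.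
split=> i j h; rewrite /Qm; case: eqP => // e; first exact: q0.
by apply: q0; rewrite e.
Qed.

Lemma hformQE w : hform Qm w = (\sum_i qc i * sq (w i.1 i.2))%:C.
Proof.
rewrite /hform rmorph_sum; apply: eq_bigr => i _; rewrite (bigD1 i) //= big1 ?addr0.
  by rewrite /Qm eqxx -sqE -rmorphM.
by move=> j; rewrite /Qm eq_sym => /negbTE ->; rewrite mul0r.
Qed.

Lemma hpolQE w z : hpol Qm w z = \sum_i (qc i)%:C *
  (z i.1 i.2 * Num.conj (w i.1 i.2) + w i.1 i.2 * Num.conj (z i.1 i.2)).
Proof.
rewrite /hpol; apply: eq_bigr => i _; rewrite (bigD1 i) //= big1 ?addr0.
  by rewrite /Qm eqxx.
by move=> j; rewrite /Qm eq_sym => /negbTE ->; rewrite mul0r.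
Qed.

Lemma hpol_Qm_rot w : hpol Qm w (rot w) = 0.
Proof.
rewrite hpolQE big1 // => i _; rewrite mxE !rmorphM /= conjCi conjCR.
by ring.
Qed.

Hypothesis sinj : injective (s 0).

(** The linearized control term at [cdiag s] is [f w *: drive (cdiag s)]. Along it the form [Qm]
    grows at rate 2 f(w)^2: this is the counterpart, for differences of solutions, of V' = f^2. *)
Lemma hpol_Qm_drive w : w \is hermsymmx -> hpol Qm w (drive (cdiag s)) = 2 * f w.
Proof.
move=> hw; rewrite hpolQE feedbackE.
(* Conjugation exchanges the entries (k, l) and (l, k) of the Hermitian [b] and [w], so each summand
   on the left matches a pair of summands of [f w]. *)
have swap : \sum_(i : I) cf (i.2, i.1) * w i.2 i.1 = \sum_(i : I) cf i * w i.1 i.2.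
  rewrite [RHS](reindex_inj (can_inj (g := fun i : I => (i.2, i.1))
    (f := fun i : I => (i.2, i.1)) _)) //; by case.
rewrite mulr2n mulrDl mul1r -{1}swap -big_split; apply: eq_bigr => i _ /=.
have [i0|i0] := eqVneq i.1 i.2.
  by rewrite /qc (cf_diag i0) cf_diag // i0 subrr !mul0r addr0.
have s0 : s 0 i.2 - s 0 i.1 != 0 by rewrite subr_eq0 eq_sym (inj_eq sinj).
have e : (qc i)%:C * (s 0 i.2 - s 0 i.1)%:C = (r 0 i.1 - r 0 i.2)%:C :> C.
  by rewrite -rmorphM /qc /= divfK.
have de : drive (cdiag s) i.1 i.2 = - 'i * b i.1 i.2 * (s 0 i.2 - s 0 i.1)%:C.
  rewrite mxE commutator_entry mulmx_cdiag mulmx_cdiagl.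
  by move: (s 0 i.2) (s 0 i.1) (b i.1 i.2) => x y z; rewrite rmorphB /=; ring.
have dJ : Num.conj (drive (cdiag s) i.1 i.2) = 'i * b i.2 i.1 * (s 0 i.2 - s 0 i.1)%:C.
  rewrite de; move: (s 0 i.2 - s 0 i.1) => x.
  by rewrite !rmorphM rmorphN /= conjCi opprK conjCR herm_entry.
rewrite dJ de (herm_entry _ _ hw).
transitivity ((qc i)%:C * (s 0 i.2 - s 0 i.1)%:C *
  (- 'i * b i.1 i.2 * w i.2 i.1 + 'i * b i.2 i.1 * w i.1 i.2)); first by ring.
rewrite e /cf /=; move: (r 0 i.1) (r 0 i.2) => x y.
by rewrite -[(y - x)%:C](opprK) -rmorphN opprB; ring.
Qed.

End saddle.

End eigenbasis.

(** * Limits at infinity of real functions controlled by a bounded increasing one *)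

Section monotone_limits.
Variable R : realType.
Implicit Types g L dg dL u : R -> R.

(** Time starts at 1 here and below because a solution is differentiated at positive times only. *)
Lemma monotone_cvg_pinfty g (B : R) : (forall s t, 1 <= s <= t -> g s <= g t) ->
  (forall t, 1 <= t -> g t <= B) -> exists l : R, g t @[t --> +oo] --> l.
Proof.
move=> gm gB; pose h (t : R) := g (Num.max t 1).
have hm : {homo h : s t / s <= t}.
  move=> s t st; apply: gm; rewrite le_max lexx orbT /=.
  by rewrite ge_max !le_max st lexx !orbT.
have hB : has_ubound (range h).
  by exists B => _ [t _ <-]; apply: gB; rewrite le_max lexx orbT.
exists (sup (range h)); apply: cvg_trans (nondecreasing_cvgr hm hB).
apply: near_eq_cvg; near=> t.
have t1 : 1 <= t by near: t; apply: nbhs_pinfty_ge; apply: num_real.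
by rewrite /h max_l.
Unshelve. all: by end_near. Qed.

(** Both [g + c L] and [c L] are nondecreasing and bounded, so their difference converges; this
    replaces the integrability of [dg]. *)
Lemma dominated_cvg_pinfty g L dg dL (c B : R) :
  (forall t : R, 1 <= t -> is_derive t 1 g (dg t)) ->
  (forall t : R, 1 <= t -> is_derive t 1 L (dL t)) ->
  (forall t, 1 <= t -> `|dg t| <= c * dL t) ->
  (forall t, 1 <= t -> `|g t| <= B) -> (forall t, 1 <= t -> `|c * L t| <= B) ->
  exists l : R, g t @[t --> +oo] --> l.
Proof.
move=> hg hL dom gB LB.
have hcL (t : R) : 1 <= t -> is_derive t 1 (fun s => c * L s) (c * dL t).
  by move=> t1; have := is_deriveZ c (hL t t1).
have [l1 h1] : exists l : R, g t + c * L t @[t --> +oo] --> l.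
  apply: (@monotone_cvg_pinfty _ (B + B)) => [s t /andP[s1 st]|t t1].
    apply: (@derive_ge0_le _ (fun t => g t + c * L t) (fun t => dg t + c * dL t)) => // x /andP[sx _].
      have x1 := le_trans s1 sx; exact: is_deriveD (hg x x1) (hcL x x1).
    have /ler_normlP[] := dom x (le_trans s1 sx); lra.
  by apply: lerD; apply: le_trans (ler_norm _) _; [apply: gB|apply: LB].
have [l2 h2] : exists l : R, c * L t @[t --> +oo] --> l.
  apply: (@monotone_cvg_pinfty _ B) => [s t /andP[s1 st]|t t1].
    apply: (@derive_ge0_le _ (fun t => c * L t) (fun t => c * dL t)) => // x /andP[sx _].
      by apply: hcL; apply: le_trans sx.
    exact: le_trans (normr_ge0 _) (dom x (le_trans s1 sx)).
  by apply: le_trans (ler_norm _) _; apply: LB.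
exists (l1 - l2); have -> : g = (fun t => (g t + c * L t) - c * L t).
  by apply/funext => t; rewrite addrK.
exact: cvgB.
Qed.

Lemma derive_unbounded L dL (k T B : R) : 0 < k ->
  (forall t : R, T <= t -> is_derive t 1 L (dL t)) -> (forall t, T <= t -> k <= dL t) ->
  (forall t, T <= t -> `|L t| <= B) -> False.
Proof.
move=> k0 hL hk LB.
have grow t : T <= t -> L T + k * (t - T) <= L t.
  move=> Tt; rewrite -subr_ge0.
  have h : L T - k * T <= L t - k * t.
    apply: (@derive_ge0_le _ (fun s => L s - k * s) (fun s => dL s - k)) => // s /andP[Ts _].
      have := is_deriveB (hL s Ts) (is_deriveZ k (is_derive_id s (1 : R))).
      by rewrite [k *: _]mulr1.
    by rewrite subr_ge0 hk.
  by move: h; lra.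
have B0 : 0 <= B := le_trans (normr_ge0 _) (LB T (lexx T)).
pose t := T + (2 * B + 1) / k.
have Tt : T <= t by rewrite lerDl divr_ge0 ?(ltW k0) //; lra.
have e : k * (t - T) = 2 * B + 1 by rewrite /t; field; rewrite gt_eqF.
have := grow t Tt; rewrite e.
by have /ler_normlP[] := LB t Tt; have /ler_normlP[] := LB T (lexx T); lra.
Qed.

(** A positive limit [l] would eventually give [L] a slope of at least k l / 2, against its
    boundedness. *)
Lemma dissipation_vanishes u L dL (k B l : R) : 0 < k ->
  (forall t : R, 1 <= t -> is_derive t 1 L (dL t)) -> (forall t, 1 <= t -> 0 <= u t) ->
  (forall t, 1 <= t -> k * u t <= dL t) -> (forall t, 1 <= t -> `|L t| <= B) ->
  u t @[t --> +oo] --> l -> l = 0.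
Proof.
move=> k0 hL u0 hk LB ul; apply/eqP; rewrite eq_le; apply/andP; split; last first.
  apply: (cvgr_to_ge ul); near=> t; apply: u0.
  by near: t; apply: nbhs_pinfty_ge; apply: num_real.
rewrite leNgt; apply/negP => l0.
have hl : l / 2 < l by lra.
have [T [Tr hT]] := cvgr_ge l ul _ hl.
pose T' := Num.max (T + 1) 1.
have T1 t : T' <= t -> T < t /\ 1 <= t by rewrite ge_max => /andP[? ?]; split => //; lra.
apply: (@derive_unbounded L dL (k * (l / 2)) T' B).
- by rewrite mulr_gt0 //; lra.
- by move=> t /T1[_]; apply: hL.
- by move=> t /T1[Tt t1]; apply: le_trans (hk t t1); rewrite ler_wpM2l ?(ltW k0) ?hT.
- by move=> t /T1[_]; apply: LB.
Unshelve. all: by end_near. Qed.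

End monotone_limits.

(** * The strict Lyapunov function and convergence of all trajectories *)

Section convergence.
Variables (R : realType) (n : nat).
Local Notation C := R[i].
Local Notation Re := (@complex.Re R).
Local Notation Im := (@complex.Im R).
Local Notation I := ('I_n * 'I_n)%type.
Variables (a r : 'rV[R]_n) (b : 'M[C]_n).
Hypothesis hfreq : forall i j : I, i.1 != i.2 -> j.1 != j.2 -> omega a i = omega a j -> i = j.
Hypothesis hb : b \is hermsymmx.
Hypothesis b0 : forall i : I, i.1 != i.2 -> b i.1 i.2 != 0.
Hypothesis rinj : injective (r 0).

Local Notation rhod := (cdiag r : 'M[C]_n).
Local Notation f := (feedback b rhod).
Local Notation K := (Rm a r b).

Lemma sq_gt0 (z : C) : z != 0 -> 0 < sq z.
Proof.
move=> z0; rewrite lt_neqAle sq_ge0 andbT; apply/eqP => h.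
have := nm_le_sq z; rewrite -h mulr0 => h2.
move/eqP: z0; apply; apply: nm_eq0.
by rewrite -(@ler_pXn2r _ 2) ?nnegrE ?nm_ge0 // expr0n.
Qed.

Lemma cf_gt0 (i : I) : i.1 != i.2 -> 0 < sq (cf r b i).
Proof.
move=> i0; apply: sq_gt0; rewrite /cf !mulf_neq0 ?oppr_eq0 ?neq0Ci //.
  by apply: (b0 (i := (i.2, i.1))); rewrite eq_sym.
by apply/eqP => /(congr1 Re) /= /eqP; rewrite subr_eq0 (inj_eq rinj) eq_sym (negbTE i0).
Qed.

Lemma dsum_lower_bound : exists2 m : R, 0 < m &
  forall w, m * mnorm (off w) ^+ 2 <= dsum r b w.
Proof.
have [c c0 hc] := pos_lower_bound (P := fun i : I => i.1 != i.2) cf_gt0.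
exists (c / (2 * (n * n)%:R + 1)).
  by rewrite divr_gt0 // ltr_wpDl // mulr_ge0.
move=> w; apply: (@le_trans _ _ (c * \sum_(i : I) sq (off w i.1 i.2))).
  rewrite -mulrA ler_wpM2l ?(ltW c0) // mulrC ler_pdivrMr; last first.
    by rewrite ltr_wpDl // mulr_ge0.
  apply: (le_trans (mnorm_sqr_le _)).
  have : 0 <= \sum_(i : I) sq (off w i.1 i.2) by apply: sumr_ge0 => i _; apply: sq_ge0.
  by lra.
rewrite mulr_sumr; apply: ler_sum => i _; rewrite mxE; case: eqP => [_|/eqP i0].
  by rewrite {1}/sq /= expr0n addr0 mulr0 mulr_ge0 ?sq_ge0.
by rewrite ler_wpM2r ?sq_ge0 ?hc.
Qed.

Lemma cdiag_herm (v : 'rV[R]_n) : (cdiag v : 'M[C]_n) \is hermsymmx.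
Proof.
apply/hermP/matrixP => k l; rewrite mxE [X in Num.conj X]mxE !cdiagE eq_sym.
by case: eqP => [->|_]; rewrite ?conjCR ?conjC0.
Qed.

Lemma feedback_Re w : w \is hermsymmx -> f w = (Re (f w))%:C.
Proof. by move=> hw; apply: conj_realE; apply: feedback_real => //; apply: cdiag_herm. Qed.

(** The perturbation [z] of the free rotation is arbitrary, so that the estimate applies both to a
    solution and to the difference of two solutions. *)
Lemma Rm_energy w z : w \is hermsymmx ->
  `|Re (hpol K w (rot a w + z)) - (Re (f w) ^+ 2 - dsum r b w)| <=
  2 * hnorm K * mnorm (off w) * mnorm z.
Proof.
move=> hw; rewrite hpolD hpol_Rm_rot // (feedback_Re hw) conjCR.
rewrite cReD cReB cReM !cRe_real cIm_real mulr0 subr0 -expr2.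
rewrite [X in `|X|](_ : _ = Re (hpol K w z)); last by ring.
rewrite -(hpol_off _ _ (Rm_off _ _ _)); apply: (le_trans (Re_le_nm _)).
apply: (le_trans (nm_hpol _ _ _)); rewrite ler_wpM2l ?mnorm_off //.
by rewrite !mulr_ge0 ?hnorm_ge0 ?mnorm_ge0.
Qed.

(* The [o * p] term is absorbed by AM-GM. *)
Lemma energy_amgm (m k A o p : R) : 0 < m -> 1 + k ^+ 2 / (2 * m) <= A ->
  m / 2 * o ^+ 2 <= (A - 1) * p ^+ 2 + m * o ^+ 2 - k * o * p.
Proof.
move=> m0 hA.
have h1 : k ^+ 2 / (2 * m) * p ^+ 2 <= (A - 1) * p ^+ 2.
  by rewrite ler_wpM2r ?sqr_ge0 //; lra.
have : 0 <= m / 2 * (o - k / m * p) ^+ 2 by rewrite mulr_ge0 ?sqr_ge0 //; lra.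
have -> : m / 2 * (o - k / m * p) ^+ 2 =
    m / 2 * o ^+ 2 - k * o * p + k ^+ 2 / (2 * m) * p ^+ 2.
  by field; rewrite gt_eqF.
by lra.
Qed.

(** A solution written in the eigenbasis, with the free rotation and the control separated.
    Right-continuity at 0 is a separate assumption where the initial state matters, in
    [trajectory_backward_lipschitz]. *)
Definition trajectory (x : R -> 'M[C]_n) :=
  (forall t : R, 0 <= t -> isospectral rhod (x t)) /\
  (forall t : R, 0 < t -> mder x t (rot a (x t) + f (x t) *: drive b (x t))).

Lemma isospectral_herm x : isospectral rhod x -> x \is hermsymmx.
Proof. by case=> -[]. Qed.

Lemma trace_rot x : \tr (rot a x *m rhod) = 0.
Proof.
apply: big1 => k _; rewrite mulmx_cdiag mxE /omega /= subrr.
by rewrite mulr0 !mul0r.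
Qed.

Lemma trace_drive x : \tr (drive b x *m rhod) = f x.
Proof. by rewrite /feedback commutatorZl. Qed.

(** As [f] is also bounded by the off-diagonal part, the diagonal entries of a solution move at a
    speed quadratic in that part. *)
Lemma drive_diag x k : drive b x k k = drive b (off x) k k.
Proof.
rewrite /drive !mxE; congr (_ * _); rewrite -!sumrB; apply: eq_bigr => j _; rewrite !mxE.
by case: eqP => [->|/eqP]; [rewrite eqxx; ring|rewrite eq_sym => /negbTE ->].
Qed.

(** The bounded function [Lc] grows at rate at least (m / 2) |off|^2, so any bounded quantity whose
    derivative is O(|off|^2) converges. This applies to the diagonal entries and to the squared
    moduli of the others; the limits of the latter must be 0, or [Lc] would be unbounded. *)
Lemma trajectory_converges x : trajectory x ->
  exists p : 'rV[R]_n, mcvg +oo x (cdiag p).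
Proof.
move=> [ix dx].
pose B : R := n%:R * n%:R * 2.
have B0 : 0 <= B by rewrite !mulr_ge0.
have xB (t : R) : 0 <= t -> mnorm (x t) <= B by move=> /ix; apply: isospectral_bounded.
have hx (t : R) : 0 <= t -> x t \is hermsymmx by move=> /ix; apply: isospectral_herm.
have [m m0 hm] := dsum_lower_bound.
set k0 := 2 * mnorm b.
have k00 : 0 <= k0 by rewrite mulr_ge0 ?mnorm_ge0.
set k1 := k0 * mnorm rhod; have k10 : 0 <= k1 by rewrite mulr_ge0 ?mnorm_ge0.
set k := 2 * hnorm K * (k0 * B).
have kK : 0 <= k by rewrite !mulr_ge0 ?hnorm_ge0 ?mnorm_ge0.
(* The least weight that [energy_amgm] accepts. *)
set A := 1 + k ^+ 2 / (2 * m).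
pose o t := mnorm (off (x t)).
pose p t := Re (f (x t)).
have o0 (t : R) : 0 <= o t := mnorm_ge0 _.
have fE (t : R) : 0 <= t -> f (x t) = (p t)%:C by move=> t0; apply: feedback_Re; apply: hx.
have po (t : R) : 0 <= t -> `|p t| <= k1 * o t.
  move=> t0; rewrite -nm_real -fE //; exact: nm_feedback_off.
have dB (t : R) : 0 <= t -> mnorm (drive b (x t)) <= k0 * B.
  by move=> t0; apply: (le_trans (mnorm_drive _ _)); rewrite ler_wpM2l ?xB.
pose Lc t : C := A%:C * \tr (x t *m rhod) - hform K (x t).
pose v t := rot a (x t) + f (x t) *: drive b (x t).
pose dLc t : C := A%:C * (f (x t) * f (x t)) - hpol K (x t) (v t).
have hL (t : R) : 0 < t -> cder Lc t (dLc t).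
  move=> t0; apply: cderB; last by apply: cder_hform; apply: dx.
  have h := cderM (cder_cst A%:C t) (cder_trace (mderM (dx t t0) (mder_cst rhod t))).
  apply: (cder_eq h); rewrite mul0r add0r mulmx0 addr0 mulmxDl -scalemxAl mxtraceD mxtraceZ.
  by rewrite trace_rot trace_drive add0r.
have dLo (t : R) : 0 < t -> m / 2 * o t ^+ 2 <= Re (dLc t).
  move=> /ltW t0; rewrite /dLc cReB fE // !cReM !cRe_real !cIm_real !mulr0 !mul0r !subr0.
  have /ler_normlP[_] := Rm_energy (f (x t) *: drive b (x t)) (hx t t0).
  rewrite -/(v t) -/(p t).
  have : 2 * hnorm K * mnorm (off (x t)) * mnorm (f (x t) *: drive b (x t)) <= k * o t * `|p t|.
    have -> : k * o t * `|p t| = 2 * hnorm K * o t * (`|p t| * (k0 * B)) by rewrite /k; ring.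
    rewrite ler_wpM2l //; first by rewrite !mulr_ge0 ?hnorm_ge0 ?mnorm_ge0.
    apply: (le_trans (mnormZ _ _)).
    by rewrite fE // nm_real ler_wpM2l ?dB.
  have := hm (x t); have := @energy_amgm m k A (o t) `|p t| m0 (lexx _).
  rewrite real_normK ?num_real // -/(o t).
  by rewrite expr2 [p t ^+ 2]expr2; lra.
pose BL := A * (B * mnorm rhod) + hnorm K * B ^+ 2.
have A0 : 0 <= A by rewrite addr_ge0 // divr_ge0 ?sqr_ge0 // mulr_ge0 // ltW.
have LB (t : R) : 0 <= t -> `|Re (Lc t)| <= BL.
  move=> t0; apply: (le_trans (Re_le_nm _)); apply: (le_trans (nmD _ _)); rewrite nmN.
  apply: lerD.
    apply: (le_trans (nmM _ _)); rewrite nm_real (ger0_norm A0) ler_wpM2l //.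
    apply: (le_trans (nm_trace _)); apply: (le_trans (mnormM _ _)).
    by rewrite ler_wpM2r ?mnorm_ge0 ?xB.
  apply: (le_trans (nm_hform _ _)); rewrite ler_wpM2l ?hnorm_ge0 //.
  by apply: lerXn2r; rewrite ?nnegrE ?mnorm_ge0 ?xB.
have pos (t : R) : 1 <= t -> 0 < t by apply: lt_le_trans.
have pos' (t : R) (t1 : 1 <= t) := ltW (pos t t1).
have conv (g dg : R -> R) (c Bg : R) : 0 <= c ->
    (forall t : R, 1 <= t -> is_derive t 1 g (dg t)) ->
    (forall t, 1 <= t -> `|dg t| <= c * o t ^+ 2) -> (forall t, 1 <= t -> `|g t| <= Bg) ->
    exists l : R, g t @[t --> +oo] --> l.
  move=> c0 hg hdg gB.
  have c0' : 0 <= 2 * c / m by apply: divr_ge0; [apply: mulr_ge0|apply: ltW].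
  apply: (@dominated_cvg_pinfty _ g (fun t => Re (Lc t)) dg (fun t => Re (dLc t))
    (2 * c / m) (Num.max Bg (2 * c / m * BL))) => // t t1.
  - by have [] := hL t (pos t t1).
  - apply: (le_trans (hdg t t1)).
    have -> : c * o t ^+ 2 = 2 * c / m * (m / 2 * o t ^+ 2) by field; rewrite gt_eqF.
    by apply: ler_wpM2l => //; apply: dLo (pos t t1).
  - by rewrite le_max gB.
  - rewrite normrM (ger0_norm c0') le_max; apply/orP; right.
    by apply: ler_wpM2l => //; apply: LB (pos' t t1).
have diag i : exists l : R, Re (x t i i) @[t --> +oo] --> l.
  apply: (conv _ (fun t => Re (v t i i)) (k1 * k0) B) => [|t t1|t t1|t t1].
  - by rewrite mulr_ge0.
  - by have [] := dx t (pos t t1) i i.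
  - have t0 := pos' t t1.
    have -> : v t i i = (p t)%:C * drive b (off (x t)) i i.
      by rewrite -drive_diag -fE // /v !mxE /omega /= subrr mulr0 mul0r add0r.
    apply: (le_trans (Re_le_nm _)); apply: (le_trans (nmM _ _)); rewrite nm_real.
    have -> : k1 * k0 * o t ^+ 2 = (k1 * o t) * (k0 * o t) by ring.
    rewrite ler_pM ?nm_ge0 ?po //.
    by apply: (le_trans (nm_le_mnorm _ _ _)); apply: mnorm_drive.
  - apply: (le_trans (Re_le_nm _)); apply: (le_trans (nm_le_mnorm _ _ _)); exact: xB (pos' t t1).
(* The phase of an off-diagonal entry keeps rotating; its squared modulus is invariant under the
   rotation and changes only at rate O(|f| |off|). *)
have offd i j : i != j -> sq (x t i j) @[t --> +oo] --> 0.
  move=> ij.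
  have no t : nm (x t i j) <= o t by apply: nm_off.
  have so t : sq (x t i j) <= o t ^+ 2.
    by apply: (le_trans (sq_le_nm _)); apply: lerXn2r; rewrite ?nnegrE ?nm_ge0 ?o0.
  have sqRe z : sq z = Re (z * Num.conj z) by rewrite -sqE.
  have dsq (t : R) : 0 < t -> is_derive t 1 (fun s => sq (x s i j))
      (p t * Re (drive b (x t) i j * Num.conj (x t i j) + x t i j * Num.conj (drive b (x t) i j))).
    move=> t0; have [h _] := cderM (dx t t0 i j) (cderJ (dx t t0 i j)).
    under eq_fun do rewrite sqRe; apply: (is_derive_eq h).
    have vE (D : 'M[C]_n) : (rot a (x t) + (p t)%:C *: D) i j =
        'i * (omega a (i, j))%:C * x t i j + (p t)%:C * D i j by rewrite !mxE.
    rewrite fE ?ltW // vE.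
    move: (x t i j) (drive b (x t) i j) (p t) (omega a (i, j)) => z g q w.
    by rewrite !ReImE; ring.
  have [L0 hL0] : exists L0 : R, sq (x t i j) @[t --> +oo] --> L0.
    apply: (conv _ _ (k1 * (2 * (k0 * B))) (B ^+ 2)) => [|t t1|t t1|t t1].
    + by rewrite !mulr_ge0 ?mnorm_ge0.
    + exact: dsq (pos t t1).
    + have t0 := pos' t t1; rewrite normrM.
      have -> : k1 * (2 * (k0 * B)) * o t ^+ 2 = k1 * o t * (k0 * B * o t + o t * (k0 * B)) by ring.
      rewrite ler_pM ?po //; apply: (le_trans (Re_le_nm _)); apply: (le_trans (nmD _ _)).
      have dk : nm (drive b (x t) i j) <= k0 * B by apply: (le_trans (nm_le_mnorm _ _ _)); apply: dB.
      by apply: lerD; apply: (le_trans (nmM _ _)); rewrite nmJ ler_pM ?nm_ge0.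
    + rewrite ger0_norm ?sq_ge0 //; apply: (le_trans (so t)).
      apply: lerXn2r; rewrite ?nnegrE ?mnorm_ge0 //; apply: (le_trans (mnorm_off _)).
      exact: xB (pos' t t1).
  suff -> : 0 = L0 by [].
  apply/esym; apply: (@dissipation_vanishes _ (fun t => sq (x t i j)) (fun t => Re (Lc t))
    (fun t => Re (dLc t)) (m / 2) BL L0) => // [|t t1|t t1|t t1|t t1].
  - by rewrite divr_gt0.
  - by have [] := hL t (pos t t1).
  - exact: sq_ge0.
  - apply: le_trans (dLo t (pos t t1)); rewrite ler_wpM2l //.
    by rewrite divr_ge0 // ltW.
  - exact: LB (pos' t t1).
have /choice[q hq] := diag.
exists (\row_i q i) => i j; rewrite cdiagE; case: eqP => [<-|/eqP ij].
  split; first by rewrite mxE cRe_real.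
  rewrite cIm_real; apply: cvg_near_cst; near=> t.
  have t0 : 0 <= t by near: t; apply: nbhs_pinfty_ge; apply: num_real.
  by have := congr1 Im (herm_entry i i (hx t t0)); rewrite cImJ; lra.
have small (g : R -> R) : (forall t, g t ^+ 2 <= sq (x t i j)) -> g t @[t --> +oo] --> 0.
  move=> hg; apply/cvgr0Pnorm_le => e e0.
  have e20 : 0 < e ^+ 2 by rewrite exprn_gt0.
  have := offd i j ij; move/cvgr0Pnorm_le => /(_ _ e20); apply: filterS => t.
  rewrite ger0_norm ?sq_ge0 // => h.
  rewrite -(@ler_pXn2r _ 2) ?nnegrE ?(ltW e0) // real_normK ?num_real //.
  exact: le_trans (hg t) h.
by split; apply: small => t; rewrite /sq; [rewrite lerDl|rewrite lerDr]; apply: sqr_ge0.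
Unshelve. all: by end_near. Qed.

End convergence.

(** * The possible limits *)

Section limit_points.
Variables (R : realType) (n : nat).
Local Notation C := R[i].
Local Notation Re := (@complex.Re R).

Lemma horner_char_poly (A : 'M[C]_n) (s : C) : (char_poly A).[s] = \det (s%:M - A).
Proof.
rewrite /char_poly -horner_evalE -det_map_mx; congr (\det _).
apply/matrixP => i j; rewrite !mxE /= horner_evalE hornerD hornerN hornerC.
by rewrite -mulr_natr hornerM hornerX -polyC_natr hornerC mulr_natr.
Qed.

Lemma det_cdiag (v : 'rV[R]_n) (s : C) :
  \det (s%:M - cdiag v : 'M[C]_n) = \prod_k (s - (v 0 k)%:C).
Proof.
have -> : s%:M - cdiag v = diag_mx (\row_k (s - (v 0 k)%:C)) :> 'M[C]_n.
  apply/matrixP => i j; rewrite !mxE; case: eqP => [->|_]; rewrite ?mulr1n ?mulr0n //.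
  by rewrite subr0.
by rewrite det_diag; apply: eq_bigr => k _; rewrite mxE.
Qed.

Variable r : 'rV[R]_n.
Hypothesis rinj : injective (r 0).

Definition permuted (s : 'S_n) : 'rV[R]_n := \row_k r 0 (s k).

(** Each r_j is a root of the characteristic polynomial of [x t] at all times t >= 0, hence of that
    of the limit, so it occurs among the p_k. Distinct r_j occur at distinct places, and an
    injection of a finite set into itself is a permutation. *)
Lemma isospectral_limit (x : R -> 'M[C]_n) (p : 'rV[R]_n) :
  (forall t, 0 <= t -> isospectral (cdiag r) (x t)) -> mcvg +oo x (cdiag p) ->
  exists s : 'S_n, p = permuted s.
Proof.
move=> ix xp.
have hk j : exists k, p 0 k = r 0 j.
  have c1 : ccvg +oo (fun t => \det ((r 0 j)%:C%:M - x t)) (\det ((r 0 j)%:C%:M - cdiag p)).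
    by apply: mcvg_det; apply: mcvgB => //; apply: mcvg_cst.
  have c2 : ccvg +oo (fun t => \det ((r 0 j)%:C%:M - x t)) 0.
    have E : \forall t \near +oo, \det ((r 0 j)%:C%:M - x t) = 0.
      near=> t; have t0 : 0 <= t by near: t; apply: nbhs_pinfty_ge; apply: num_real.
      have [_ e] := ix t t0; rewrite -horner_char_poly e horner_char_poly det_cdiag.
      by rewrite (bigD1 j) //= subrr mul0r.
    by split; apply: cvg_near_cst; apply: filterS E => t ->.
  have := ccvg_unique _ c1 c2; rewrite det_cdiag => h0.
  have /prodf_eq0[k _ /eqP h] : \prod_k ((r 0 j)%:C - (p 0 k)%:C) == 0 :> C by rewrite h0.
  exists k; apply/esym/eqP; rewrite -subr_eq0; apply/eqP.
  by have := congr1 Re h; rewrite cReB.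
have /choice[g hg] := hk.
have ginj : injective g by move=> i j e; apply: rinj; rewrite -!hg e.
exists (perm ginj)^-1%g; apply/rowP => k; rewrite mxE -hg.
by rewrite -[in LHS](permKV (perm ginj) k) permE.
Unshelve. all: by end_near. Qed.

Lemma permuted_inj s : injective (permuted s 0).
Proof. by move=> i j; rewrite !mxE => /rinj/perm_inj. Qed.

(* A permutation preserving the order of the [r 0 k] is trivial: compare the ranks. *)
Lemma permuted_inversion s : s != 1%g -> exists k l : 'I_n,
  [/\ (k < l)%N & (r 0 k - r 0 l) * (permuted s 0 k - permuted s 0 l) < 0].
Proof.
move=> s1; apply: contrapT => no.
have mono k l : r 0 l < r 0 k -> r 0 (s l) < r 0 (s k).
  move=> lk; have kl : k != l by apply: contraTneq lk => ->; rewrite ltxx.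
  have skl : r 0 (s l) != r 0 (s k) by rewrite (inj_eq rinj) (inj_eq perm_inj) eq_sym.
  rewrite lt_neqAle skl leNgt; apply/negP => h; apply: no.
  have neg : (r 0 k - r 0 l) * (r 0 (s k) - r 0 (s l)) < 0.
    by rewrite pmulr_rlt0 ?subr_gt0 // subr_lt0.
  have [lt|lt|e] := ltngtP k l.
  - by exists k, l; rewrite !mxE.
  - by exists l, k; rewrite !mxE; split => //; rewrite -mulrNN !opprB.
  - by rewrite (ord_inj e) eqxx in kl.
pose N k := #|[set l | r 0 l < r 0 k]%SET|.
have NE k : #|[set l | r 0 (s l) < r 0 (s k)]%SET| = N (s k).
  rewrite /N; have <- : s @: [set l | r 0 (s l) < r 0 (s k)]%SET = [set l | r 0 l < r 0 (s k)]%SET.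
    apply/setP => l; rewrite inE; apply/imsetP/idP => [[m]|h]; first by rewrite inE => h ->.
    by exists ((s^-1)%g l); rewrite ?inE permKV.
  by rewrite card_imset //; apply: perm_inj.
have Nle k : (N k <= N (s k))%N.
  by rewrite -NE; apply: subset_leq_card; apply/fintype.subsetP => l; rewrite !inE; apply: mono.
have rle k : r 0 k <= r 0 (s k).
  rewrite leNgt; apply/negP => h; have := Nle k; rewrite leqNgt => /negP; apply.
  apply: proper_card; apply/fintype.properP; split.
    by apply/fintype.subsetP => l; rewrite !inE => /lt_trans; apply.
  by exists (s k); rewrite !inE ?h ?ltxx.
(* The families r_k and r_(s k) have the same sum, so the inequalities [rle] are equalities. *)
have sumE : \sum_k (r 0 (s k) - r 0 k) = 0.
  by rewrite sumrB [X in _ - X](reindex_inj (@perm_inj _ s)) subrr.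
move/negP: s1; apply; apply/eqP/permP => k; rewrite perm1; apply: rinj.
apply/eqP; rewrite -subr_eq0; apply/eqP.
by apply: (psumr_eq0P _ sumE) => // i _; rewrite subr_ge0.
Qed.

End limit_points.

(** * Solutions trapped near a saddle *)

Section near_diagonal.
Variables (R : realType) (n : nat).
Local Notation C := R[i].

Lemma horner_mx_lipschitz (q : {poly C}) (B : R) : exists2 c : R, 0 <= c &
  forall x : 'M[C]_n.+1, mnorm x <= B -> mnorm (horner_mx x q) <= c /\
  forall y, mnorm y <= B -> mnorm (horner_mx x q - horner_mx y q) <= c * mnorm (x - y).
Proof.
elim/poly_ind: q => [|q z [c c0 hc]].
  exists 0 => // x _; split; first by rewrite rmorph0 mnorm0.
  by move=> y _; rewrite !rmorph0 subrr mnorm0 mul0r.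
have z0 := mnorm_ge0 (z%:M : 'M[C]_n.+1).
exists (c * `|B| + c + mnorm (z%:M : 'M[C]_n.+1)).
  by rewrite !addr_ge0 // mulr_ge0.
move=> x xB; have [qx qxy] := hc x xB.
have B0 : B <= `|B| := ler_norm B.
have nB0 := normr_ge0 B.
have hE (y : 'M[C]_n.+1) : horner_mx y (q * 'X + z%:P) = horner_mx y q *m y + z%:M.
  by rewrite rmorphD rmorphM /= horner_mx_X horner_mx_C.
have xB' := le_trans xB B0.
split.
  rewrite hE; apply: (le_trans (mnormD _ _)); rewrite lerD2r.
  apply: (le_trans (mnormM _ _)).
  have := ler_pM (mnorm_ge0 _) (mnorm_ge0 _) qx xB'; lra.
move=> y yB; rewrite !hE opprD addrACA subrr addr0.
have [qy _] := hc y yB; have xy := qxy y yB.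
have -> : horner_mx x q *m x - horner_mx y q *m y =
    (horner_mx x q - horner_mx y q) *m x + horner_mx y q *m (x - y).
  by rewrite mulmxBl mulmxBr addrA subrK.
apply: (le_trans (mnormD _ _)).
have h1 := le_trans (mnormM (horner_mx x q - horner_mx y q) x)
  (ler_pM (mnorm_ge0 _) (mnorm_ge0 _) xy xB').
have h2 := le_trans (mnormM (horner_mx y q) (x - y))
  (ler_wpM2r (mnorm_ge0 _) qy).
have h3 : 0 <= mnorm (z%:M : 'M[C]_n.+1) * mnorm (x - y) by rewrite mulr_ge0 ?mnorm_ge0.
lra.
Qed.

End near_diagonal.

Section near_critical_point.
Variables (R : realType) (n : nat).
Local Notation C := R[i].
Local Notation Re := (@complex.Re R).
Variable r : 'rV[R]_n.
Hypothesis rinj : injective (r 0).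

(* Linearization of the Cayley-Hamilton identity [(x - s_k) q(x) = 0] at the diagonal
   matrix [cdiag s], [q] being the product of the other factors: the [(k, k)] entry of
   the difference of two solutions is [q(s_k) (x - y)_kk] up to second order terms. *)
Lemma isospectral_diag_small (s : 'S_n) (k : 'I_n) : exists2 c : R, 0 <= c &
  forall (d : R) x y, d <= 1 -> isospectral (cdiag r) x -> isospectral (cdiag r) y ->
    mnorm (x - cdiag (permuted r s)) <= d -> mnorm (y - cdiag (permuted r s)) <= d ->
    nm ((x - y) k k) <= c * d * mnorm (x - y).
Proof.
case: n r rinj s k => [|m] r' rinj' s k; first by case: k.
set p := permuted r' s; set P : 'M[C]_m.+1 := cdiag p.
pose z := (p 0 k)%:C.
pose q : {poly C} := \prod_(j | j != s k) ('X - ((r' 0 j)%:C)%:P).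
have chE x : isospectral (cdiag r') x -> horner_mx x q *m (x - z%:M) = 0.
  move=> [_ e]; have := Cayley_Hamilton x; rewrite e.
  have -> : char_poly (cdiag r' : 'M[C]_m.+1) = q * ('X - z%:P).
    rewrite char_poly_trig ?diag_mx_is_trig // (bigD1 (s k)) //= mulrC.
    rewrite cdiagE eqxx /z /p mxE; congr (_ * _).
    by apply: eq_bigr => j _; rewrite cdiagE eqxx.
  by rewrite rmorphM rmorphB /= horner_mx_X horner_mx_C.
have qz : q.[z] != 0.
  rewrite /q horner_prod; apply/prodf_neq0 => j jk; rewrite hornerXsubC /z /p mxE.
  apply/eqP => /(congr1 Re) /= /eqP; rewrite subr_eq0 (inj_eq rinj') => /eqP h.
  by rewrite h eqxx in jk.
have [c c0 hc] := horner_mx_lipschitz m q (mnorm P + 1).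
exists (nm (q.[z])^-1 * (2 * c)); first by rewrite !mulr_ge0 ?nm_ge0.
move=> d x y d1 ix iy xd yd.
have nearB u : mnorm (u - P) <= d -> mnorm u <= mnorm P + 1.
  move=> h; rewrite -[u](subrK P); apply: (le_trans (mnormD _ _)); lra.
have xB := nearB x xd; have yB := nearB y yd.
have PB : mnorm P <= mnorm P + 1 by rewrite lerDl.
have [_ hx] := hc x xB; have hxy := hx y yB; have hxP := hx P PB.
pose w := x - y.
pose D := horner_mx x q - horner_mx y q.
(* The difference of the two Cayley-Hamilton identities, for [x] and for [y]. *)
have E : D *m (x - z%:M) + horner_mx y q *m w = 0.
  have -> : w = (x - z%:M) - (y - z%:M) by rewrite opprB addrA subrK.
  have cx : horner_mx x q *m (x - z%:M) = 0 := chE x ix.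
  have cy : horner_mx y q *m (y - z%:M) = 0 := chE y iy.
  by rewrite /D mulmxBl cx sub0r [X in _ + X]mulmxBr cy subr0 addNr.
(* Column k of [P - z%:M] is zero: this removes the first order contribution of [D] to the (k, k)
   entry. *)
have Dkk : (D *m (P - z%:M)) k k = 0.
  have Pz j : (P - z%:M) j k = 0.
    by rewrite /P /z !mxE; case: eqP => [->|_]; rewrite ?mulr0n ?mulr1n subrr.
  by rewrite mxE big1 // => j _; rewrite Pz mulr0.
have qw : (horner_mx P q *m w) k k = q.[z] * w k k.
  rewrite horner_mx_diag mul_diag_mx mxE; congr (_ * _).
  by rewrite /z /p !mxE.
have addE (A A' : 'M[C]_m.+1) : (A + A') k k = A k k + A' k k by rewrite mxE.
have e1 : (D *m (x - z%:M)) k k = (D *m (x - P)) k k.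
  have -> : x - z%:M = (P - z%:M) + (x - P) by rewrite [RHS]addrC addrA subrK.
  by rewrite mulmxDr addE Dkk add0r.
have e2 : (horner_mx y q *m w) k k =
    (horner_mx P q *m w) k k + ((horner_mx y q - horner_mx P q) *m w) k k.
  by rewrite -addE -mulmxDl addrC subrK.
have e : q.[z] * w k k =
    - ((D *m (x - P)) k k + ((horner_mx y q - horner_mx P q) *m w) k k).
  have zkk : (0 : 'M[C]_m.+1) k k = 0 by rewrite mxE.
  have := congr1 (fun A : 'M[C]_m.+1 => A k k) E; rewrite addE e1 e2 qw zkk => h.
  by apply/eqP; rewrite -addr_eq0 addrCA h.
have d0 : 0 <= d := le_trans (mnorm_ge0 _) xd.
have w0 : 0 <= mnorm w := mnorm_ge0 _.
have hyP : mnorm (horner_mx y q - horner_mx P q) <= c * d.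
  have [_ /(_ P PB) h] := hc y yB.
  by apply: (le_trans h); rewrite ler_wpM2l.
have bound : nm (q.[z] * w k k) <= 2 * c * d * mnorm w.
  rewrite e nmN; apply: (le_trans (nmD _ _)).
  have h1 : nm ((D *m (x - P)) k k) <= c * mnorm w * d.
    apply: (le_trans (nm_le_mnorm _ _ _)); apply: (le_trans (mnormM _ _)).
    by rewrite ler_pM ?mnorm_ge0.
  have h2 : nm (((horner_mx y q - horner_mx P q) *m w) k k) <= c * d * mnorm w.
    apply: (le_trans (nm_le_mnorm _ _ _)); apply: (le_trans (mnormM _ _)).
    by rewrite ler_wpM2r.
  by lra.
have -> : nm (w k k) = nm ((q.[z])^-1 * (q.[z] * w k k)) by rewrite mulKf.
apply: (le_trans (nmM _ _)).
have -> : nm (q.[z])^-1 * (2 * c) * d * mnorm w = nm (q.[z])^-1 * (2 * c * d * mnorm w) by ring.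
by rewrite ler_wpM2l ?nm_ge0.
Qed.

End near_critical_point.

(** * Differences of two trajectories *)

Section trajectory_differences.
Variables (R : realType) (n : nat).
Local Notation C := R[i].
Local Notation Re := (@complex.Re R).
Local Notation I := ('I_n * 'I_n)%type.
Variables (a r : 'rV[R]_n) (b : 'M[C]_n).

Local Notation rhod := (cdiag r : 'M[C]_n).
Local Notation f := (feedback b rhod).

Lemma mder_difference x y (t : R) : trajectory a r b x -> trajectory a r b y -> 0 < t ->
  mder (fun s => x s - y s) t (rot a (x t - y t) +
    (f (x t - y t) *: drive b (x t) + f (y t) *: drive b (x t - y t))).
Proof.
move=> [_ dx] [_ dy] t0.
rewrite [X in mder _ _ X](_ : _ = (rot a (x t) + f (x t) *: drive b (x t)) -
   (rot a (y t) + f (y t) *: drive b (y t))); first exact: mderB (dx t t0) (dy t t0).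
rewrite rotB feedbackB driveB scalerBl scalerBr opprD [RHS]addrACA; apply: (congr1 (fun A => _ + A)).
by rewrite addrA subrK.
Qed.

Definition Nm (i j : I) : C := if i == j then 1 else 0.

Lemma hform_Nm w : hform Nm w = (\sum_(i : I) sq (w i.1 i.2))%:C.
Proof.
rewrite /hform rmorph_sum; apply: eq_bigr => i _; rewrite (bigD1 i) //= big1 ?addr0.
  by rewrite /Nm eqxx mul1r sqE.
by move=> j; rewrite /Nm eq_sym => /negbTE ->; rewrite mul0r.
Qed.

(* Gronwall's inequality, backwards in time. *)
Lemma trajectory_backward_lipschitz (T : R) : 0 < T -> exists2 c : R, 0 <= c &
  forall x y, trajectory a r b x -> trajectory a r b y ->
    mcvg 0^'+ x (x 0) -> mcvg 0^'+ y (y 0) ->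
    mnorm (x 0 - y 0) <= c * mnorm (x T - y T).
Proof.
move=> T0.
pose B : R := n%:R * n%:R * 2.
have B0 : 0 <= B by rewrite !mulr_ge0.
pose kf := 2 * mnorm b * mnorm rhod; pose kd := 2 * mnorm b.
have kf0 : 0 <= kf by rewrite !mulr_ge0 ?mnorm_ge0.
have kd0 : 0 <= kd by rewrite !mulr_ge0 ?mnorm_ge0.
pose ka := 2 * mnorm (cdiag a : 'M[C]_n).
pose kw := ka + 2 * (kf * (kd * B)).
pose N : R := 2 * (n * n)%:R.
have N0 : 0 <= N by rewrite mulr_ge0.
pose c := 2 * hnorm Nm * kw * N.
have kw0 : 0 <= kw by rewrite addr_ge0 ?mulr_ge0 ?mnorm_ge0.
have c0 : 0 <= c by rewrite !mulr_ge0 ?hnorm_ge0.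
exists (Num.sqrt (N * expR (c * T))); first exact: sqrtr_ge0.
move=> x y tx ty x0 y0.
pose w t := x t - y t.
pose z t := rot a (w t) + (f (w t) *: drive b (x t) + f (y t) *: drive b (w t)).
have xB (t : R) : 0 <= t -> mnorm (x t) <= B by move=> /tx.1; apply: isospectral_bounded.
have yB (t : R) : 0 <= t -> mnorm (y t) <= B by move=> /ty.1; apply: isospectral_bounded.
have zB (t : R) : 0 <= t -> mnorm (z t) <= kw * mnorm (w t).
  move=> t0; have w0 : 0 <= mnorm (w t) := mnorm_ge0 _.
  have h1 : mnorm (rot a (w t)) <= ka * mnorm (w t).
    rewrite rotE; apply: (le_trans (mnormZ _ _)); rewrite nmN nm_i mul1r.
    exact: mnorm_commutator.
  have h2 : mnorm (f (w t) *: drive b (x t)) <= kf * mnorm (w t) * (kd * B).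
    apply: (le_trans (mnormZ _ _)); rewrite ler_pM ?nm_ge0 ?mnorm_ge0 ?nm_feedback //.
    by apply: (le_trans (mnorm_drive _ _)); rewrite ler_wpM2l ?xB.
  have h3 : mnorm (f (y t) *: drive b (w t)) <= kf * B * (kd * mnorm (w t)).
    apply: (le_trans (mnormZ _ _)); rewrite ler_pM ?nm_ge0 ?mnorm_ge0 ?mnorm_drive //.
    by apply: (le_trans (nm_feedback _ _ _)); rewrite ler_wpM2l ?yB.
  have h4 := mnormD (f (w t) *: drive b (x t)) (f (y t) *: drive b (w t)).
  have -> : kw * mnorm (w t) = ka * mnorm (w t) +
      (kf * mnorm (w t) * (kd * B) + kf * B * (kd * mnorm (w t))).
    have distr (p q u v s : R) : (p + 2 * (q * (u * v))) * s = p * s + (q * s * (u * v) + q * v * (u * s)).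
      by ring.
    exact: distr.
  by apply: (le_trans (mnormD _ _)); apply: lerD => //; apply: (le_trans h4); apply: lerD.
(* The squared Frobenius norm stands in for [mnorm], which is not differentiable; the factor [N]
   converts between them. *)
pose S t := \sum_(i : I) sq (w t i.1 i.2).
have dS (t : R) : 0 < t -> is_derive t 1 S (Re (hpol Nm (w t) (z t))).
  move=> t0; have [h _] := cder_hform Nm (mder_difference tx ty t0).
  by move: h; under eq_fun do rewrite hform_Nm cRe_real.
have wS (t : R) : mnorm (w t) ^+ 2 <= N * S t := mnorm_sqr_le _.
have S0 (t : R) : 0 <= S t by apply: sumr_ge0 => i _; apply: sq_ge0.
have dSB (t : R) : 0 < t -> 0 <= c * S t + Re (hpol Nm (w t) (z t)).
  move=> /ltW t0; have h : `|Re (hpol Nm (w t) (z t))| <= c * S t.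
    apply: (le_trans (Re_le_nm _)); apply: (le_trans (nm_hpol _ _ _)).
    apply: (@le_trans _ _ (2 * hnorm Nm * kw * mnorm (w t) ^+ 2)).
      have -> : 2 * hnorm Nm * kw * mnorm (w t) ^+ 2 =
         2 * hnorm Nm * mnorm (w t) * (kw * mnorm (w t)) by ring.
      by rewrite ler_wpM2l ?zB // !mulr_ge0 ?hnorm_ge0 ?mnorm_ge0.
    rewrite /c -[leRHS]mulrA ler_wpM2l // !mulr_ge0 ?hnorm_ge0 //.
  by have /ler_normlP[] := h; lra.
have dexp (t : R) : is_derive t 1 (fun s => expR (c * s)) (c * expR (c * t)).
  have h := @is_derive1_comp _ expR (fun s => c * s) t _ _ (is_derive_expR _)
    (is_deriveZ c (is_derive_id t 1)).
  by apply: (is_derive_eq h); rewrite /GRing.scale /= mulr1 mulrC.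
have mono (t : R) : 0 < t <= T -> expR (c * t) * S t <= expR (c * T) * S T.
  move=> /andP[t0 tT].
  pose F s := expR (c * s) * S s.
  pose dF s := expR (c * s) * (c * S s + Re (hpol Nm (w s) (z s))).
  suff : F t <= F T by [].
  apply: (derive_ge0_le (df := dF) tT) => s /andP[ts _]; last first.
    by rewrite /dF mulr_ge0 ?expR_ge0 // dSB // (lt_le_trans t0).
  have s0 : 0 < s := lt_le_trans t0 ts.
  have h := is_deriveM (dexp s) (dS s s0).
  by apply: (is_derive_eq h); rewrite /dF /GRing.scale /=; ring.
have St (t : R) : 0 < t <= T -> S t <= expR (c * T) * S T.
  move=> tT; apply: le_trans (mono t tT); rewrite ler_peMl //.
  apply: le_trans (expR_ge1Dx _); rewrite lerDl mulr_ge0 //.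
  by case/andP: tT => /ltW.
(* The differential inequality holds at positive times; the initial time is reached by continuity
   from the right. *)
have Scvg : S t @[t --> 0^'+] --> S 0.
  have wc : mcvg 0^'+ w (w 0) by apply: mcvgB.
  have hS : ccvg 0^'+ (fun t => hform Nm (w t)) (hform Nm (w 0)).
    apply: ccvg_sum => i _; apply: ccvg_sum => j _; apply: ccvgM; first exact: ccvg_cst.
    by apply: ccvgM; [apply: wc|apply: ccvgJ; apply: wc].
  by have [h _] := hS; move: h; under eq_fun do rewrite hform_Nm cRe_real; rewrite hform_Nm cRe_real.
have hS0 : S 0 <= expR (c * T) * S T.
  apply: (cvgr_to_le Scvg); near=> t; apply: St; apply/andP; split.
    by near: t; apply: nbhs_right_gt.
  by near: t; apply: nbhs_right_le.
rewrite -(@ler_pXn2r _ 2) ?nnegrE ?mnorm_ge0 ?mulr_ge0 ?sqrtr_ge0 ?mnorm_ge0 //.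
rewrite exprMn sqr_sqrtr; last by rewrite mulr_ge0 ?expR_ge0.
apply: (le_trans (wS 0)); rewrite -[leRHS]mulrA ler_wpM2l //; apply: (le_trans hS0).
by rewrite ler_wpM2l ?expR_ge0 //; apply: sum_sq_le.
Unshelve. all: by end_near. Qed.

End trajectory_differences.

(** * Real coordinates and the cone where a form is nonpositive *)

Section saddle_cone.
Variables (R : realType) (n : nat).
Local Notation C := R[i].
Local Notation Re := (@complex.Re R).
Local Notation Im := (@complex.Im R).
Local Notation I := ('I_n * 'I_n)%type.
Variables (a r : 'rV[R]_n) (b : 'M[C]_n).
Hypothesis hfreq : forall i j : I, i.1 != i.2 -> j.1 != j.2 -> omega a i = omega a j -> i = j.
Hypothesis hb : b \is hermsymmx.
Hypothesis b0 : forall i : I, i.1 != i.2 -> b i.1 i.2 != 0.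
Hypothesis rinj : injective (r 0).

(* Real coordinates of the off-diagonal part of a Hermitian matrix. *)
Definition coord (i : I) (w : 'M[C]_n) : R :=
  if (i.1 < i.2)%N then Re (w i.1 i.2) else Im (w i.1 i.2).

Lemma nm_coord w (i : I) (e : R) : w \is hermsymmx -> i.1 != i.2 ->
  `|coord i w| <= e -> `|coord (i.2, i.1) w| <= e -> nm (w i.1 i.2) <= 2 * e.
Proof.
move=> hw i0; have sw : w i.2 i.1 = Num.conj (w i.1 i.2) by rewrite herm_entry.
rewrite /coord /nm /= sw cReJ cImJ; case: ltngtP => [_|_|e'].
- by rewrite normrN => h1 h2; lra.
- by move=> h1 h2; lra.
by case/eqP: i0; apply: ord_inj.
Qed.

(** Write the off-diagonal part as s E + u, where s is the coordinate [i0] and u is controlled by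
    the other coordinates. As the form is positive on E, it can be nonpositive at s E + u only if
    |s| is O(e). *)
Lemma hform_cone M (i0 : I) : (i0.1 < i0.2)%N -> off_supported M ->
  0 < Re (hform M (delta_mx i0.1 i0.2 + delta_mx i0.2 i0.1)) ->
  exists2 c : R, 0 <= c & forall w (e : R), w \is hermsymmx -> 0 <= e ->
    Re (hform M w) <= 0 ->
    (forall i, i.1 != i.2 -> i != i0 -> `|coord i w| <= e) -> mnorm (off w) <= c * e.
Proof.
move=> lt0 hM; set E := delta_mx i0.1 i0.2 + delta_mx i0.2 i0.1; set q := Re (hform M E) => q0.
have ne0 : i0.1 != i0.2 by apply: contraTneq lt0 => ->; rewrite ltnn.
pose N : R := n%:R * n%:R * 2; have N0 : 0 <= N by rewrite !mulr_ge0.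
pose k1 := 2 * hnorm M * mnorm E * N; pose k2 := hnorm M * N ^+ 2.
have k10 : 0 <= k1 by rewrite !mulr_ge0 ?hnorm_ge0 ?mnorm_ge0.
have k20 : 0 <= k2 by rewrite mulr_ge0 ?hnorm_ge0 ?sqr_ge0.
(* If |s| > k3 e, then e < |s|, hence e^2 <= |s| e, and the inequality [key] yields |s| q <= (k1 +
   k2) e, a contradiction. *)
pose k3 := (k1 + k2) / q + 1.
have k31 : 1 <= k3 by rewrite lerDr divr_ge0 ?addr_ge0 // ltW.
exists (k3 * mnorm E + N).
  by rewrite addr_ge0 // mulr_ge0 ?mnorm_ge0 // (le_trans ler01).
move=> w e hw e0 hneg hc.
pose s := coord i0 w; pose u := off w - s%:C *: E.
have sE : s = Re (w i0.1 i0.2) by rewrite /s /coord lt0.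
have uB : mnorm u <= N * e.
  have -> : N * e = n%:R * n%:R * (2 * e) by rewrite /N; ring.
  apply: mnorm_le => k l; rewrite /u !mxE.
  have [kl|kl] := eqVneq k l.
    have -> : (k == i0.1) && (l == i0.2) = false.
      by apply/negbTE/negP => /andP[/eqP k1' /eqP l1']; case/eqP: ne0; rewrite -k1' -l1' kl.
    have -> : (k == i0.2) && (l == i0.1) = false.
      by apply/negbTE/negP => /andP[/eqP k1' /eqP l1']; case/eqP: ne0; rewrite -k1' -l1' kl.
    by rewrite addr0 mulr0 subr0 nm0 mulr_ge0.
  have [/andP[/eqP k1' /eqP l1']|n1] := boolP ((k == i0.1) && (l == i0.2)).
    have -> : (k == i0.2) && (l == i0.1) = false by rewrite k1' (negbTE ne0).
    rewrite addr0 mulr1 k1' l1' /nm cReB cImB cRe_real cIm_real -sE subrr normr0 add0r subr0.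
    have := hc (i0.2, i0.1); rewrite /coord /= eq_sym ne0 ltnNge (ltnW lt0) /= => /(_ isT).
    have -> : (i0.2, i0.1) != i0 by apply: contra ne0 => /eqP/(congr1 snd) /= ->.
    move=> /(_ isT); rewrite -(herm_entry i0.1 i0.2 hw) cImJ normrN; lra.
  have [/andP[/eqP k2' /eqP l2']|n2] := boolP ((k == i0.2) && (l == i0.1)).
    rewrite add0r mulr1 k2' l2' /nm cReB cImB cRe_real cIm_real.
    have -> : Re (w i0.2 i0.1) = s by rewrite sE -(herm_entry i0.1 i0.2 hw) cReJ.
    rewrite subrr normr0 add0r subr0.
    have := hc (i0.2, i0.1); rewrite /coord /= eq_sym ne0 ltnNge (ltnW lt0) /= => /(_ isT).
    have -> : (i0.2, i0.1) != i0 by apply: contra ne0 => /eqP/(congr1 snd) /= ->.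
    by move=> /(_ isT); lra.
  rewrite addr0 mulr0 subr0; apply: (@nm_coord w (k, l)) => //; apply: hc => //=.
  - by rewrite eq_sym.
  - by rewrite andbC in n2.
have wE : off w = s%:C *: E + u by rewrite /u addrC subrK.
have key : s ^+ 2 * q <= k1 * `|s| * e + k2 * e ^+ 2.
  have := hneg; rewrite -(hform_off _ hM) wE hformD hformZ hpolZl !cReD cReM.
  rewrite cRe_real cIm_real mul0r subr0 -/q => h.
  have h1 : `|Re (s%:C * hpol M E u)| <= k1 * `|s| * e.
    apply: (le_trans (Re_le_nm _)); apply: (le_trans (nmM _ _)); rewrite nm_real.
    have -> : k1 * `|s| * e = `|s| * (2 * hnorm M * mnorm E * (N * e)) by rewrite /k1; ring.
    rewrite ler_wpM2l //; apply: (le_trans (nm_hpol _ _ _)); rewrite ler_wpM2l //.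
    by rewrite !mulr_ge0 ?hnorm_ge0 ?mnorm_ge0.
  have h2 : `|Re (hform M u)| <= k2 * e ^+ 2.
    apply: (le_trans (Re_le_nm _)); apply: (le_trans (nm_hform _ _)).
    have -> : k2 * e ^+ 2 = hnorm M * (N * e) ^+ 2 by rewrite /k2; ring.
    rewrite ler_wpM2l ?hnorm_ge0 //; apply: lerXn2r; rewrite ?nnegrE ?mnorm_ge0 //.
    by rewrite mulr_ge0.
  by move: h h1 h2; rewrite !ler_norml => h /andP[h1 _] /andP[h2 _]; lra.
have sB : `|s| <= k3 * e.
  rewrite leNgt; apply/negP => h.
  have es : e < `|s| by apply: le_lt_trans h; rewrite ler_peMl.
  have sp : 0 < `|s| := le_lt_trans e0 es.
  have : `|s| * (`|s| * q) <= `|s| * ((k1 + k2) * e).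
    have -> : `|s| * (`|s| * q) = s ^+ 2 * q by rewrite mulrA -expr2 real_normK ?num_real.
    apply: (le_trans key).
    have -> : `|s| * ((k1 + k2) * e) = k1 * `|s| * e + k2 * (`|s| * e) by ring.
    by rewrite lerD2l ler_wpM2l // expr2 ler_wpM2r // ltW.
  rewrite ler_pM2l // -ler_pdivlMr // => h'.
  have : k3 * e = (k1 + k2) * e / q + e by rewrite /k3; ring.
  by lra.
rewrite wE; apply: (le_trans (mnormD _ _)); rewrite mulrDl; apply: lerD => //.
apply: (le_trans (mnormZ _ _)); rewrite nm_real mulrAC ler_wpM2r ?mnorm_ge0 //.
Qed.

End saddle_cone.

(** * States trapped near a saddle *)

Section saddles.
Variables (R : realType) (n : nat).
Local Notation C := R[i].
Local Notation Re := (@complex.Re R).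
Local Notation I := ('I_n * 'I_n)%type.
Variables (a r : 'rV[R]_n) (b : 'M[C]_n).
Hypothesis hfreq : forall i j : I, i.1 != i.2 -> j.1 != j.2 -> omega a i = omega a j -> i = j.
Hypothesis hb : b \is hermsymmx.
Hypothesis b0 : forall i : I, i.1 != i.2 -> b i.1 i.2 != 0.
Hypothesis rinj : injective (r 0).

Local Notation rhod := (cdiag r : 'M[C]_n).
Local Notation f := (feedback b rhod).
Local Notation K := (Rm a r b).

(** The growth estimate in real numbers. For a difference [w] of trajectories, [o] is the
    off-diagonal norm, [p] the feedback, [nE] the norm of the second order remainder, [q1] and [r1]
    the errors that it and the control cause in the derivatives of Q and K. AM-GM provides (m / 2)
    o^2, half of which pays for the remainder when [d] is small. *)
Lemma saddle_arith (A m o p hQ hR k2 c1 d nE q1 r1 ds nz : R) :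
  0 < m -> 0 <= A -> 0 <= o -> 0 <= hQ -> 0 <= hR ->
  nE <= c1 * d * (2 * o) -> `|q1| <= hQ * o * nE -> `|r1| <= hR * o * nz ->
  nz <= `|p| * k2 + nE -> m * o ^+ 2 <= ds -> 1 + (hR * k2) ^+ 2 / (2 * m) <= A ->
  d * (2 * ((A * hQ + hR) * c1)) <= m / 4 ->
  m / 4 * o ^+ 2 <= A * (2 * p ^+ 2 + q1) - (p ^+ 2 - ds + r1).
Proof.
move=> m0 A0 o0 hQ0 hR0 hE hq hr hz hds hA hd.
have am := energy_amgm o `|p| m0 hA; rewrite real_normK ?num_real // in am.
have q2 : - (A * (hQ * o * nE)) <= A * q1.
  by rewrite -mulrN ler_wpM2l //; move: hq; rewrite ler_norml => /andP[].
have r2 : r1 <= hR * o * (`|p| * k2) + hR * o * nE.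
  rewrite -mulrDr; apply: (le_trans (ler_norm _)); apply: (le_trans hr).
  by rewrite ler_wpM2l ?mulr_ge0.
have e2 : (A * hQ + hR) * o * nE <= m / 4 * o ^+ 2.
  apply: (@le_trans _ _ ((A * hQ + hR) * o * (c1 * d * (2 * o)))).
    by rewrite ler_wpM2l // mulr_ge0 // addr_ge0 // mulr_ge0.
  have -> : (A * hQ + hR) * o * (c1 * d * (2 * o)) =
      d * (2 * ((A * hQ + hR) * c1)) * o ^+ 2 by ring.
  by rewrite ler_wpM2r ?sqr_ge0.
have p0 : 0 <= A * p ^+ 2 by rewrite mulr_ge0 ?sqr_ge0.
have -> : A * (2 * p ^+ 2 + q1) = A * p ^+ 2 + A * p ^+ 2 + A * q1 by ring.
have am' : m / 2 * o ^+ 2 <= A * p ^+ 2 - p ^+ 2 + m * o ^+ 2 - hR * o * (`|p| * k2).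
  by apply: (le_trans am); rewrite le_eqVlt; apply/orP; left; apply/eqP; ring.
have e2' : A * (hQ * o * nE) + hR * o * nE <= m / 4 * o ^+ 2.
  by apply: le_trans e2; rewrite le_eqVlt; apply/orP; left; apply/eqP; ring.
have mh : m / 2 * o ^+ 2 = m / 4 * o ^+ 2 + m / 4 * o ^+ 2 by field.
lra.
Qed.

(* The difference of two trajectories trapped near the saddle cannot enter the cone where
   the form is positive, since the form grows there: the trapped set is a graph over the
   remaining coordinates. *)
Lemma saddle_cone (s : 'S_n) : s != 1%g -> exists2 d : R, 0 < d &
  exists2 i0 : I, i0.1 != i0.2 & exists2 c : R, 0 <= c &
  forall x y (T : R), 0 < T -> trajectory a r b x -> trajectory a r b y ->
    (forall t, T <= t -> mnorm (x t - cdiag (permuted r s)) <= d) ->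
    (forall t, T <= t -> mnorm (y t - cdiag (permuted r s)) <= d) ->
    forall e : R, 0 <= e ->
    (forall i, i.1 != i.2 -> i != i0 -> `|coord i (x T - y T)| <= e) ->
    mnorm (x T - y T) <= c * e.
Proof.
move=> s1; have [k [l [kl neg]]] := permuted_inversion rinj s1.
set p := permuted r s in neg *; set P : 'M[C]_n := cdiag p.
have pinj : injective (p 0) := permuted_inj rinj (s := s).
pose Q : I -> I -> C := Qm r p.
have Qoff : off_supported Q := Qm_off r p.
(* At an inversion r_k - r_l and p_k - p_l have opposite signs, which makes [qc] positive at (k, l)
   and at (l, k). *)
pose i0 : I := (k, l); have i00 : i0.1 != i0.2 by apply: contraTneq kl => /= ->; rewrite ltnn.
pose E : 'M[C]_n := delta_mx i0.1 i0.2 + delta_mx i0.2 i0.1.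
have qc0 : 0 < qc r p i0.
  have pp : p 0 l - p 0 k != 0 by rewrite subr_eq0 (inj_eq pinj) eq_sym.
  rewrite /qc /= -(@pmulr_lgt0 _ ((p 0 l - p 0 k) ^+ 2)); last by rewrite lt_neqAle sqr_ge0 eq_sym sqrf_eq0 pp.
  by rewrite expr2 mulrA divfK // -oppr_lt0 -mulrN opprB.
have QE : 0 < Re (hform Q E).
  rewrite hformQE cRe_real (bigD1 i0) //= ltr_pwDl //.
    rewrite mulr_gt0 // !mxE !eqxx (negbTE i00) /= addr0.
    by rewrite /sq /= expr1n expr0n addr0.
  apply: sumr_ge0 => i ii0.
  have [->|ii1] := eqVneq i (l, k).
    rewrite mulr_ge0 ?sq_ge0 // /qc /= -mulrNN -invrN !opprB ltW //.
  rewrite !mxE.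
  have -> : (i.1 == k) && (i.2 == l) = false by case: i ii0 {ii1} => i1 i2 /negbTE.
  have -> : (i.1 == l) && (i.2 == k) = false by case: i ii1 {ii0} => i1 i2 /negbTE.
  by rewrite addr0 /sq /= expr0n addr0 mulr0.
have [m m0 hm] := dsum_lower_bound b0 rinj.
pose kf := 2 * mnorm b * mnorm rhod; pose kd := 2 * mnorm b.
have kf0 : 0 <= kf by rewrite !mulr_ge0 ?mnorm_ge0.
have kd0 : 0 <= kd by rewrite !mulr_ge0 ?mnorm_ge0.
pose hQ := 2 * hnorm Q; pose hR := 2 * hnorm K.
have hQ0 : 0 <= hQ by rewrite !mulr_ge0 ?hnorm_ge0.
have hR0 : 0 <= hR by rewrite !mulr_ge0 ?hnorm_ge0.
pose k2 := kd * mnorm P; have k20 : 0 <= k2 by rewrite mulr_ge0 ?mnorm_ge0.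
pose ERm := `|Re (hform K E)|; have ERm0 : 0 <= ERm := normr_ge0 _.
(* [A] must be large enough for the AM-GM step and also for [A Q - K] to inherit from [Q] its
   positivity on [E]. *)
have [A [A0 A1 A2]] : exists A : R, [/\ 0 <= A, 1 + (hR * k2) ^+ 2 / (2 * m) <= A &
    ERm < A * Re (hform Q E)].
  have h1 : 0 <= (hR * k2) ^+ 2 / (2 * m) by rewrite divr_ge0 ?sqr_ge0 // mulr_ge0 // ltW.
  have h2 : 0 <= (ERm + 1) / Re (hform Q E) by rewrite divr_ge0 ?addr_ge0 // ltW.
  exists (1 + (hR * k2) ^+ 2 / (2 * m) + (ERm + 1) / Re (hform Q E)); split; try lra.
  rewrite mulrDl divfK ?gt_eqF // addrA ltr_pwDr //.
  by rewrite lerDr mulr_ge0 ?addr_ge0 // ltW.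
pose M : I -> I -> C := fun i j => A%:C * Q i j - K i j.
have Moff : off_supported M.
  have [q1 q2] := Qoff; have [k1 k2'] := Rm_off a r b.
  by split=> i j h; rewrite /M ?(q1 _ _ h) ?(k1 _ _ h) ?(q2 _ _ h) ?(k2' _ _ h) mulr0 subr0.
have ME : 0 < Re (hform M E).
  rewrite hform_comb cReB cReM cRe_real cIm_real mul0r subr0 subr_gt0.
  exact: le_lt_trans (ler_norm _) A2.
have [cc cc0 hcone] := hform_cone (i0 := i0) kl Moff ME.
have /choice[cD hcD] : forall k' : 'I_n, exists c : R, 0 <= c /\
  forall (d : R) x y, d <= 1 -> isospectral rhod x -> isospectral rhod y ->
    mnorm (x - P) <= d -> mnorm (y - P) <= d ->
    nm ((x - y) k' k') <= c * d * mnorm (x - y).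
  by move=> k'; have [c c0 hc] := isospectral_diag_small rinj s k'; exists c.
pose D := \sum_k' cD k'.
have D0 : 0 <= D by apply: sumr_ge0 => k' _; have [] := hcD k'.
have cDD k' : cD k' <= D.
  by rewrite /D (bigD1 k') //= lerDl; apply: sumr_ge0 => k'' _; have [] := hcD k''.
pose c1 := 2 * (kf * kd); have c10 : 0 <= c1 by rewrite !mulr_ge0 ?mnorm_ge0.
pose c3 := 2 * ((A * hQ + hR) * c1).
have c30 : 0 <= c3 by rewrite mulr_ge0 // mulr_ge0 // addr_ge0 // mulr_ge0.
(* The third condition makes the diagonal of a difference at most half of the whole, whence [w2o];
   the last one absorbs the second order remainder. *)
have [d [d0 d1 dD dc]] : exists d : R,
    [/\ 0 < d, d <= 1, n%:R * (D * d) <= 1 / 2 & d * c3 <= m / 4].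
  have nD0 : 0 <= n%:R * D by rewrite mulr_ge0.
  have cm0 : 0 <= 4 * c3 / m by apply: divr_ge0; [apply: mulr_ge0|apply: ltW].
  have den0 : 0 < 1 + 2 * (n%:R * D) + 4 * c3 / m by lra.
  exists (1 + 2 * (n%:R * D) + 4 * c3 / m)^-1; split.
  - by rewrite invr_gt0.
  - by rewrite invf_le1 //; lra.
  - by rewrite mulrA ler_pdivrMr //; lra.
  - rewrite mulrC ler_pdivrMr // !mulrDr.
    have -> : m / 4 * (4 * c3 / m) = c3 by field; rewrite gt_eqF.
    by rewrite lerDr addr_ge0 ?mulr_ge0 // ?divr_ge0 // ?(ltW m0).
exists d => //; exists i0 => //; exists (2 * cc); first by rewrite mulr_ge0.
move=> x y T T0 tx ty xd yd e e0 hcoord.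
have pos (t : R) : T <= t -> 0 < t := lt_le_trans T0.
have ix (t : R) : T <= t -> isospectral rhod (x t) by move=> /pos/ltW/tx.1.
have iy (t : R) : T <= t -> isospectral rhod (y t) by move=> /pos/ltW/ty.1.
pose w (t : R) := x t - y t.
have hw (t : R) : T <= t -> w t \is hermsymmx.
  move=> Tt; apply/hermP; rewrite adjB (hermP _ (isospectral_herm (ix t Tt))).
  by rewrite (hermP _ (isospectral_herm (iy t Tt))).
have w2o (t : R) : T <= t -> mnorm (w t) <= 2 * mnorm (off (w t)).
  move=> Tt; have w0 : 0 <= mnorm (w t) := mnorm_ge0 _.
  have h k' : nm (w t k' k') <= D * d * mnorm (w t).
    have [c0 hc] := hcD k'.
    apply: (le_trans (hc d _ _ d1 (ix t Tt) (iy t Tt) (xd t Tt) (yd t Tt))).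
    by rewrite ler_wpM2r // ler_wpM2r // ltW.
  have := mnorm_off_diag h.
  have : n%:R * (D * d * mnorm (w t)) <= 1 / 2 * mnorm (w t).
    by rewrite mulrA ler_wpM2r.
  lra.
pose z (t : R) := f (w t) *: drive b (x t) + f (y t) *: drive b (w t).
pose U (t : R) := Re (hform M (w t)).
pose dU (t : R) := Re (hpol M (w t) (rot a (w t) + z t)).
have hU (t : R) : T <= t -> is_derive t 1 U (dU t).
  by move=> Tt; have [] := cder_hform M (mder_difference tx ty (pos t Tt)).
pose o (t : R) := mnorm (off (w t)).
have o0 (t : R) : 0 <= o t by exact: mnorm_ge0.
have grow (t : R) : T <= t -> m / 4 * o t ^+ 2 <= dU t.
  move=> Tt.
  (* The remainder once the control field is frozen at [P]: since [f P = 0], both terms are bounded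
     by a multiple of [d |w|]. *)
  pose ee := f (w t) *: drive b (x t - P) + f (y t) *: drive b (w t).
  have zE : z t = f (w t) *: drive b P + ee.
    have -> : ee = (f (w t) *: drive b (x t) - f (w t) *: drive b P) + f (y t) *: drive b (w t).
      by rewrite /ee (driveB b (x t) P) scalerBr.
    rewrite /z; move: (f (w t) *: drive b (x t)) (f (w t) *: drive b P) (f (y t) *: drive b (w t)) => u v q.
    by rewrite addrA (addrC v) subrK.
  have fP : f P = 0.
    have offP : off P = 0.
      by apply/matrixP => i j; rewrite [LHS]mxE [RHS]mxE cdiagE; case: eqP.
    by rewrite -feedback_off offP -(scale0r (0 : 'M[C]_n)) feedbackZ mul0r.
  have fw := nm_feedback b rhod (w t).
  have fy : nm (f (y t)) <= kf * d.
    have -> : f (y t) = f (y t - P) by rewrite feedbackB fP subr0.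
    by apply: (le_trans (nm_feedback _ _ _)); rewrite ler_wpM2l ?yd.
  have w0 : 0 <= mnorm (w t) := mnorm_ge0 _.
  have eeB : mnorm ee <= c1 * d * (2 * o t).
    apply: (@le_trans _ _ (c1 * d * mnorm (w t))); last first.
      by rewrite ler_wpM2l ?w2o // mulr_ge0 // ltW.
    have -> : c1 * d * mnorm (w t) =
        kf * mnorm (w t) * (kd * d) + kf * d * (kd * mnorm (w t)) by rewrite /c1; ring.
    apply: (le_trans (mnormD _ _)); apply: lerD; apply: (le_trans (mnormZ _ _)).
      rewrite ler_pM ?nm_ge0 ?mnorm_ge0 //; apply: (le_trans (mnorm_drive _ _)).
      by rewrite ler_wpM2l ?xd.
    by rewrite ler_pM ?nm_ge0 ?mnorm_ge0 ?mnorm_drive.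
  have fwE := feedback_Re r hb (hw t Tt).
  have qB : `|Re (hpol Q (w t) ee)| <= hQ * o t * mnorm ee.
    rewrite -(hpol_off _ _ Qoff); apply: (le_trans (Re_le_nm _)).
    apply: (le_trans (nm_hpol _ _ _)); rewrite ler_wpM2l ?mnorm_off //.
    by rewrite !mulr_ge0 ?hnorm_ge0 ?mnorm_ge0.
  have rB := Rm_energy r hfreq hb (z t) (hw t Tt).
  have zB : mnorm (z t) <= `|Re (f (w t))| * k2 + mnorm ee.
    rewrite zE; apply: (le_trans (mnormD _ _)); rewrite lerD2r.
    apply: (le_trans (mnormZ _ _)); rewrite {1}fwE nm_real ler_wpM2l //.
    exact: mnorm_drive.
  have dUE : dU t = A * (2 * Re (f (w t)) ^+ 2 + Re (hpol Q (w t) ee)) -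
      (Re (f (w t)) ^+ 2 - dsum r b (w t) + (Re (hpol K (w t) (rot a (w t) + z t)) -
        (Re (f (w t)) ^+ 2 - dsum r b (w t)))).
    rewrite /dU hpol_comb cReB cReM cRe_real cIm_real mul0r subr0.
    have -> : hpol Q (w t) (rot a (w t) + z t) =
        (Re (f (w t)))%:C * (2 * (Re (f (w t)))%:C) + hpol Q (w t) ee.
      rewrite hpolD hpol_Qm_rot add0r zE hpolD; congr (_ + _).
      rewrite {1}fwE hpolZ hpol_Qm_drive; [|exact: hb|exact: pinj|exact: hw].
      by congr (_ * (2 * _)); exact: fwE.
    rewrite cReD; have -> : Re ((Re (f (w t)))%:C * (2 * (Re (f (w t)))%:C)) = 2 * Re (f (w t)) ^+ 2.
      by rewrite !ReImE /=; ring.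
    by ring.
  rewrite dUE.
  exact: (@saddle_arith A m (o t) _ hQ hR k2 c1 d (mnorm ee) _ _ _ (mnorm (z t))
    m0 A0 (o0 t) hQ0 hR0 eeB qB rB zB (hm (w t)) A1 dc).
have Ubound (t : R) : `|U t| <= hnorm M * o t ^+ 2.
  by rewrite /U -(hform_off _ Moff); apply: (le_trans (Re_le_nm _)); apply: nm_hform.
(* If [U T] were positive, [U] would increase, so the off-diagonal part would stay away from 0, so
   [U] would grow at least linearly, whereas trapping keeps it bounded. *)
have UT : U T <= 0.
  rewrite leNgt; apply/negP => U0.
  have hM0 : 0 < hnorm M + 1 by rewrite ltr_wpDl ?hnorm_ge0.
  have Ule (t : R) : U t <= (hnorm M + 1) * o t ^+ 2.
    apply: (le_trans (ler_norm _)); apply: (le_trans (Ubound t)).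
    by rewrite ler_wpM2r ?sqr_ge0 // lerDl.
  have m40 : 0 < m / 4 by rewrite divr_gt0.
  have Umono (t : R) : T <= t -> U T <= U t.
    move=> Tt; apply: (derive_ge0_le (df := dU) Tt) => u /andP[Tu _]; first exact: hU.
    by apply: le_trans (grow u Tu); rewrite mulr_ge0 ?sqr_ge0 ?(ltW m40).
  apply: (@derive_unbounded _ U dU (m / 4 * (U T / (hnorm M + 1))) T (hnorm M * (2 * d) ^+ 2)).
  - by rewrite mulr_gt0 // divr_gt0.
  - move=> t Tt; apply: le_trans (grow t Tt); rewrite ler_wpM2l ?(ltW m40) //.
    by rewrite ler_pdivrMr // mulrC; apply: le_trans (Umono t Tt) (Ule t).
  - move=> t Tt; apply: (le_trans (Ubound t)); rewrite ler_wpM2l ?hnorm_ge0 //.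
    apply: lerXn2r; rewrite ?nnegrE ?o0 //; first by rewrite mulr_ge0 // ltW.
    apply: (le_trans (mnorm_off _)).
    have -> : w t = (x t - P) - (y t - P) by rewrite opprB addrA subrK.
    by apply: (le_trans (mnormB _ _)); have := xd t Tt; have := yd t Tt; lra.
apply: (le_trans (w2o T (lexx _))); rewrite -mulrA ler_wpM2l //.
exact: hcone (hw T (lexx _)) e0 UT hcoord.
Qed.

End saddles.

(** * Null sets *)

Section null_sets.
Variables (R : realType) (d : nat).
Implicit Types E : set 'rV[R]_d.

Lemma lebesgue_null_sub E E' : E `<=` E' -> lebesgue_null E' -> lebesgue_null E.
Proof.
move=> EE h e e0; have [I [a [b [ab cov vol]]]] := h e e0.
by exists I, a, b; split => //; apply: subset_trans cov.
Qed.

Lemma box_volume_ge0 (a b : nat -> 'rV[R]_d) k : (forall k j, a k 0 j <= b k 0 j) ->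
  (0 <= (\prod_(j < d) (b k 0 j - a k 0 j))%:E)%E.
Proof. by move=> ab; rewrite lee_fin; apply: prodr_ge0 => j _; rewrite subr_ge0. Qed.

Lemma lebesgue_null_bigcup (E : nat -> set 'rV[R]_d) :
  (forall n, lebesgue_null (E n)) -> lebesgue_null (\bigcup_n E n).
Proof.
move=> hE e e0.
have en n : 0 < e / (2 ^ n.+1)%:R by rewrite divr_gt0 // ltr0n expn_gt0.
have /choice[c hc] : forall n, exists c : set nat * ((nat -> 'rV[R]_d) * (nat -> 'rV[R]_d)),
    [/\ forall k j, c.2.1 k 0 j <= c.2.2 k 0 j,
        E n `<=` \bigcup_(k in c.1) [set x | forall j, c.2.1 k 0 j <= x 0 j <= c.2.2 k 0 j] &
        (\esum_(k in c.1) (\prod_(j < d) (c.2.2 k 0 j - c.2.1 k 0 j))%:E <=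
          (e / (2 ^ n.+1)%:R)%:E)%E].
  by move=> n; have [I [a [b hab]]] := hE n _ (en n); exists (I, (a, b)).
pose P : set (nat * nat) := setT `*`` (fun n => (c n).1).
pose u (q : nat * nat) := (c q.1).2.1 q.2; pose v (q : nat * nat) := (c q.1).2.2 q.2.
pose lift (g : nat * nat -> 'rV[R]_d) k := if unpickle k is Some q then g q else 0.
have liftE g q : lift g (pickle q) = g q by rewrite /lift pickleK.
exists (pickle @` P), (lift u), (lift v); split.
- move=> k j; rewrite /lift; case: unpickle => [q|//].
  by have [h _ _] := hc q.1; apply: h.
- move=> x [n _ /= nx]; have [_ cov _] := hc n.
  have [k Ik hk] := cov x nx.
  exists (pickle (n, k)); first by exists (n, k).
  by move=> j; rewrite !liftE; apply: hk.
rewrite (reindex_esum P (pickle @` P) pickle); last first.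
  by apply: inj_bij => p q _ _; apply: (pcan_inj pickleK).
under eq_esum do rewrite !liftE.
rewrite /P -(esum_esum (a := fun n k => (\prod_(j < d) (v (n, k) 0 j - u (n, k) 0 j))%:E)); last first.
  by move=> n k _ _; apply: box_volume_ge0; have [h _ _] := hc n.
apply: (@le_trans _ _ (\esum_(n in [set: nat]) (e / (2 ^ n.+1)%:R)%:E)%E).
  by apply: le_esum => n _; have [_ _ h] := hc n.
rewrite -nneseries_esumT; last by move=> n; rewrite lee_fin ltW.
exact: (epsilon_trick0 xpredT (ltW e0)).
Qed.

Lemma lebesgue_null_countable (T : countType) (E : T -> set 'rV[R]_d) :
  (forall i, lebesgue_null (E i)) -> lebesgue_null (\bigcup_i E i).
Proof.
move=> hE; pose E' n := if unpickle n is Some i then E i else set0.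
apply: (@lebesgue_null_sub _ (\bigcup_n E' n)).
  by move=> x [i _ ix]; exists (pickle i) => //; rewrite /E' pickleK.
apply: lebesgue_null_bigcup => n; rewrite /E'; case: unpickle => [i|]; first exact: hE.
move=> e e0; exists set0, (fun=> 0), (fun=> 0); split => //.
by rewrite esum_set0 lee_fin ltW.
Qed.

(* The image of [E] lies in a cube of dimension [#|J| < d], which is cut into small cells;
   the preimage of each cell lies in a small cube of dimension [d]. *)
Lemma lebesgue_null_low_dim (J : finType) E (h : 'rV[R]_d -> J -> R) (B c : R) :
  (#|J| < d)%N -> 0 <= c ->
  (forall v i, E v -> `|h v i| <= B) ->
  (forall v v' (e : R), E v -> E v' -> 0 <= e -> (forall i, `|h v i - h v' i| <= e) ->
     forall j, `|v 0 j - v' 0 j| <= c * e) ->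
  lebesgue_null E.
Proof.
move=> Jd c0 hB hc e e0.
pose L := 2 * (`|B| + 1); have L0 : 0 < L by rewrite mulr_gt0 // ltr_wpDl.
(* With N cells per axis the total volume is N^|J| (2 c L / N)^d, at most (2 c L)^d / N because |J|
   < d; this choice of N makes it at most [e]. *)
pose N := (Num.truncn ((2 * (c * L)) ^+ d / e)).+1.
have N0 : 0 < N%:R :> R by rewrite ltr0n.
pose n := N.-1.
pose X v i := (h v i + (`|B| + 1)) / L * N%:R.
pose cell v : {ffun J -> 'I_N} := [ffun i => inord (Num.truncn (X v i))].
have Xb v i : E v -> 0 <= X v i < N%:R.
  move=> Ev; have := hB v i Ev; have := ler_norm B; have := normr_ge0 B.
  move=> b0 b1 /ler_normlP[h1 h2]; apply/andP; split.
    by rewrite mulr_ge0 ?(ltW N0) // divr_ge0 ?(ltW L0) //; lra.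
  by rewrite gtr_pMl // ltr_pdivrMr // mul1r /L; lra.
have Xcell v i : E v -> (cell v i : nat)%:R <= X v i < (cell v i).+1%:R.
  move=> Ev; have /andP[x0 x1] := Xb v i Ev; rewrite ffunE inordK ?truncn_itv //.
  rewrite -/N -(@ltr_nat R); apply: le_lt_trans x1.
  by have /andP[] := truncn_itv x0.
pose eta := L / N%:R; have eta0 : 0 <= eta by rewrite divr_ge0 // ltW.
have same v v' i : E v -> E v' -> cell v = cell v' -> `|h v i - h v' i| <= eta.
  move=> Ev Ev' cc; have := Xcell v i Ev; have := Xcell v' i Ev'; rewrite cc -natr1.
  move: ((cell v' i)%:R : R) => m /andP[h1 h2] /andP[h3 h4].
  have -> : h v i - h v' i = (X v i - X v' i) * eta.
    by rewrite /X /eta; field; rewrite !gt_eqF.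
  rewrite normrM (ger0_norm eta0) ler_piMl //.
  by rewrite ler_norml; apply/andP; split; lra.
(* A cell that no point of [E] reaches gets the arbitrary centre 0; its cube only enters the
   count. *)
have /choice[rep hrep] : forall k : {ffun J -> 'I_N}, exists v : 'rV[R]_d,
    (exists v', E v' /\ cell v' = k) -> E v /\ cell v = k.
  move=> k; have [[v' [Ev' kv']]|no] := pselect (exists v', E v' /\ cell v' = k).
    by exists v'.
  by exists 0.
pose F := enum {: {ffun J -> 'I_N}}.
pose x0 : {ffun J -> 'I_N} := [ffun=> ord0].
exists `I_(size F), (fun k => \row_j (rep (nth x0 F k) 0 j - c * eta)),
  (fun k => \row_j (rep (nth x0 F k) 0 j + c * eta)); split.
- by move=> k j; rewrite !mxE; have := mulr_ge0 c0 eta0; lra.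
- move=> v Ev; have [Er cr] := hrep (cell v) (ex_intro _ v (conj Ev erefl)).
  have Fv : cell v \in F by rewrite mem_enum.
  exists (index (cell v) F); first by rewrite /= index_mem.
  move=> j; rewrite !mxE nth_index //.
  have := hc v (rep (cell v)) eta Ev Er eta0 (fun i => same v _ i Ev Er (esym cr)) j.
  by rewrite ler_norml => /andP[h1 h2]; apply/andP; split; lra.
rewrite esum_fset; [|exact: finite_II|]; last first.
  move=> k _; rewrite lee_fin; apply: prodr_ge0 => j _; rewrite !mxE.
  by have := mulr_ge0 c0 eta0; lra.
rewrite -fsbig_ord sumEFin lee_fin.
have -> : \sum_(k < size F) \prod_(j < d)
    ((\row_j (rep (nth x0 F k) 0 j + c * eta)) 0 j -
     (\row_j (rep (nth x0 F k) 0 j - c * eta)) 0 j) = (size F)%:R * (2 * (c * eta)) ^+ d.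
  rewrite -[size F in RHS]card_ord mulr_natl -sumr_const; apply: eq_bigr => k _.
  rewrite -[d in RHS]card_ord -prodr_const; apply: eq_bigr => j _; rewrite !mxE.
  by ring.
rewrite -cardE card_ffun card_ord natrX.
have -> : 2 * (c * eta) = 2 * (c * L) / N%:R by rewrite /eta; field; rewrite gt_eqF.
have Nd : (N%:R ^+ #|J| * N%:R : R) <= N%:R ^+ d.
  by rewrite -exprSr; apply: ler_weXn2l => //; rewrite ler1n.
have KN : (2 * (c * L)) ^+ d <= e * N%:R.
  rewrite [leRHS]mulrC -ler_pdivrMr //; apply: ltW.
  have Ke : 0 <= (2 * (c * L)) ^+ d / e.
    by rewrite divr_ge0 ?exprn_ge0 ?(ltW e0) // mulr_ge0 // mulr_ge0 // ltW.
  by have /andP[] := truncn_itv Ke.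
rewrite expr_div_n [leLHS]mulrA ler_pdivrMr ?exprn_gt0 //.
apply: (@le_trans _ _ (N%:R ^+ #|J| * (e * N%:R))).
  by rewrite ler_wpM2l // exprn_ge0 // ltW.
by rewrite mulrCA ler_wpM2l // ltW.
Qed.

End null_sets.

(** * The exceptional set in a chart *)

Section change_of_basis.
Variables (R : realType) (n : nat).
Local Notation C := R[i].
Local Notation Re := (@complex.Re R).
Variable U : 'M[C]_n.
Hypothesis hU : U \is unitarymx.

Definition cj (A : 'M[C]_n) : 'M[C]_n := U *m A *m U ^t*.

Lemma cjM A B : cj (A *m B) = cj A *m cj B.
Proof.
by rewrite /cj !mulmxA -[U *m A *m U ^t* *m U]mulmxA unitary_adjK // mulmx1.
Qed.

Lemma cjB A B : cj (A - B) = cj A - cj B.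
Proof. by rewrite /cj mulmxBr mulmxBl. Qed.

Lemma cjD A B : cj (A + B) = cj A + cj B.
Proof. by rewrite /cj mulmxDr mulmxDl. Qed.

Lemma cjZ c A : cj (c *: A) = c *: cj A.
Proof. by rewrite /cj -scalemxAr -scalemxAl. Qed.

Lemma tr_cj A : \tr (cj A) = \tr A.
Proof. by rewrite /cj mxtrace_mulC mulmxA unitary_adjK // mul1mx. Qed.

Lemma cjK A : U ^t* *m cj A *m U = A.
Proof.
by rewrite /cj !mulmxA unitary_adjK // mul1mx -mulmxA unitary_adjK // mulmx1.
Qed.

Lemma cj_commutator A B : cj (commutator A B) = commutator (cj A) (cj B).
Proof. by rewrite /commutator cjB !cjM. Qed.

Lemma cj_feedback H rhod x : feedback (cj H) (cj rhod) (cj x) = feedback H rhod x.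
Proof. by rewrite /feedback -cjZ -cj_commutator -cjM tr_cj. Qed.

Lemma cj_closed_loop H0 H1 rhod x :
  cj (closed_loop H0 H1 rhod x) = closed_loop (cj H0) (cj H1) (cj rhod) (cj x).
Proof. by rewrite /closed_loop cjZ cj_commutator cjD cjZ cj_feedback. Qed.

Lemma cj_herm A : A \is hermsymmx -> cj A \is hermsymmx.
Proof. by move=> /hermP h; apply/hermP; rewrite /cj !adjM trmxCK h mulmxA. Qed.

Lemma mnorm_cj_inv : exists2 c : R, 0 <= c & forall A, mnorm A <= c * mnorm (cj A).
Proof.
exists (mnorm (U ^t*) * mnorm U); first by rewrite mulr_ge0 ?mnorm_ge0.
move=> A; rewrite -{1}(cjK A); apply: (le_trans (mnormM _ _)).
by rewrite mulrAC ler_wpM2r ?mnorm_ge0 // mnormM.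
Qed.

Lemma mcvg_cj T (F : set_system T) (FF : ProperFilter F) (A : T -> 'M[C]_n) L :
  mcvg F A L -> mcvg F (fun t => cj (A t)) (cj L).
Proof.
by move=> h; apply: mcvgM; [apply: mcvgM => //; apply: mcvg_cst|apply: mcvg_cst].
Qed.

Lemma mcvg_cjK T (F : set_system T) (FF : ProperFilter F) (A : T -> 'M[C]_n) L :
  mcvg F (fun t => cj (A t)) (cj L) -> mcvg F A L.
Proof.
move=> h; rewrite -(cjK L).
have -> : A = (fun t => U ^t* *m cj (A t) *m U) by apply/funext => t; rewrite cjK.
by apply: mcvgM; [apply: mcvgM => //; apply: mcvg_cst|apply: mcvg_cst].
Qed.

Lemma mder_cj (A : R -> 'M[C]_n) t L : mder A t L -> mder (fun t => cj (A t)) t (cj L).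
Proof.
move=> h; have := mderM (mderM (mder_cst U t) h) (mder_cst (U ^t*) t).
by rewrite mul0mx add0r mulmx0 addr0.
Qed.

Lemma stationary_diagonal (a : 'rV[R]_n) (x : 'M[C]_n) : injective (a 0) ->
  x \is hermsymmx -> commutator (cdiag a) x = 0 -> x = cdiag (\row_k Re (x k k)).
Proof.
move=> ainj hx cx; apply/matrixP => k l; rewrite cdiagE mxE.
case: eqP => [<-|/eqP kl]; first by apply: conj_realE; rewrite herm_entry.
have := congr1 (fun A : 'M[C]_n => A k l) cx.
rewrite commutator_entry mulmx_cdiag mulmx_cdiagl [in RHS]mxE [X in _ - X]mulrC -mulrBl => /eqP.
rewrite mulf_eq0 => /orP[|/eqP //] /eqP/(congr1 Re) /= /eqP.
by rewrite subr_eq0 (inj_eq ainj) (negbTE kl).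
Qed.

(** The n distinct eigenvalues all occur in the list of the r_k, which has length n and so cannot
    repeat a value. *)
Lemma generic_injective (rhod : 'M[C]_n) (r : 'rV[R]_n) :
  generic rhod -> char_poly rhod = char_poly (cdiag r) -> injective (r 0).
Proof.
move=> [s [us ss hs]] e.
pose t := [seq (r 0 k)%:C | k <- enum 'I_n].
have st : {subset s <= t}.
  move=> x /hs; rewrite eigenvalue_root_char e rootE horner_char_poly det_cdiag.
  move=> /prodf_eq0[k _ /eqP h]; apply/mapP; exists k; first by rewrite mem_enum.
  by apply/eqP; rewrite -subr_eq0 h.
have ut : uniq t.
  by apply: (leq_size_uniq us st); rewrite size_map size_enum_ord ss.
have /injectiveP inj : injectiveb (fun k => (r 0 k)%:C : C) by [].
by move=> k l kl; apply: inj; rewrite kl.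
Qed.

End change_of_basis.

(** * Quantitative injectivity of immersions *)

Section immersions.
Variables (R : realType) (d n : nat).
Local Notation C := R[i].

Lemma mx_norm_le m p (x : 'M[R]_(m, p)) (c : R) : 0 <= c ->
  (forall i j, `|x i j| <= c) -> `|x| <= c.
Proof.
move=> c0 h; rewrite -[`|x|]/(mx_norm x) mx_normrE.
by elim/big_ind : _ => // u v uc vc; rewrite ge_max uc.
Qed.

Lemma le_mx_norm m p (x : 'M[R]_(m, p)) i j : `|x i j| <= `|x|.
Proof.
rewrite -[`|x|]/(mx_norm x) mx_normrE (bigD1 (i, j)) //= le_max lexx //.
Qed.

Lemma norm_realify (A : 'M[C]_n) : `|realify A| <= mnorm A.
Proof.
rewrite prod_normE ge_max; apply/andP; split; apply: mx_norm_le => [|i j];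
  rewrite ?mnorm_ge0 //= mxE.
  exact: le_trans (Re_le_nm _) (nm_le_mnorm A i j).
exact: le_trans (Im_le_nm _) (nm_le_mnorm A i j).
Qed.

(** The matrix of [L], its values being flattened into rows, has full row rank, so a right inverse
    recovers u from its image. *)
Lemma injective_linear_bounded_below m (L : {linear 'rV[R]_d -> ('M[R]_m * 'M[R]_m)%type}) :
  injective L -> exists2 c : R, 0 < c & forall u, `|u| <= c * `|L u|.
Proof.
move=> Linj.
pose F (u : 'rV[R]_d) : 'rV[R]_(m * m + m * m) := row_mx (mxvec (L u).1) (mxvec (L u).2).
pose A := \matrix_(i < d) F (delta_mx 0 i).
have FD : {morph F : u v / u + v >-> u + v}.
  by move=> u v; rewrite /F linearD /= !linearD add_row_mx.
have FZ x u : F (x *: u) = x *: F u.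
  by rewrite /F linearZ /= !linearZ scale_row_mx.
have F0 : F 0 = 0 by rewrite /F linear0 /= !linear0 row_mx0.
have FA u : u *m A = F u.
  rewrite [in RHS](row_sum_delta u) (big_morph F FD F0) mulmx_sum_row.
  by apply: eq_bigr => i _; rewrite rowK FZ.
have /mulmxVp AP : row_free A.
  apply: inj_row_free => u; rewrite FA /F -row_mx0 => /eq_row_mx[h1 h2].
  have z1 : (L u).1 = 0 by rewrite -[LHS]mxvecK h1 linear0.
  have z2 : (L u).2 = 0 by rewrite -[LHS]mxvecK h2 linear0.
  apply: Linj; rewrite linear0.
  by case: (L u) z1 z2 => l1 l2 /= -> ->.
pose P := pinvmx A.
pose c := \sum_k \sum_j `|P k j|.
have c0 : 0 <= c by apply: sumr_ge0 => k _; apply: sumr_ge0.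
exists (c + 1); first by rewrite ltr_wpDl.
move=> u; apply: mx_norm_le; first by rewrite mulr_ge0 // addr_ge0.
move=> i j; rewrite ord1.
have -> : u 0 j = \sum_k F u 0 k * P k j.
  by rewrite -{1}[u]mulmx1 -AP mulmxA FA mxE.
have FL k : `|F u 0 k| <= `|L u|.
  rewrite prod_normE le_max /F mxE; case: splitP => k' _.
    by case/mxvec_indexP: k' => a b; rewrite mxvecE le_mx_norm.
  by case/mxvec_indexP: k' => a b; rewrite mxvecE le_mx_norm orbT.
apply: (le_trans (ler_norm_sum _ _ _)).
apply: (@le_trans _ _ (c * `|L u|)); last by rewrite ler_wpM2r // lerDl.
rewrite mulr_suml; apply: ler_sum => k _; rewrite normrM mulrC.
apply: (@le_trans _ _ (`|P k j| * `|L u|)); first by rewrite ler_wpM2l.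
by rewrite ler_wpM2r // (bigD1 j) //= lerDl; apply: sumr_ge0.
Qed.

(** The differential expands by at least 1 / c, and a remainder of size |v' - v| / (2 c) costs half
    of this. A single integer bounds both the inverse radius and the constant, so that countably
    many cases cover all points. *)
Lemma immersion_lower_bound (g : 'rV[R]_d -> 'M[R]_n * 'M[R]_n) (v : 'rV[R]_d) :
  differentiable g v -> injective ('d g v) -> exists m : nat,
  forall v' : 'rV[R]_d, `|v' - v| <= m.+1%:R^-1 -> `|v' - v| <= m.+1%:R * `|g v' - g v|.
Proof.
move=> dg inj; have [c c0 hc] := injective_linear_bounded_below inj.
have [_ /eqaddoP h] := (diff_locallyP _ _).1 dg.
have e0 : 0 < (2 * c)^-1 by rewrite invr_gt0 mulr_gt0.
have /nbhs_ballP[r /= r0 hr] := h _ e0.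
pose m := Num.truncn (2 * c + r^-1).
have m1 : 2 * c + r^-1 < m.+1%:R.
  have p : 0 <= 2 * c + r^-1 by rewrite addr_ge0 ?mulr_ge0 ?invr_ge0 // ltW.
  by have /andP[] := truncn_itv p.
have r10 : 0 < r^-1 by rewrite invr_gt0.
have c20 : 0 < 2 * c by rewrite mulr_gt0.
exists m => v' hv'.
have vr : `|v' - v| < r.
  apply: (le_lt_trans hv'); rewrite -[r]invrK ltf_pV2 ?posrE //.
  by apply: le_lt_trans m1; rewrite lerDr ltW.
have := hr (v' - v); rewrite -ball_normE /= sub0r normrN => /(_ vr).
rewrite /cst /= !fctE /= subrK => hd.
have hL := hc (v' - v).
set Lv := 'd g v (v' - v) in hd hL.
have hN : `|Lv| <= `|g v' - g v| + (2 * c)^-1 * `|v' - v|.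
  have -> : Lv = (g v' - g v) - (g v' - (g v + Lv)).
    by rewrite opprB [RHS]addrC addrA subrK [RHS]addrC addKr.
  by apply: (le_trans (ler_normB _ _)); rewrite lerD2l.
have half : c * ((2 * c)^-1 * `|v' - v|) = `|v' - v| / 2 by field; rewrite gt_eqF.
have h2 := le_trans hL (ler_wpM2l (ltW c0) hN); rewrite mulrDr half in h2.
apply: (@le_trans _ _ (2 * c * `|g v' - g v|)); first lra.
by rewrite ler_wpM2r // ltW // (lt_trans _ m1) // ltrDl.
Qed.

End immersions.

(** * Countable decomposition of the exceptional set *)

Section saddle_basins.
Variables (R : realType) (n : nat).
Local Notation C := R[i].
Local Notation I := ('I_n * 'I_n)%type.

Lemma coordB (i : I) (x y : 'M[C]_n) : coord i (x - y) = coord i x - coord i y.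
Proof. by rewrite /coord !mxE !raddfB; case: ifP. Qed.

Lemma coord_le_mnorm (i : I) (x : 'M[C]_n) : `|coord i x| <= mnorm x.
Proof.
apply: le_trans (nm_le_mnorm x i.1 i.2).
by rewrite /coord; case: ifP => _; [apply: Re_le_nm|apply: Im_le_nm].
Qed.

Lemma card_offdiag : #|[pred i : I | i.1 != i.2]| = (n ^ 2 - n)%N.
Proof.
have e := cardC [pred i : I | i.1 == i.2].
have d : #|[pred i : I | i.1 == i.2]| = n.
  rewrite -[RHS]card_ord -(@fintype.card_image _ I (fun k : 'I_n => (k, k))) => [|k l [] //].
  apply: eq_card => -[k l]; rewrite !inE /=; apply/eqP/fintype.imageP => [->|[m _ [-> ->]] //].
  by exists l.
rewrite d card_prod card_ord in e.
by rewrite -mulnn -e addKn; apply: eq_card.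
Qed.

Lemma card_offdiag1 (i0 : I) : i0.1 != i0.2 ->
  (#|{: {i : I | (i.1 != i.2) && (i != i0)}}| < n ^ 2 - n)%N.
Proof.
move=> h; rewrite card_sig -card_offdiag [in X in (_ < X)%N](cardD1 i0) inE h add1n ltnS.
by apply: subset_leq_card; apply/fintype.subsetP => i; rewrite !inE andbC.
Qed.

Lemma floor_cell (d m : nat) (v v' : 'rV[R]_d) :
  (forall j, Num.floor (v 0 j * m.+1%:R) = Num.floor (v' 0 j * m.+1%:R)) ->
  `|v - v'| <= m.+1%:R^-1.
Proof.
move=> h; apply: mx_norm_le => [|i j]; first by rewrite invr_ge0.
rewrite ord1 !mxE -[leRHS]mul1r ler_pdivlMr // -[m.+1%:R in leLHS]gtr0_norm //.
rewrite -normrM mulrBl.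
have /andP[a1 a2] := floor_itv (v 0 j * m.+1%:R).
have /andP[b1 b2] := floor_itv (v' 0 j * m.+1%:R).
rewrite h in a1 a2; rewrite !intrD in a2 b2.
rewrite ler_norml; apply/andP; split; lra.
Qed.

Variables (U H0 H1 rhod : 'M[C]_n) (a r : 'rV[R]_n).
Hypothesis hU : U \is unitarymx.
Hypothesis hH1 : H1 \is hermsymmx.
Hypothesis hH0a : cj U H0 = cdiag a.
Hypothesis hrhod : cj U rhod = cdiag r.
Hypothesis rinj : injective (r 0).
Local Notation b := (cj U H1).
Hypothesis hfreq : forall i j : I, i.1 != i.2 -> j.1 != j.2 -> omega a i = omega a j -> i = j.
Hypothesis b0 : forall i : I, i.1 != i.2 -> b i.1 i.2 != 0.

Lemma solution_trajectory x0 (x : R -> 'M[C]_n) : solution H0 H1 rhod x0 x ->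
  trajectory a r b (fun t => cj U (x t)) /\ mcvg 0^'+ (fun t => cj U (x t)) (cj U (x 0)).
Proof.
move=> [_ iso c0 dx]; split; last by apply: mcvg_cj; apply/realify_cvgP.
split=> t t0.
  have [dt ct] := isospectral_conj hU (iso t t0); split; first exact: dt.
  by rewrite [LHS]ct -hrhod /cj char_poly_conj.
have /realify_deriveP/(mder_cj U) := dx t t0.
by rewrite cj_closed_loop // hH0a hrhod closed_loopE.
Qed.

Lemma converges_to_saddle x0 (x : R -> 'M[C]_n) : solution H0 H1 rhod x0 x ->
  ~ realify (x t) @[t --> +oo] --> realify rhod ->
  exists2 s : 'S_n, s != 1%g & mcvg +oo (fun t => cj U (x t)) (cdiag (permuted r s)).
Proof.
move=> sx nx; have [tx _] := solution_trajectory sx.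
have [p hp] := trajectory_converges hfreq (cj_herm U hH1) b0 rinj tx.
have [s ps] := isospectral_limit rinj tx.1 hp; exists s; last by rewrite -ps.
apply/eqP => s1; apply: nx; apply/realify_cvgP; apply: (mcvg_cjK hU).
rewrite hrhod (_ : r = p) //; apply/rowP => k.
by rewrite ps s1 mxE perm1.
Qed.

(** Integer trapping times keep the decomposition countable; [N.+1] makes them positive, as
    [saddle_cone] and the backward estimate require. *)
Definition saddle_basin (s : 'S_n) (dl : R) (N : nat) : set 'M[C]_n :=
  [set x0 | exists2 x, solution H0 H1 rhod x0 x &
     forall t : R, N.+1%:R <= t -> mnorm (cj U (x t) - cdiag (permuted r s)) <= dl].

(* Within such a piece, whose diameter is at most [1 / m.+1], the inverse of [phi] is
   Lipschitz. *)
Definition basin_piece (phi : 'rV[R]_(n ^ 2 - n) -> 'M[C]_n) (s : 'S_n) (dl : R)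
    (N m : nat) (z : {ffun 'I_(n ^ 2 - n) -> int}) : set 'rV[R]_(n ^ 2 - n) :=
  [set v | [/\ saddle_basin s dl N (phi v),
    forall v', `|v' - v| <= m.+1%:R^-1 ->
      `|v' - v| <= m.+1%:R * `|realify (phi v') - realify (phi v)| &
    forall j, Num.floor (v 0 j * m.+1%:R) = z j]].

(** The map [h] records all off-diagonal coordinates but one of the state at time N + 1. Its inverse
    is Lipschitz in four stages: the coordinates determine that state by [saddle_cone], then the
    initial state by Gronwall, then its form in the original basis, and at last the chart point,
    both points lying in the same cell. *)
Lemma basin_piece_null (s : 'S_n) : s != 1%g -> exists2 dl : R, 0 < dl &
  forall phi N m z, lebesgue_null (basin_piece phi s dl N m z).
Proof.
move=> s1.
have [dl dl0 [i0 hi0 [c c0 cone]]] := saddle_cone hfreq (cj_herm U hH1) b0 rinj s1.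
exists dl => // phi N m z.
have T0 : (0 : R) < N.+1%:R by [].
have [k1 k10 hk1] := mnorm_cj_inv hU.
have [k2 k20 hk2] := trajectory_backward_lipschitz a r b T0.
set E := basin_piece _ _ _ _ _ _.
have /choice[X hX] : forall v, exists x : R -> 'M[C]_n, E v ->
    solution H0 H1 rhod (phi v) x /\
    forall t : R, N.+1%:R <= t -> mnorm (cj U (x t) - cdiag (permuted r s)) <= dl.
  move=> v; have [[[x sx hx] _ _]|h] := pselect (E v); first by exists x.
  by exists (fun=> 0) => /h.
pose J := {: {i : I | (i.1 != i.2) && (i != i0)}}.
pose h (v : 'rV[R]_(n ^ 2 - n)) (i : J) := coord (val i) (cj U (X v N.+1%:R)).
apply: (@lebesgue_null_low_dim _ _ J E h (n%:R * n%:R * 2)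
  (m.+1%:R * (k1 * (k2 * c)))).
- exact: card_offdiag1.
- by rewrite !mulr_ge0.
- move=> v i /hX[/solution_trajectory[[iso _] _] _].
  exact: le_trans (coord_le_mnorm _ _) (isospectral_bounded (iso _ (ltW T0))).
move=> v v' e Ev Ev' e0 he j.
have [sx nx] := hX v Ev; have [sy ny] := hX v' Ev'.
have [tx cx] := solution_trajectory sx; have [ty cy] := solution_trajectory sy.
have hT := cone _ _ _ T0 tx ty nx ny e e0.
have {}hT : mnorm (cj U (X v N.+1%:R) - cj U (X v' N.+1%:R)) <= c * e.
  apply: hT => i i1 i2; rewrite coordB.
  have hi : (i.1 != i.2) && (i != i0) by rewrite i1.
  exact: (he (exist _ i hi)).
have h0 := hk2 _ _ tx ty cx cy.
have [[x0 _ _ _] [y0 _ _ _]] := (sx, sy).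
have [_ _ zv] := Ev; have [_ low zv'] := Ev'.
have : `|v - v'| <= m.+1%:R * `|realify (phi v) - realify (phi v')|.
  by apply: low; apply: floor_cell => l; rewrite zv zv'.
have -> : realify (phi v) - realify (phi v') = realify (phi v - phi v').
  by apply/eqP; rewrite -pair_eqE /= /realify /= !map_mxB !eqxx.
move=> hv; have := le_mx_norm (v - v') 0 j; rewrite !mxE => /le_trans; apply.
apply: (le_trans hv); rewrite -!mulrA; apply: ler_wpM2l => //.
apply: (le_trans (norm_realify _)); rewrite -x0 -y0.
apply: (le_trans (hk1 _)); apply: ler_wpM2l => //; rewrite cjB.
by apply: (le_trans h0); apply: ler_wpM2l.
Qed.

Lemma not_attracted_null :
  (forall x0, isospectral rhod x0 -> exists x, solution H0 H1 rhod x0 x) ->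
  measure_zero (n ^ 2 - n)%N (isospectral rhod)
    [set x0 | isospectral rhod x0 /\ ~ attracted H0 H1 rhod x0].
Proof.
move=> sol V phi [_ smooth inj _ _].
have /choice[dl hdl] : forall s : 'S_n, exists dl : R, s != 1%g -> 0 < dl /\
    forall phi N m z, lebesgue_null (basin_piece phi s dl N m z).
  move=> s; have [->|/basin_piece_null[dl h1 h2]] := eqVneq s 1%g; first by exists 0.
  by exists dl.
pose E (q : 'S_n * nat * nat * {ffun 'I_(n ^ 2 - n) -> int}) :=
  let: (s, N, m, z) := q in
  [set v | s != 1%g /\ basin_piece phi s (dl s) N m z v].
apply: (@lebesgue_null_sub _ _ _ (\bigcup_q E q)); last first.
  apply: lebesgue_null_countable => -[[[s N] m] z].
  have [s1|s1] := eqVneq s 1%g.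
    (* For the identity permutation the piece is empty, that is, contained in a union without
       members. *)
    apply: (@lebesgue_null_sub _ _ _ (\bigcup_(k : void) set0)) => [v [/eqP]//|].
    by apply: (lebesgue_null_countable (T := void)) => -[].
  apply: lebesgue_null_sub ((hdl s s1).2 phi N m z) => v [_ //].
move=> v [Vv [iso natt]].
(* As a solution exists, failing to be attracted means that some solution does not converge to
   [rhod]. *)
have [x sx nx] : exists2 x, solution H0 H1 rhod (phi v) x &
    ~ realify (x t) @[t --> +oo] --> realify rhod.
  apply: contrapT => hno; apply: natt; split; first exact: sol.
  by move=> x sx; apply: contrapT => nx; apply: hno; exists x.
have [s s1 cx] := converges_to_saddle sx nx.
have [m hm] := immersion_lower_bound (smooth [::] v Vv) (inj v Vv).
have [dl0 _] := hdl s s1.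
have := cvgr0_norm_lt _ (mcvg_norm _ cx) _ dl0.
move=> [M [_ hM]].
(* The threshold [M] may be negative, hence the maximum with 0. *)
pose N := Num.truncn (Num.max 0 M).
have MN : M < N.+1%:R.
  have p : 0 <= Num.max 0 M by rewrite le_max lexx.
  have /andP[_] := truncn_itv p; apply: le_lt_trans; by rewrite le_max lexx orbT.
exists (s, N, m, [ffun j => Num.floor (v 0 j * m.+1%:R)]) => //; split=> //; split.
- exists x => // t tN.
  have := hM t (lt_le_trans MN tN); rewrite ger0_norm ?mnorm_ge0 // => h.
  exact: ltW.
- exact: hm.
by move=> j; rewrite ffunE.
Qed.

End saddle_basins.

Theorem mainTheorem9 (R : realType) (n : nat) (H0 H1 rhod : 'M[R[i]%C]_n)
    (hH0 : (H0 \is hermsymmx)%R) (hH1 : (H1 \is hermsymmx)%R)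
    (hideal : ideal H0 H1)
    (hdensity : density rhod) (hgeneric : generic rhod)
    (hstationary : commutator H0 rhod = 0%R) :
  measure_zero (n ^ 2 - n)%N (isospectral rhod)
    [set rho0 | isospectral rhod rho0 /\ ~ attracted H0 H1 rhod rho0]%classic.
Proof.
have [hrhod _ _] := hdensity.
have [U [a [hU hH0a _ hfreq b0]]] := hideal.
have {}hfreq (i j : 'I_n * 'I_n) :
    i.1 != i.2 -> j.1 != j.2 -> omega a i = omega a j -> i = j.
  by case: i j => [k l] [p q] /= kl pq; apply: hfreq.
(* A repeated eigenvalue of [H0] would make omega_kl and omega_lk both zero, against the
   distinctness of the frequencies. *)
have ainj : injective (a 0).
  move=> k l kl; apply/eqP/negPn/negP => kl'.
  have : (k, l) = (l, k).
    by apply: hfreq => //=; rewrite 1?eq_sym // /omega /= (kl : a 0 k = a 0 l).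
  by case=> e _; rewrite e eqxx in kl'.
(* As the spectrum of [H0] is simple, stationarity makes the target diagonal in its eigenbasis. *)
have hc : cj U rhod = cdiag (\row_k complex.Re (cj U rhod k k)).
  apply: (stationary_diagonal ainj); first exact: cj_herm.
  rewrite -hH0a -[commutator _ _](cj_commutator hU) hstationary.
  by rewrite /cj mulmx0 mul0mx.
apply: (not_attracted_null hU hH1 hH0a hc) => //.
- by apply: (generic_injective hgeneric); rewrite -hc /cj char_poly_conj.
- by case=> k l /= /b0.
by move=> x0; apply: solution_exists.
Qed.
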